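(* Let $W$ and $Z$ be Banach spaces with $Z$ separable, let $R:W\to Z$ be a bounded linear operator, let $K\subseteq Z^\ast$ be absolutely convex and weak$^\ast$-compact, and let $\epsilon>0$ be such that $R^\ast(K)$ contains an uncountable $\epsilon$-separated subset. Then for any $\delta>0$, any $\theta>0$, any downwards-closed subtree $\mathcal{T}\subseteq\Omega$, and any bijection $\tau:\omega\to\mathcal{T}$ such that $\tau(l)\sqsubseteq\tau(m)$ implies $l\le m$, there exist families $(w_t)_{t\in\mathcal{T}}\subseteq S_W$ and $(z_t^\ast)_{t\in\overline{\mathcal{T}}}\subseteq K$ such that: (i) for all $s\in\mathcal{T}$ and $t\in\overline{\mathcal{T}}$, $$\langle z_t^\ast,Rw_s\rangle=\begin{cases}\langle z_s^\ast,Rw_s\rangle>\frac{\epsilon}{2+\theta}&\text{if } s\sqsubseteq' t,\\ 0&\text{if } s\not\sqsubseteq' t;\end{cases}$$ (ii) the map $t\mapsto z_t^\ast$ from $\overline{\mathcal{T}}$ (with the coarse wedge topology) to $Z^\ast$ (with the weak$^\ast$ topology) is continuous; (iii) $(w_{\tau(m)})_{m=0}^\infty$ is a basic sequence with basis constant at most $1+\delta$; (iv) with $Z_0:=\bigcap_{t\in\mathcal{T}}\ker(z_t^\ast)$ and $Q:Z\to Z/Z_0$ the quotient map, $(QRw_{\tau(m)})_{m=0}^\infty$ is a (Schauder) basis for $Z/Z_0$ with basis constant at most $1+\delta$.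
   Context: Banach spaces are real or complex. $S_W$ is the unit sphere of $W$. A subset $A$ of a Banach space is $\epsilon$-separated if $\|x-y\|>\epsilon$ for all distinct $x,y\in A$. $\Omega$ denotes the set of all finite (possibly empty) sequences of natural numbers $\{0,1,2,\dots\}$, partially ordered by $s\sqsubseteq t$ iff $s$ is an initial segment of $t$; a subset $\mathcal{T}\subseteq\Omega$ is downwards closed if $t\in\mathcal{T}$ and $s\sqsubseteq t$ imply $s\in\mathcal{T}$. For such $\mathcal{T}$, $\partial\mathcal{T}$ denotes the set of infinite branches of $\mathcal{T}$ (infinite maximal totally ordered subsets of $\mathcal{T}$, each being a set of finite sequences), and $\overline{\mathcal{T}}:=\mathcal{T}\cup\partial\mathcal{T}$. On $\overline{\mathcal{T}}$ define the partial order $\sqsubseteq'$ by: $s\sqsubseteq' t$ iff either $s,t\in\Omega$ and $s\sqsubseteq t$; or $s\in\Omega$, $t\in\partial\mathcal{T}$ and $s\in t$; or $s=t\in\partial\mathcal{T}$. The coarse wedge topology on $\overline{\mathcal{T}}$ is the topology having as a subbase all sets $\{u\in\overline{\mathcal{T}}: t\sqsubseteq' u\}$ and their complements $\overline{\mathcal{T}}\setminus\{u\in\overline{\mathcal{T}}: t\sqsubseteq' u\}$, for $t\in\mathcal{T}$; it is compact Hausdorff. *)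

(* Defs.v *)
From Stdlib Require Import Reals Lra List Classical ClassicalEpsilon.
Open Scope R_scope.
Set Implicit Arguments.

Record Cpx := mkC { re : R; im : R }.
Definition Cadd (x y : Cpx) := mkC (re x + re y) (im x + im y).
Definition Cmul (x y : Cpx) :=
  mkC (re x * re y - im x * im y) (re x * im y + im x * re y).
Definition Copp (x : Cpx) := mkC (- re x) (- im x).
Definition Cabs (x : Cpx) := sqrt (re x ^ 2 + im x ^ 2).

Definition K (b : bool) : Type := if b then Cpx else R.
Definition K0 (b : bool) : K b := match b return K b with true => mkC 0 0 | false => 0 end.
Definition K1 (b : bool) : K b := match b return K b with true => mkC 1 0 | false => 1 end.
Definition KofR (b : bool) (r : R) : K b :=
  match b return K b with true => mkC r 0 | false => r end.
Definition Kadd (b : bool) : K b -> K b -> K b :=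
  match b return K b -> K b -> K b with true => Cadd | false => Rplus end.
Definition Kmul (b : bool) : K b -> K b -> K b :=
  match b return K b -> K b -> K b with true => Cmul | false => Rmult end.
Definition Kopp (b : bool) : K b -> K b :=
  match b return K b -> K b with true => Copp | false => Ropp end.
Definition Kabs (b : bool) : K b -> R :=
  match b return K b -> R with true => Cabs | false => Rabs end.
Arguments Kadd {b}. Arguments Kmul {b}. Arguments Kopp {b}. Arguments Kabs {b}.
Definition Ksub {b : bool} (x y : K b) : K b := Kadd x (Kopp y).
Definition Kgt (b : bool) : K b -> R -> Prop :=
  match b return K b -> R -> Prop with
  | true => fun x r => im x = 0 /\ r < re x
  | false => fun x r => r < x end.

Arguments Kgt {b}.
(* supremum of a set of reals (0 if empty or unbounded) *)
Definition Rsup (E : R -> Prop) : R :=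
  match excluded_middle_informative (bound E /\ exists x, E x) with
  | left H => proj1_sig (completeness E (proj1 H) (proj2 H))
  | right _ => 0
  end.

Record NormedSpace (b : bool) := {
  carrier :> Type;
  vzero : carrier;
  vadd : carrier -> carrier -> carrier;
  vopp : carrier -> carrier;
  vscale : K b -> carrier -> carrier;
  vnorm : carrier -> R;
  vadd_assoc : forall x y z, vadd x (vadd y z) = vadd (vadd x y) z;
  vadd_comm : forall x y, vadd x y = vadd y x;
  vadd_0 : forall x, vadd x vzero = x;
  vadd_opp : forall x, vadd x (vopp x) = vzero;
  vscale_1 : forall x, vscale (K1 b) x = x;
  vscale_assoc : forall a c x, vscale a (vscale c x) = vscale (Kmul a c) x;
  vscale_distr_v : forall a x y, vscale a (vadd x y) = vadd (vscale a x) (vscale a y);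
  vscale_distr_K : forall a c x, vscale (Kadd a c) x = vadd (vscale a x) (vscale c x);
  vnorm_def : forall x, vnorm x = 0 -> x = vzero;
  vnorm_scale : forall a x, vnorm (vscale a x) = Kabs a * vnorm x;
  vnorm_tri : forall x y, vnorm (vadd x y) <= vnorm x + vnorm y
}.
Arguments vzero {b} _.
Arguments vadd {b} _ _ _.
Arguments vopp {b} _ _.
Arguments vscale {b} _ _ _.
Arguments vnorm {b} _ _.

Definition vsub b (X : NormedSpace b) (x y : X) : X := vadd X x (vopp X y).

Definition complete b (X : NormedSpace b) : Prop :=
  forall u : nat -> X,
    (forall e, 0 < e -> exists N, forall m n, (N <= m)%nat -> (N <= n)%nat ->
        vnorm X (vsub X (u m) (u n)) < e) ->
    exists l : X, forall e, 0 < e -> exists N, forall n, (N <= n)%nat ->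
        vnorm X (vsub X (u n) l) < e.

Definition separable b (X : NormedSpace b) : Prop :=
  exists d : nat -> X, forall x e, 0 < e -> exists n, vnorm X (vsub X x (d n)) < e.

Definition sphere b (X : NormedSpace b) (x : X) : Prop := vnorm X x = 1.

Definition bounded_linear_op b (X Y : NormedSpace b) (f : X -> Y) : Prop :=
  (forall x y, f (vadd X x y) = vadd Y (f x) (f y)) /\
  (forall a x, f (vscale X a x) = vscale Y a (f x)) /\
  (exists C, forall x, vnorm Y (f x) <= C * vnorm X x).

Definition bounded_linear_fun b (X : NormedSpace b) (f : X -> K b) : Prop :=
  (forall x y, f (vadd X x y) = Kadd (f x) (f y)) /\
  (forall a x, f (vscale X a x) = Kmul a (f x)) /\
  (exists C, forall x, Kabs (f x) <= C * vnorm X x).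

Definition dual_norm b (X : NormedSpace b) (f : X -> K b) : R :=
  Rsup (fun r => exists x, vnorm X x <= 1 /\ r = Kabs (f x)).

Definition gen_open (X : Type) (S : (X -> Prop) -> Prop) (U : X -> Prop) : Prop :=
  forall x, U x -> exists l : list (X -> Prop),
    Forall S l /\ Forall (fun V => V x) l /\
    (forall y, Forall (fun V => V y) l -> U y).

Definition compact_in (X : Type) (opn : (X -> Prop) -> Prop) (A : X -> Prop) : Prop :=
  forall (I : Type) (U : I -> X -> Prop), (forall i, opn (U i)) ->
    (forall x, A x -> exists i, U i x) ->
    exists l : list I, forall x, A x -> exists i, In i l /\ U i x.

Definition continuous_on (X Y : Type) (opnX : (X -> Prop) -> Prop) (A : X -> Prop)
    (opnY : (Y -> Prop) -> Prop) (f : X -> Y) : Prop :=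
  forall V, opnY V -> exists U, opnX U /\ forall x, A x -> (U x <-> V (f x)).

(* weak* topology on functionals Z -> K b (restricted to Z^* it is the weak* topology) *)
Definition weakstar_subbase b (Z : NormedSpace b) (U : (Z -> K b) -> Prop) : Prop :=
  exists (z : Z) (a : K b) (r : R), 0 < r /\
    forall f, U f <-> Kabs (Ksub (f z) a) < r.
Definition weakstar_open b (Z : NormedSpace b) := gen_open (@weakstar_subbase b Z).

Definition absolutely_convex b (Z : NormedSpace b) (Ks : (Z -> K b) -> Prop) : Prop :=
  forall f g (a c : K b), Ks f -> Ks g -> Kabs a + Kabs c <= 1 ->
    Ks (fun z => Kadd (Kmul a (f z)) (Kmul c (g z))).

Definition uncountable (X : Type) (A : X -> Prop) : Prop :=
  ~ exists e : nat -> X, forall x, A x -> exists n, e n = x.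

Definition eps_separated b (W : NormedSpace b) (eps : R) (A : (W -> K b) -> Prop) : Prop :=
  forall f g, A f -> A g -> f <> g -> dual_norm W (fun w => Ksub (f w) (g w)) > eps.

Definition prefix (s t : list nat) : Prop := exists r, t = s ++ r.
Definition down_closed (T : list nat -> Prop) : Prop :=
  forall s t, T t -> prefix s t -> T s.
Definition chain (C : list nat -> Prop) : Prop :=
  forall s t, C s -> C t -> prefix s t \/ prefix t s.
Definition is_branch (T B : list nat -> Prop) : Prop :=
  (forall s, B s -> T s) /\ chain B /\
  (~ exists l : list (list nat), forall s, B s -> In s l) /\
  (forall C, (forall s, C s -> T s) -> chain C -> (forall s, B s -> C s) ->
     forall s, C s -> B s).

Inductive tpoint := Node (s : list nat) | Branch (B : list nat -> Prop).
Definition in_Tbar (T : list nat -> Prop) (u : tpoint) : Prop :=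
  match u with Node s => T s | Branch B => is_branch T B end.
Definition le' (u v : tpoint) : Prop :=
  match u, v with
  | Node s, Node t => prefix s t
  | Node s, Branch B => B s
  | Branch B, Branch B' => forall s, B s <-> B' s
  | Branch _, Node _ => False
  end.
Definition wedge_subbase (T : list nat -> Prop) (U : tpoint -> Prop) : Prop :=
  exists t, T t /\
    ((forall u, U u <-> le' (Node t) u) \/ (forall u, U u <-> ~ le' (Node t) u)).
(* coarse wedge topology (on tpoint; used via the subspace in_Tbar T) *)
Definition wedge_open (T : list nat -> Prop) := gen_open (wedge_subbase T).

Fixpoint lin_comb b (X : NormedSpace b) (a : nat -> K b) (x : nat -> X) (n : nat) : X :=
  match n with
  | O => vzero X
  | S k => vadd X (lin_comb X a x k) (vscale X (a k) (x k))
  end.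
Definition series_conv b (X : NormedSpace b) (p : X -> R) (a : nat -> K b)
    (x : nat -> X) (y : X) : Prop :=
  forall e, 0 < e -> exists N, forall n, (N <= n)%nat -> p (vsub X y (lin_comb X a x n)) < e.
Definition basis_of b (X : NormedSpace b) (p : X -> R) (x : nat -> X) (Sp : X -> Prop)
    (C : R) : Prop :=
  (forall y, Sp y -> exists a, series_conv X p a x y) /\
  (forall y a a', Sp y -> series_conv X p a x y -> series_conv X p a' x y ->
     forall i, a i = a' i) /\
  (forall y a n, Sp y -> series_conv X p a x y -> p (lin_comb X a x n) <= C * p y).
Definition closed_span b (X : NormedSpace b) (p : X -> R) (x : nat -> X) (y : X) : Prop :=
  forall e, 0 < e -> exists a n, p (vsub X y (lin_comb X a x n)) < e.
Definition basic_seq b (X : NormedSpace b) (x : nat -> X) (C : R) : Prop :=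
  basis_of X (vnorm X) x (closed_span X (vnorm X) x) C.
(* quotient norm of Z/Z0 evaluated at the class of z: inf_{z0 in Z0} ||z - z0|| *)
Definition quot_norm b (Z : NormedSpace b) (Z0 : Z -> Prop) (z : Z) : R :=
  - Rsup (fun r => exists z0, Z0 z0 /\ r = - vnorm Z (vsub Z z z0)).

(* Main.v *)
Require Import Defs.
From mathcomp Require classical_sets.
From Stdlib Require Import Reals List Lra Lia ZArith Cantor.
From Stdlib Require Import Classical ClassicalEpsilon FunctionalExtensionality PropExtensionality.
Open Scope R_scope.
Set Implicit Arguments.

(** Choose preimages in [K] of the separated family and keep an uncountable, norm bounded set
    [G] of them all of whose points are weak* condensation points of [G]. Along the enumeration
    [tau] one builds unit vectors [w_n] and functionals [z_n = lam g_n + u_n] with [g_n] in [G]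
    weak* close to [g_p], where [tau p] is the parent of [tau n], and [u_n] in [(1 - lam) K].
    A finite-dimensional space of functionals is within [r < eps/2] of only countably many
    members of an [eps]-separated family, so [g_n] can be taken at distance more than [r] from the
    finitely many functionals used before; by Hahn-Banach some unit vector [w_n] is killed by
    all of them while [g_n (R w_n) > r]. As [(z_i - z_p(i)) / z_i (R w_i)] is biorthogonal to
    [R w_i], a small combination of earlier functionals added to [u_n] makes
    [z_n (R w_i) = z_p (R w_i)] exact for [i < n].

    Letting [w_n] be killed by functionals that almost norm [span (w_i)_{i<n}] gives (iii), as in
    Mazur's construction of basic sequences. For (iv), [z_n - z_p] is made small on a dense
    sequence and on finite sets that approximate the unit ball of [Z] for the earlier functionals,
    as in the Johnson-Rosenthal construction of weak* basic sequences. *)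

(** * Scalars *)

Declare Scope K_scope.
Delimit Scope K_scope with K.
Notation "x + y" := (Kadd x y) : K_scope.
Notation "x * y" := (Kmul x y) : K_scope.
Notation "x - y" := (Ksub x y) : K_scope.
Notation "- x" := (Kopp x) : K_scope.
Notation "0" := (K0 _) : K_scope.
Notation "1" := (K1 _) : K_scope.

(** Two functionals within [r] of the same element of a span are within [2 * r] of each other, so
    the distance argument works for [2 * r < eps]; this is the origin of the 2 in
    [eps / (2 + theta)]. The slack [theta] is spent twice: on taking [r] strictly between
    [eps / (2 + theta)] and [eps / 2], and on [lam < 1] with [lam * r] still above
    [eps / (2 + theta)]. The obstacle is that (i) asks for exact values while condensation gives
    approximate ones, and that the corrections must not lead out of [K]: the share [1 - lam] of [K]
    is reserved for them. The new vector is killed by the earlier [g_i] as well as by the [z_i], so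
    that [z_n (R w_n)] equals [lam * g_n (R w_n)] whatever the corrections are. Parents precede
    children under [tau], so one recursion over the natural numbers suffices. Because [z_n - z_p(n)]
    shrinks like [2^-n], its sums along paths of the tree converge; the same estimate gives the
    continuity in (ii), where a branch functional is a cluster point of the functionals on its
    nodes, and the convergent expansions in (iv). *)

Lemma Cpx_eq (x y : Cpx) : re x = re y -> im x = im y -> x = y.
Proof. destruct x, y; simpl; intros; subst; reflexivity. Qed.

Lemma K_ring_theory (b : bool) :
  ring_theory (K0 b) (K1 b) (@Kadd b) (@Kmul b) (@Ksub b) (@Kopp b) eq.
Proof.
  destruct b; constructor; intros; try (simpl; ring); apply Cpx_eq; simpl; ring.
Qed.

Definition Kre {b} : K b -> R := match b return K b -> R with true => re | false => fun x => x end.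

Definition Kim {b} : K b -> R := match b return K b -> R with true => im | false => fun _ => 0 end.

Definition Kinv {b} : K b -> K b :=
  match b return K b -> K b with
  | true => fun x => mkC (re x / (re x ^ 2 + im x ^ 2)) (- im x / (re x ^ 2 + im x ^ 2))
  | false => Rinv
  end.

Lemma Kre_le {b} (a : K b) : Rabs (Kre a) <= Kabs a.
Proof.
  destruct b; simpl; [|lra]. unfold Cabs. rewrite <- (sqrt_Rsqr_abs (re a)).
  apply sqrt_le_1_alt. unfold Rsqr. nra.
Qed.

Lemma Kim_le {b} (a : K b) : Rabs (Kim a) <= Kabs a.
Proof.
  destruct b; simpl.
  - unfold Cabs. rewrite <- (sqrt_Rsqr_abs (im a)). apply sqrt_le_1_alt. unfold Rsqr. nra.
  - rewrite Rabs_R0. apply Rabs_pos.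
Qed.

Lemma Kabs_le_re_im {b} (a : K b) : Kabs a <= Rabs (Kre a) + Rabs (Kim a).
Proof.
  destruct b; simpl.
  - unfold Cabs. pose proof (Rabs_pos (re a)). pose proof (Rabs_pos (im a)).
    rewrite <- (sqrt_Rsqr (Rabs (re a) + Rabs (im a))) by lra.
    apply sqrt_le_1_alt. pose proof (pow2_abs (re a)). pose proof (pow2_abs (im a)).
    unfold Rsqr. nra.
  - rewrite Rabs_R0. lra.
Qed.

Lemma Kre_sub {b} (a c : K b) : Kre (a - c)%K = Kre a - Kre c.
Proof. destruct b; simpl; unfold Rminus; auto. Qed.

Lemma Kim_sub {b} (a c : K b) : Kim (a - c)%K = Kim a - Kim c.
Proof. destruct b; simpl; unfold Rminus; auto; ring. Qed.

Lemma Kabs_pos {b} (a : K b) : 0 <= Kabs a.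
Proof. destruct b; simpl; [apply sqrt_pos | apply Rabs_pos]. Qed.

Lemma Kabs_0 b : Kabs (K0 b) = 0.
Proof.
  destruct b; simpl; [|apply Rabs_R0].
  unfold Cabs; simpl. replace (0 * (0 * 1) + 0 * (0 * 1)) with 0 by ring. apply sqrt_0.
Qed.

Lemma Kabs_ofR b (r : R) : Kabs (KofR b r) = Rabs r.
Proof.
  destruct b; simpl; auto. unfold Cabs; simpl. rewrite <- sqrt_Rsqr_abs. f_equal.
  unfold Rsqr. ring.
Qed.

Lemma Kabs_1 b : Kabs (K1 b) = 1.
Proof. transitivity (Kabs (KofR b 1)); [destruct b; reflexivity|]. rewrite Kabs_ofR. apply Rabs_R1. Qed.

Lemma Kabs_opp {b} (a : K b) : Kabs (- a)%K = Kabs a.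
Proof.
  destruct b; simpl; [|apply Rabs_Ropp]. unfold Cabs; simpl. f_equal. ring.
Qed.

Lemma Kabs_mul {b} (a c : K b) : Kabs (a * c)%K = Kabs a * Kabs c.
Proof.
  destruct b; simpl; [|apply Rabs_mult]. unfold Cabs; simpl. rewrite <- sqrt_mult by nra.
  f_equal. ring.
Qed.

Lemma Kabs_tri {b} (a c : K b) : Kabs (a + c)%K <= Kabs a + Kabs c.
Proof.
  destruct b; simpl; [|apply Rabs_triang]. unfold Cabs, Cadd; simpl.
  set (x := re a); set (y := im a); set (u := re c); set (v := im c).
  set (p := sqrt (x * (x * 1) + y * (y * 1))). set (q := sqrt (u * (u * 1) + v * (v * 1))).
  assert (Hp : p * p = x * x + y * y) by (unfold p; rewrite sqrt_sqrt; nra).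
  assert (Hq : q * q = u * u + v * v) by (unfold q; rewrite sqrt_sqrt; nra).
  assert (Hp0 : 0 <= p) by apply sqrt_pos. assert (Hq0 : 0 <= q) by apply sqrt_pos.
  rewrite <- (sqrt_Rsqr (p + q)) by lra. apply sqrt_le_1_alt. unfold Rsqr.
  assert (x * u + y * v <= p * q).
  { destruct (Rle_dec (x * u + y * v) 0); [nra|]. apply Rsqr_incr_0_var; [|nra].
    unfold Rsqr. replace (p * q * (p * q)) with ((p * p) * (q * q)) by ring. rewrite Hp, Hq.
    pose proof (Rle_0_sqr (x * v - y * u)). unfold Rsqr in *. nra. }
  nra.
Qed.

Lemma Kabs_eq0 {b} (a : K b) : Kabs a = 0 -> a = K0 b.
Proof.
  intros H. pose proof (Kre_le a). pose proof (Kim_le a). rewrite H in *.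
  destruct b; simpl in *.
  - apply Cpx_eq; simpl; [destruct (Req_dec (re a) 0) as [|E] | destruct (Req_dec (im a) 0) as [|E]];
      auto; apply Rabs_pos_lt in E; lra.
  - destruct (Req_dec a 0) as [|E]; auto. apply Rabs_pos_lt in E; lra.
Qed.

Lemma Kinv_l {b} (a : K b) : a <> K0 b -> (Kinv a * a = 1)%K.
Proof.
  destruct b; simpl; intros H; [|apply Rinv_l; auto].
  assert (re a * re a + im a * im a <> 0).
  { intros E. apply H. apply Cpx_eq; simpl; nra. }
  apply Cpx_eq; simpl; field; auto; replace (re a * (re a * 1) + im a * (im a * 1))
    with (re a * re a + im a * im a) by ring; auto.
Qed.

Lemma Kabs_inv {b} (a : K b) : a <> K0 b -> Kabs (Kinv a) = / Kabs a.
Proof.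
  intros H. assert (Kabs a <> 0) by (intros E; apply H, Kabs_eq0, E).
  apply Rmult_eq_reg_r with (Kabs a); auto. rewrite <- Kabs_mul, Kinv_l, Kabs_1 by auto.
  field; auto.
Qed.

Lemma Kabs_sub_sym {b} (a c : K b) : Kabs (a - c)%K = Kabs (c - a)%K.
Proof.
  rewrite <- Kabs_opp. f_equal. destruct b; [apply Cpx_eq; simpl; ring|simpl; ring].
Qed.

Lemma KofR_mul b r s : KofR b (r * s) = (KofR b r * KofR b s)%K.
Proof. destruct b; [apply Cpx_eq; simpl; ring | reflexivity]. Qed.

Lemma KofR_add b r s : KofR b (r + s) = (KofR b r + KofR b s)%K.
Proof. destruct b; [apply Cpx_eq; simpl; ring | reflexivity]. Qed.

Lemma KofR_1 b : KofR b 1 = K1 b.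
Proof. destruct b; reflexivity. Qed.

Lemma KofR_0 b : KofR b 0 = K0 b.
Proof. destruct b; reflexivity. Qed.

Lemma Kgt_ofR b r s : s < r -> Kgt (KofR b r) s.
Proof. destruct b; simpl; auto. Qed.

(** Rotation onto the nonnegative reals. It turns a bound on real parts into one on moduli in the
    Hahn-Banach theorem, and makes the diagonal values in (i) positive reals also over the complex
    field. *)
Lemma K_phase {b} (a : K b) : exists u, Kabs u = 1 /\ (u * a)%K = KofR b (Kabs a).
Proof.
  destruct (classic (a = K0 b)) as [->|H].
  - exists (K1 b). split; [apply Kabs_1|]. rewrite Kabs_0, KofR_0.
    destruct b; [apply Cpx_eq; simpl; ring | simpl; ring].
  - assert (Kabs a <> 0) by (intros E; apply H, Kabs_eq0, E).
    exists (KofR b (Kabs a) * Kinv a)%K. split.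
    + rewrite Kabs_mul, Kabs_inv, Kabs_ofR, Rabs_pos_eq by (auto; apply Kabs_pos). field; auto.
    + pose proof (Kinv_l H) as E. pose proof (K_ring_theory b) as T.
      rewrite <- (Rmul_assoc T), E, (Rmul_comm T), (Rmul_1_l T). reflexivity.
Qed.

(** * Vectors, functionals and linear combinations *)

Declare Scope V_scope.
Delimit Scope V_scope with V.
Notation "x + y" := (vadd _ x y) : V_scope.
Notation "x - y" := (vsub _ x y) : V_scope.
Notation "- x" := (vopp _ x) : V_scope.
Notation "0" := (vzero _) : V_scope.
Notation "a *: x" := (vscale _ a x) (at level 40, left associativity) : V_scope.
Notation norm x := (vnorm _ x).

Section VectorIdentities.
Context {b : bool} {X : NormedSpace b}.
Add Ring K_ring : (K_ring_theory b).
Implicit Types (x y : X) (a c : K b).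

Lemma vadd_cancel x y z : (x + z = y + z -> x = y)%V.
Proof.
  intros H. rewrite <- (vadd_0 X x), <- (vadd_0 X y), <- (vadd_opp X z), !vadd_assoc, H.
  reflexivity.
Qed.

Lemma vscale_0_l x : (K0 b *: x = 0)%V.
Proof.
  apply (@vadd_cancel _ _ (K0 b *: x)%V). rewrite <- vscale_distr_K, vadd_comm, vadd_0.
  f_equal. ring.
Qed.

Lemma vscale_0_r a : (a *: vzero X = 0)%V.
Proof.
  rewrite <- (vscale_0_l (vzero X)), vscale_assoc. f_equal. ring.
Qed.

Lemma vopp_scale x : (- x = Kopp (K1 b) *: x)%V.
Proof.
  apply (@vadd_cancel _ _ x). rewrite vadd_comm, vadd_opp.
  rewrite <- (vscale_1 X x) at 2. rewrite <- vscale_distr_K, <- (vscale_0_l x). f_equal. ring.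
Qed.

(* The square-zero extension of K by X is a commutative ring containing both, so that
   [ring] decides vector identities. *)
Definition sqz_add (p q : K b * X) := (Kadd (fst p) (fst q), vadd X (snd p) (snd q)).
Definition sqz_mul (p q : K b * X) : K b * X :=
  (Kmul (fst p) (fst q), vadd X (vscale X (fst p) (snd q)) (vscale X (fst q) (snd p))).
Definition sqz_opp (p : K b * X) := (Kopp (fst p), vopp X (snd p)).
Definition sqz_scalar a : K b * X := (a, vzero X).
Definition sqz_vector x : K b * X := (K0 b, x).

Lemma sqz_ring_theory :
  ring_theory (sqz_scalar (K0 b)) (sqz_scalar (K1 b)) sqz_add sqz_mul
    (fun p q => sqz_add p (sqz_opp q)) sqz_opp eq.
Proof.
  assert (AC : forall p q r s : X, vadd X (vadd X p q) (vadd X r s) = vadd X (vadd X p r) (vadd X q s)).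
  { intros. rewrite <- !vadd_assoc. f_equal. rewrite !vadd_assoc. f_equal. apply vadd_comm. }
  constructor; intros; repeat match goal with p : prod _ _ |- _ => destruct p end;
    unfold sqz_add, sqz_mul, sqz_opp, sqz_scalar; simpl; f_equal; try ring.
  - rewrite vadd_comm. apply vadd_0.
  - apply vadd_comm.
  - apply vadd_assoc.
  - rewrite vscale_1, vscale_0_r. apply vadd_0.
  - apply vadd_comm.
  - rewrite !vscale_distr_v, !vscale_assoc, vadd_assoc. f_equal; [f_equal|]; f_equal; ring.
  - rewrite !vscale_distr_v, !vscale_distr_K. apply AC.
  - apply vadd_opp.
Qed.

Lemma sqz_vector_inj x y : sqz_vector x = sqz_vector y -> x = y.
Proof. intros H. injection H. auto. Qed.
Lemma sqz_vector_add x y : sqz_vector (x + y)%V = sqz_add (sqz_vector x) (sqz_vector y).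
Proof. unfold sqz_vector, sqz_add; simpl; f_equal; ring. Qed.
Lemma sqz_vector_opp x : sqz_vector (- x)%V = sqz_opp (sqz_vector x).
Proof. unfold sqz_vector, sqz_opp; simpl; f_equal; ring. Qed.
Lemma sqz_vector_0 : sqz_vector (vzero X) = sqz_scalar (K0 b).
Proof. reflexivity. Qed.
Lemma sqz_vector_scale a x : sqz_vector (a *: x)%V = sqz_mul (sqz_scalar a) (sqz_vector x).
Proof.
  unfold sqz_vector, sqz_mul, sqz_scalar; simpl; f_equal; [ring|].
  rewrite vscale_0_l, vadd_0. reflexivity.
Qed.
Lemma sqz_scalar_add a c : sqz_scalar (a + c)%K = sqz_add (sqz_scalar a) (sqz_scalar c).
Proof. unfold sqz_add, sqz_scalar; simpl; f_equal. symmetry; apply vadd_0. Qed.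
Lemma sqz_scalar_opp a : sqz_scalar (- a)%K = sqz_opp (sqz_scalar a).
Proof.
  unfold sqz_opp, sqz_scalar; simpl; f_equal. rewrite vopp_scale. symmetry; apply vscale_0_r.
Qed.
Lemma sqz_scalar_mul a c : sqz_scalar (a * c)%K = sqz_mul (sqz_scalar a) (sqz_scalar c).
Proof. unfold sqz_mul, sqz_scalar; simpl; f_equal. rewrite !vscale_0_r. symmetry; apply vadd_0. Qed.

End VectorIdentities.
Arguments sqz_ring_theory {b} X.

Ltac to_sqz :=
  apply sqz_vector_inj; unfold vsub, Ksub;
  repeat (rewrite ?sqz_vector_add, ?sqz_vector_opp, ?sqz_vector_0, ?sqz_vector_scale,
    ?sqz_scalar_add, ?sqz_scalar_opp, ?sqz_scalar_mul).
Ltac vring := to_sqz; ring.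

Definition linear_functional {b} (X : NormedSpace b) (f : X -> K b) : Prop :=
  (forall x y, f (x + y)%V = (f x + f y)%K) /\ (forall a x, f (a *: x)%V = (a * f x)%K).

Definition bounded_by {b} (X : NormedSpace b) (C : R) (f : X -> K b) : Prop :=
  forall x, Kabs (f x) <= C * norm x.

Section Norms.
Context {b : bool} {X : NormedSpace b}.
Add Ring K_ring : (K_ring_theory b).
Add Ring X_ring : (sqz_ring_theory X).
Implicit Types (x y : X) (a c : K b).

Lemma vnorm_0 : norm (vzero X) = 0.
Proof. rewrite <- (vscale_0_l 0%V), vnorm_scale, Kabs_0. ring. Qed.

Lemma vnorm_opp x : norm (- x)%V = norm x.
Proof. rewrite vopp_scale, vnorm_scale, Kabs_opp, Kabs_1. ring. Qed.

Lemma vnorm_pos x : 0 <= norm x.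
Proof.
  pose proof (vnorm_tri X x (- x)%V) as H. rewrite vadd_opp, vnorm_0, vnorm_opp in H. lra.
Qed.

Lemma vnorm_sub_sym x y : norm (x - y)%V = norm (y - x)%V.
Proof. rewrite <- vnorm_opp. f_equal. vring. Qed.

Lemma vnorm_sub_le x y z : norm (x - z)%V <= norm (x - y)%V + norm (y - z)%V.
Proof. replace (x - z)%V with ((x - y) + (y - z))%V by vring. apply vnorm_tri. Qed.

Lemma vnorm_le_sub x y : norm x <= norm (x - y)%V + norm y.
Proof. replace x with ((x - y) + y)%V at 1 by vring. apply vnorm_tri. Qed.

Lemma vsub_eq0 x y : (x - y = 0 -> x = y)%V.
Proof. intros H. transitivity ((x - y) + y)%V; [vring|]. rewrite H. vring. Qed.

Lemma linear_0 (f : X -> K b) : linear_functional X f -> f 0%V = 0%K.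
Proof. intros [_ H]. rewrite <- (vscale_0_l 0%V), H. ring. Qed.

Lemma linear_sub (f : X -> K b) x y :
  linear_functional X f -> f (x - y)%V = (f x - f y)%K.
Proof. intros [H H']. unfold vsub. rewrite H, vopp_scale, H'. ring. Qed.

Lemma bounded_combination C D (f g : X -> K b) a c :
  bounded_by X C f -> bounded_by X D g ->
  bounded_by X (Kabs a * C + Kabs c * D) (fun x => a * f x + c * g x)%K.
Proof.
  intros Hf Hg x. eapply Rle_trans; [apply Kabs_tri|]. rewrite !Kabs_mul.
  specialize (Hf x); specialize (Hg x). pose proof (Kabs_pos a). pose proof (Kabs_pos c). nra.
Qed.

End Norms.

(** Allows the lemmas on norms and on [lin_comb] to be used for scalars as well. *)
Definition Kspace (b : bool) : NormedSpace b.
Proof.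
  refine {| carrier := K b; vzero := K0 b; vadd := @Kadd b; vopp := @Kopp b;
            vscale := @Kmul b; vnorm := @Kabs b |}; pose proof (K_ring_theory b) as T; intros.
  - apply (Radd_assoc T).
  - apply (Radd_comm T).
  - rewrite (Radd_comm T). apply (Radd_0_l T).
  - apply (Ropp_def T).
  - apply (Rmul_1_l T).
  - apply (Rmul_assoc T).
  - rewrite !(Rmul_comm T a). apply (Rdistr_l T).
  - apply (Rdistr_l T).
  - apply Kabs_eq0; assumption.
  - apply Kabs_mul.
  - apply Kabs_tri.
Defined.

Lemma Ksub_le b (x y z : K b) : Kabs (x - z)%K <= Kabs (x - y)%K + Kabs (y - z)%K.
Proof. exact (@vnorm_sub_le b (Kspace b) x y z). Qed.

Lemma Kabs_le_sub b (x y : K b) : Kabs x <= Kabs (x - y)%K + Kabs y.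
Proof. exact (@vnorm_le_sub b (Kspace b) x y). Qed.

Lemma Ksub_eq0 b (x y : K b) : (x - y = 0)%K -> x = y.
Proof. exact (@vsub_eq0 b (Kspace b) x y). Qed.

Section LinearCombinations.
Context {b : bool} {X : NormedSpace b}.
Add Ring K_ring : (K_ring_theory b).
Add Ring X_ring : (sqz_ring_theory X).
Implicit Types (x : nat -> X) (a c : nat -> K b).

Lemma lin_comb_ext a a' x x' n :
  (forall i, (i < n)%nat -> a i = a' i) -> (forall i, (i < n)%nat -> x i = x' i) ->
  lin_comb X a x n = lin_comb X a' x' n.
Proof.
  induction n as [|n IH]; intros H H'; simpl; auto.
  rewrite IH, H, H'; auto.
Qed.

Lemma lin_comb_add a c x n :
  lin_comb X (fun i => a i + c i)%K x n = (lin_comb X a x n + lin_comb X c x n)%V.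
Proof. induction n as [|n IH]; simpl; [|rewrite IH]; vring. Qed.

Lemma lin_comb_scale s a x n :
  lin_comb X (fun i => s * a i)%K x n = (s *: lin_comb X a x n)%V.
Proof. induction n as [|n IH]; simpl; [|rewrite IH]; vring. Qed.

Lemma lin_comb_sub a c x n :
  lin_comb X (fun i => a i - c i)%K x n = (lin_comb X a x n - lin_comb X c x n)%V.
Proof. induction n as [|n IH]; simpl; [|rewrite IH]; vring. Qed.

Lemma lin_comb_0 a x n : (forall i, (i < n)%nat -> x i = 0%V) -> lin_comb X a x n = 0%V.
Proof.
  induction n as [|n IH]; intros H; simpl; auto. rewrite IH, H by auto. vring.
Qed.

Lemma linear_lin_comb (f : X -> K b) a x n :
  linear_functional X f -> f (lin_comb X a x n) = lin_comb (Kspace b) a (fun i => f (x i)) n.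
Proof.
  intros Hf. induction n as [|n IH]; simpl; [apply linear_0, Hf|].
  destruct Hf as [H H']. rewrite H, H', IH. reflexivity.
Qed.

Lemma vnorm_lin_comb_le a x n B :
  (forall i, (i < n)%nat -> Kabs (a i) * norm (x i) <= B) -> norm (lin_comb X a x n) <= INR n * B.
Proof.
  induction n as [|n IH]; intros H; [simpl; rewrite vnorm_0; lra|].
  rewrite S_INR. cbn [lin_comb]. eapply Rle_trans; [apply vnorm_tri|]. rewrite vnorm_scale.
  pose proof (H n (le_n _)). assert (norm (lin_comb X a x n) <= INR n * B) by (apply IH; auto). lra.
Qed.

End LinearCombinations.

(** The form in which biorthogonality is used, both for one functional on a combination of vectors
    and for a combination of functionals at one vector. *)
Lemma lin_comb_delta b (a : nat -> K b) (x : nat -> K b) j n :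
  (j < n)%nat -> x j = 1%K -> (forall i, (i < n)%nat -> i <> j -> x i = 0%K) ->
  lin_comb (Kspace b) a x n = a j.
Proof.
  pose proof (K_ring_theory b) as T.
  intros Hj Hx H.
  assert (E : forall m, (m <= n)%nat -> lin_comb (Kspace b) a x m = if lt_dec j m then a j else 0%K).
  { induction m as [|m IH]; intros Hm; [destruct (lt_dec j 0); [lia|reflexivity]|].
    cbn [lin_comb]. rewrite IH by lia. cbn.
    destruct (Nat.eq_dec m j) as [->|Hmj].
    - destruct (lt_dec j j); [lia|]. destruct (lt_dec j (S j)); [|lia].
      rewrite Hx, (Radd_0_l T), (Rmul_comm T). apply (Rmul_1_l T).
    - rewrite (H m) by lia.
      assert (E0 : (a m * 0 = 0)%K) by exact (@vscale_0_r b (Kspace b) (a m)).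
      rewrite E0, (Radd_comm T), (Radd_0_l T).
      destruct (lt_dec j m), (lt_dec j (S m)); auto; lia. }
  rewrite E by lia. destruct (lt_dec j n); [reflexivity|lia].
Qed.

(** * The Hahn-Banach theorem *)

Section RealHahnBanach.
Context {X : NormedSpace false} (C : R) (HC0 : 0 <= C).
Add Ring K_ring : (K_ring_theory false).
Add Ring X_ring : (sqz_ring_theory X).

(** Partial functionals are encoded by their graphs, so that extension is inclusion and chains have
    unions. Single-valuedness is a consequence: two values [u], [v] at [x] put [(0, u - v)] in the
    graph, and the bound at zero gives [u <= v]. *)
Definition dominated_graph (G : X * R -> Prop) : Prop :=
  G (vzero X, 0) /\
  (forall x a y c s, G (x, a) -> G (y, c) -> G (vadd X x (vscale X s y), a + s * c)) /\
  (forall x a, G (x, a) -> a <= C * norm x).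

Lemma dominated_graph_functional G x a c :
  dominated_graph G -> G (x, a) -> G (x, c) -> a = c.
Proof.
  intros (_ & HG & HC) Ha Hc.
  assert (D : forall u v, G (x, u) -> G (x, v) -> u <= v).
  { intros u v Hu Hv. pose proof (HG _ _ _ _ (-1) Hu Hv) as H. apply HC in H.
    replace (vadd X x (vscale X (-1) x)) with (vzero X) in H.
    - rewrite vnorm_0 in H. lra.
    - change (-1) with (Kopp (K1 false)). vring. }
  apply Rle_antisym; auto.
Qed.

Lemma dominated_graph_scale (s : R) G x a :
  dominated_graph G -> G (x, a) -> G (vscale X s x, s * a).
Proof.
  intros (H0 & HG & _) H. pose proof (HG _ _ _ _ s H0 H) as E.
  rewrite vadd_comm, vadd_0, Rplus_0_l in E. exact E.
Qed.

(** The value [c] at [x0] is the supremum of the lower bounds [a - C * norm (x - x0)], which by [M]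
    stay below all upper bounds [C * norm (y + x0) - d]. Division by the absolute value of [t]
    reduces the estimate at [x + t x0] to these two families. *)
Lemma dominated_graph_extend (x0 : X) G :
  dominated_graph G -> exists G', dominated_graph G' /\ (forall p, G p -> G' p) /\ exists c, G' (x0, c).
Proof.
  intros DG. pose proof DG as (H0 & HG & HC).
  assert (M : forall x a y d, G (x, a) -> G (y, d) ->
    a - C * norm (x - x0)%V <= C * norm (y + x0)%V - d).
  { intros x a y d Hx Hy. pose proof (HC _ _ (HG _ _ _ _ 1 Hx Hy)) as H.
    replace (vadd X x (vscale X 1 y)) with ((x - x0) + (y + x0))%V in H.
    2:{ change 1 with (K1 false). vring. }
    pose proof (vnorm_tri X (x - x0)%V (y + x0)%V). nra. }
  destruct (completeness (fun r => exists x a, G (x, a) /\ r = a - C * norm (x - x0)%V))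
    as [c [Hub Hlub]].
  { exists (C * norm (vzero X + x0)%V - 0). intros r (x & a & Ha & ->). apply M; auto. }
  { eexists. exists (vzero X), 0. eauto. }
  assert (L : forall x a, G (x, a) -> a - C * norm (x - x0)%V <= c) by (intros; apply Hub; eauto).
  assert (U : forall x a, G (x, a) -> c <= C * norm (x + x0)%V - a).
  { intros x a Ha. apply Hlub. intros r (x' & a' & Ha' & ->). apply M; auto. }
  exists (fun p => exists x a t, G (x, a) /\ p = (vadd X x (vscale X t x0), a + t * c)).
  repeat split.
  - exists (vzero X), 0, 0. split; auto. f_equal; [|ring].
    change 0 with (K0 false). vring.
  - intros x a y d s (x1 & a1 & t1 & G1 & E1) (x2 & a2 & t2 & G2 & E2).
    injection E1 as -> ->. injection E2 as -> ->.
    exists (vadd X x1 (vscale X s x2)), (a1 + s * a2), (t1 + s * t2). split; [auto|]. f_equal; [|ring].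
    change (t1 + s * t2) with (@Kadd false t1 (@Kmul false s t2)). vring.
  - intros x a (y & d & t & Hy & E). injection E as -> ->.
    destruct (Rtotal_order t 0) as [Ht|[->|Ht]].
    + pose proof (L _ _ (dominated_graph_scale (- / t) _ _ DG Hy)) as H.
      replace (norm (y + vscale X t x0)%V) with (- t * norm (vscale X (- / t)%R y - x0)%V).
      * apply Rmult_le_compat_l with (r := - t) in H; [|lra].
        replace (- t * (- / t * d - C * norm (vscale X (- / t)%R y - x0)%V))
          with (d - C * (- t * norm (vscale X (- / t)%R y - x0)%V)) in H by (field; lra). lra.
      * rewrite <- (Rabs_pos_eq (- t)) by lra. change (Rabs (- t)) with (@Kabs false (- t)).
        rewrite <- vnorm_scale. f_equal. unfold vsub.
        rewrite vscale_distr_v, vscale_assoc, vopp_scale, vscale_assoc.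
        replace (@Kmul false (- t) (- / t)) with (K1 false) by (simpl; field; lra).
        rewrite vscale_1. f_equal. f_equal. simpl. ring.
    + pose proof (HC _ _ Hy). replace (y + vscale X (0%R) x0)%V with y;
        [lra | change 0 with (K0 false); vring].
    + pose proof (U _ _ (dominated_graph_scale (/ t) _ _ DG Hy)) as H.
      replace (norm (y + vscale X t x0)%V) with (t * norm (vscale X (/ t)%R y + x0)%V).
      * apply Rmult_le_compat_l with (r := t) in H; [|lra].
        replace (t * (C * norm (vscale X (/ t)%R y + x0)%V - / t * d))
          with (C * (t * norm (vscale X (/ t)%R y + x0)%V) - d) in H by (field; lra). lra.
      * rewrite <- (Rabs_pos_eq t) at 1 by lra. change (Rabs t) with (@Kabs false t).
        rewrite <- vnorm_scale. f_equal.
        rewrite vscale_distr_v, vscale_assoc.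
        replace (@Kmul false t (/ t)) with (K1 false) by (simpl; field; lra).
        rewrite vscale_1. reflexivity.
  - intros [x a] Ha. exists x, a, 0. split; auto. f_equal; [|ring].
    change 0 with (K0 false). vring.
  - exists c, (vzero X), 0, 1. split; auto. f_equal; [|ring].
    change 1 with (K1 false). vring.
Qed.

Lemma Hahn_Banach_graph G0 :
  dominated_graph G0 ->
  exists f : X -> R, linear_functional X f /\ bounded_by X C f /\ forall x a, G0 (x, a) -> f x = a.
Proof.
  intros D0.
  set (P := fun G : X * R -> Prop =>
    (forall p, ~ G p) \/ (dominated_graph G /\ forall p, G0 p -> G p)).
  destruct (@classical_sets.Zorn_bigcup (X * R) P) as (G & PG & Gmax).
  { intros F FP Ftot.
    destruct (classic (exists G, F G /\ exists p, G p)) as [(G & FG & p & Gp)|N].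
    2:{ left. intros p [G FG Gp]. apply N. eauto. }
    assert (NE : forall G', F G' -> (exists p, G' p) -> dominated_graph G' /\ forall p, G0 p -> G' p).
    { intros G' FG' [q Gq]. destruct (FP G' FG') as [E|E]; [destruct (E q Gq)|exact E]. }
    destruct (NE G FG (ex_intro _ p Gp)) as [(H0 & HG & HC) Hsub].
    right. repeat split.
    - exists G; auto.
    - intros x a y c s [G1 F1 h1] [G2 F2 h2].
      destruct (NE G1 F1 (ex_intro _ _ h1)) as [(_ & HG1 & _) _].
      destruct (NE G2 F2 (ex_intro _ _ h2)) as [(_ & HG2 & _) _].
      destruct (Ftot _ _ F1 F2) as [I|I]; [exists G2 | exists G1]; auto.
    - intros x a [G1 F1 h1]. destruct (NE G1 F1 (ex_intro _ _ h1)) as [(_ & _ & HC1) _]. auto.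
    - intros q Hq. exists G; auto. }
  assert (DG : dominated_graph G /\ forall p, G0 p -> G p).
  { destruct PG as [E|E]; auto. exfalso. apply (Gmax G0).
    - split; [intros q Hq; destruct (E q Hq)|]. intros I. apply (E (vzero X, 0)), I, D0.
    - right; auto. }
  destruct DG as [DG Hsub].
  assert (tot : forall x, exists a, G (x, a)).
  { intros x. apply NNPP. intros N. destruct (dominated_graph_extend x DG) as (G' & DG' & I & c & Hc).
    apply (Gmax G').
    - split; [exact I|]. intros I'. apply N. exists c. apply I', Hc.
    - right. split; auto. }
  pose (f := fun x => proj1_sig (constructive_indefinite_description _ (tot x))).
  assert (Hf : forall x, G (x, f x)) by (intros x; apply proj2_sig).
  assert (fE : forall x a, G (x, a) -> f x = a).
  { intros x a Ha. exact (dominated_graph_functional _ _ _ DG (Hf x) Ha). }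
  pose proof DG as (H0 & HG & HC).
  assert (Lf : linear_functional X f).
  { split; intros; apply fE.
    - pose proof (HG _ _ _ _ 1 (Hf x) (Hf y)) as H. rewrite Rmult_1_l in H.
      change 1 with (K1 false) in H. rewrite vscale_1 in H. exact H.
    - apply dominated_graph_scale; auto. }
  exists f. split; [exact Lf|]. split; [|auto].
  intros x. simpl. apply Rabs_le. split; [|apply HC, Hf].
  pose proof (HC _ _ (dominated_graph_scale (-1) _ _ DG (Hf x))) as H.
  rewrite vnorm_scale in H. simpl in H. rewrite (Rabs_left (-1)) in H by lra. lra.
Qed.

End RealHahnBanach.

Definition realify {b} (X : NormedSpace b) : NormedSpace false.
Proof.
  refine {| carrier := X; vzero := vzero X; vadd := vadd X; vopp := vopp X;
            vscale := fun r : K false => vscale X (KofR b r); vnorm := vnorm X |}.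
  - apply vadd_assoc.
  - apply vadd_comm.
  - apply vadd_0.
  - apply vadd_opp.
  - intros x. change (K1 false) with 1. rewrite KofR_1. apply vscale_1.
  - intros a c x. rewrite vscale_assoc. f_equal. symmetry. apply KofR_mul.
  - intros. apply vscale_distr_v.
  - intros a c x. rewrite <- vscale_distr_K. f_equal. apply KofR_add.
  - apply vnorm_def.
  - intros a x. rewrite vnorm_scale, Kabs_ofR. reflexivity.
  - apply vnorm_tri.
Defined.

(** In the complex case the real part of [f] is extended to a real functional [g], and
    [F x = g x - i g (i x)]. The bound is not lost: rotating [x] so that [F] is real there makes the
    modulus of [F x] a value of [g]. *)
Theorem Hahn_Banach b (X : NormedSpace b) (C : R) (S : X -> Prop) (f : X -> K b) :
  0 <= C -> S (vzero X) ->
  (forall x y a, S x -> S y -> S (x + a *: y)%V /\ f (x + a *: y)%V = (f x + a * f y)%K) ->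
  (forall x, S x -> Kabs (f x) <= C * norm x) ->
  exists F, linear_functional X F /\ bounded_by X C F /\ forall x, S x -> F x = f x.
Proof.
  intros HC0 S0 HS Hf.
  pose (G := fun p : realify X * R => S (fst p) /\ snd p = Kre (f (fst p))).
  assert (f0 : f 0%V = 0%K).
  { apply Kabs_eq0. pose proof (Hf _ S0) as H. pose proof (Kabs_pos (f (vzero X))).
    rewrite vnorm_0 in H. lra. }
  assert (re_lin : forall (a c : K b) r, Kre (a + KofR b r * c)%K = Kre a + r * Kre c).
  { intros. destruct b; simpl; ring. }
  assert (D : dominated_graph C G).
  { split; [|split].
    - split; [exact S0|]. simpl. rewrite f0. destruct b; reflexivity.
    - intros x a y c s [Hx Ea] [Hy Ec]; simpl in Hx, Ea, Hy, Ec; subst a c. destruct (HS _ _ (KofR b s) Hx Hy) as [H E].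
      split; [exact H|]. simpl in *. rewrite E. symmetry. apply re_lin.
    - intros x a [Hx Ea]; simpl in Hx, Ea; subst a. eapply Rle_trans; [|apply Hf, Hx].
      eapply Rle_trans; [apply Rle_abs | apply Kre_le]. }
  destruct (Hahn_Banach_graph HC0 D) as (g & [g1 g2] & g3 & g4).
  assert (gre : forall x, S x -> g x = Kre (f x)) by (intros x Hx; apply g4; split; auto).
  clear D G re_lin g4. simpl in g1, g2.
  destruct b; [|exists g; split; [split|split]; auto].
  pose (i := mkC 0 1 : K true).
  assert (gs : forall (a : K true) (x : X), g (a *: x)%V = re a * g x + im a * g (i *: x)%V).
  { intros a x. rewrite <- (g2 (im a)), <- (g2 (re a)), <- g1. f_equal. simpl.
    rewrite vscale_assoc, <- vscale_distr_K. f_equal. apply Cpx_eq; simpl; ring. }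
  pose (F := fun x : X => mkC (g x) (- g (i *: x)%V) : K true).
  assert (FL : linear_functional X F).
  { split.
    - intros x y. unfold F. rewrite vscale_distr_v, !g1. apply Cpx_eq; simpl; ring.
    - intros a x. unfold F. rewrite vscale_assoc, (gs a), (gs (i * a)%K).
      apply Cpx_eq; simpl; ring. }
  exists F. split; [exact FL|]. split.
  - intros x. destruct (K_phase (F x)) as (u & Hu & E).
    destruct FL as [_ FL]. rewrite <- FL in E.
    assert (E' : g (u *: x)%V = Kabs (F x)) by (injection E; auto).
    rewrite <- E'. eapply Rle_trans; [apply Rle_abs|]. eapply Rle_trans; [apply g3|].
    simpl. rewrite vnorm_scale, Hu. lra.
  - intros x Hx. destruct (HS _ _ i S0 Hx) as [Hi E].
    rewrite vadd_comm, vadd_0 in Hi, E. unfold F. rewrite gre, (gre _ Hi), E, f0 by auto.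
    apply Cpx_eq; simpl; ring.
Qed.

Corollary norming_functional b (X : NormedSpace b) (e : X) :
  exists F, linear_functional X F /\ bounded_by X 1 F /\ F e = KofR b (norm e).
Proof.
  pose proof (K_ring_theory b) as T.
  destruct (classic (norm e = 0)) as [E0|Hn].
  { exists (fun _ => K0 b). rewrite E0, KofR_0. split; [split|split]; auto.
    - intros. symmetry. apply (Radd_0_l T).
    - intros a _. symmetry. exact (@vscale_0_r b (Kspace b) a).
    - intros x. rewrite Kabs_0. pose proof (vnorm_pos x). lra. }
  assert (inj : forall s t : K b, (s *: e = t *: e)%V -> s = t).
  { intros s t E. apply Ksub_eq0, Kabs_eq0. apply Rmult_eq_reg_r with (norm e); auto.
    rewrite <- vnorm_scale. unfold Ksub. rewrite vscale_distr_K, E, <- vscale_distr_K.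
    rewrite (Ropp_def T), vscale_0_l, vnorm_0. ring. }
  pose (S := fun x : X => exists s : K b, x = (s *: e)%V).
  pose (c := fun x : X => epsilon (inhabits (K0 b)) (fun s => x = (s *: e)%V)).
  assert (cE : forall s, c (s *: e)%V = s).
  { intros s. symmetry. apply inj. unfold c. apply epsilon_spec. eauto. }
  pose (f := fun x : X => (c x * KofR b (norm e))%K).
  assert (fE : forall s, f (s *: e)%V = (s * KofR b (norm e))%K) by (intros; unfold f; rewrite cE; auto).
  destruct (@Hahn_Banach b X 1 S f) as (F & F1 & F2 & F3).
  - lra.
  - exists (K0 b). symmetry. apply vscale_0_l.
  - intros x y a [s ->] [t ->]. rewrite vscale_assoc, <- vscale_distr_K. split; [eexists; eauto|].
    rewrite !fE, (Rdistr_l T), (Rmul_assoc T). reflexivity.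
  - intros x [s ->]. rewrite fE, Kabs_mul, vnorm_scale, Kabs_ofR, Rabs_pos_eq by apply vnorm_pos. lra.
  - exists F. split; [|split]; auto.
    rewrite <- (vscale_1 X e) at 1. rewrite F3 by (exists (K1 b); auto).
    rewrite fE, (Rmul_1_l T). reflexivity.
Qed.

(** * Countability, condensation and separated families *)

(** An injection into [nat], rather than the enumeration in [uncountable], passes to subsets at once
    and covers the empty set. *)
Definition countable_set {X : Type} (A : X -> Prop) : Prop :=
  exists c : X -> nat, forall x y, A x -> A y -> c x = c y -> x = y.

Lemma to_nat_inj p q : to_nat p = to_nat q -> p = q.
Proof. intros H. rewrite <- (cancel_of_to p), H. apply cancel_of_to. Qed.

Section Countability.
Context {X : Type}.
Implicit Types A B : X -> Prop.

Lemma countable_sub A B : countable_set B -> (forall x, A x -> B x) -> countable_set A.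
Proof. intros [c Hc] H. exists c. auto. Qed.

Lemma countable_union (A : nat -> X -> Prop) :
  (forall n, countable_set (A n)) -> countable_set (fun x => exists n, A n x).
Proof.
  intros H.
  pose (c := fun n => proj1_sig (constructive_indefinite_description _ (H n))).
  assert (Hc : forall n x y, A n x -> A n y -> c n x = c n y -> x = y) by
    (intros n; exact (proj2_sig (constructive_indefinite_description _ (H n)))).
  pose (ix := fun x => epsilon (inhabits O) (fun n => A n x)).
  exists (fun x => to_nat (ix x, c (ix x) x)). intros x y Hx Hy E.
  apply to_nat_inj in E. injection E as E1 E2.
  assert (Ax : A (ix x) x) by (apply epsilon_spec; exact Hx).
  assert (Ay : A (ix y) y) by (apply epsilon_spec; exact Hy).
  rewrite <- E1 in *. eauto.
Qed.

Lemma uncountable_minus A B :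
  ~ countable_set A -> countable_set B -> ~ countable_set (fun x => A x /\ ~ B x).
Proof.
  intros HA HB H. apply HA.
  apply countable_sub with
    (fun x => exists n, match n with O => B x | S _ => A x /\ ~ B x end).
  - apply countable_union. intros [|n]; auto.
  - intros x Hx. destruct (classic (B x)); [exists O | exists 1%nat]; auto.
Qed.

Lemma uncountable_fiber A (c : X -> nat) :
  ~ countable_set A -> exists n, ~ countable_set (fun x => A x /\ c x = n).
Proof.
  intros HA. apply NNPP. intros N. apply HA.
  apply countable_sub with (fun x => exists n, A x /\ c x = n); [|eauto].
  apply countable_union. intros n. apply NNPP. eauto.
Qed.

Lemma uncountable_distinct A :
  ~ countable_set A -> exists x y, A x /\ A y /\ x <> y.
Proof.
  intros HA. apply NNPP. intros N. apply HA. exists (fun _ => O). intros x y Hx Hy _.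
  apply NNPP. intros E. apply N. eauto.
Qed.

Lemma uncountable_inhabited A : ~ countable_set A -> exists x, A x.
Proof. intros H. destruct (uncountable_distinct H) as (x & _ & Hx & _). eauto. Qed.

Lemma uncountable_not_countable_set (x0 : X) A : uncountable A -> ~ countable_set A.
Proof.
  intros HA [c Hc]. apply HA.
  exists (fun n => epsilon (inhabits x0) (fun x => A x /\ c x = n)). intros x Hx.
  exists (c x). assert (E : exists y, A y /\ c y = c x) by eauto.
  apply (epsilon_spec (inhabits x0)) in E. destruct E as [E1 E2]. apply Hc; auto.
Qed.

End Countability.

Definition Z_code (z : Z) : nat := to_nat (Z.to_nat z, Z.to_nat (- z)).

Definition K_cell {b} (M : nat) (a : K b) : nat :=
  to_nat (Z_code (Int_part (INR (S M) * Kre a)), Z_code (Int_part (INR (S M) * Kim a))).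

Lemma Z_code_inj z z' : Z_code z = Z_code z' -> z = z'.
Proof. intros H. unfold Z_code in H. apply to_nat_inj in H. injection H. lia. Qed.

Lemma Int_part_close M x y :
  Int_part (INR (S M) * x) = Int_part (INR (S M) * y) -> Rabs (x - y) <= / INR (S M).
Proof.
  intros H. assert (HM : 0 < INR (S M)) by (apply lt_0_INR; lia).
  pose proof (base_Int_part (INR (S M) * x)). pose proof (base_Int_part (INR (S M) * y)).
  rewrite H in *. apply Rmult_le_reg_l with (INR (S M)); auto. rewrite Rinv_r by lra.
  rewrite <- (Rabs_pos_eq (INR (S M))) at 1 by lra. rewrite <- Rabs_mult.
  apply Rabs_le. lra.
Qed.

Lemma K_cell_close b M (a c : K b) : K_cell M a = K_cell M c -> Kabs (a - c)%K <= 2 * / INR (S M).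
Proof.
  intros H. unfold K_cell in H. apply to_nat_inj in H. injection H as H1 H2.
  apply Z_code_inj, Int_part_close in H1. apply Z_code_inj, Int_part_close in H2.
  eapply Rle_trans; [apply Kabs_le_re_im|]. rewrite Kre_sub, Kim_sub. lra.
Qed.

Lemma exists_fine_cell e : 0 < e -> exists M, 2 * / INR (S M) < e.
Proof.
  intros He. destruct (@archimed_cor1 (e / 2)) as (N & HN & HN'); [lra|].
  destruct N as [|M]; [lia|]. exists M. lra.
Qed.

Section Condensation.
Context {b : bool} {Z : NormedSpace b} (y : nat -> Z).
Context (y_dense : forall x e, 0 < e -> exists n, norm (x - y n)%V < e).
Add Ring K_ring : (K_ring_theory b).

(** For all [M] and [m] together the codes give countably many cells; on norm bounded sets of
    functionals these replace a countable base of the weak* topology. *)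
Fixpoint values_code (M m : nat) (k : Z -> K b) : nat :=
  match m with
  | O => O
  | S j => to_nat (K_cell M (k (y j)), values_code M j k)
  end.

Lemma values_code_close M m k k' :
  values_code M m k = values_code M m k' ->
  forall j, (j < m)%nat -> Kabs (k (y j) - k' (y j))%K <= 2 * / INR (S M).
Proof.
  induction m as [|m IH]; intros H j Hj; [lia|].
  apply (to_nat_inj (_, _) (_, _)) in H. injection H as H1 H2.
  destruct (Nat.eq_dec j m) as [->|]; [apply K_cell_close, H1 | apply IH; auto; lia].
Qed.

Lemma dense_approx_list (L : list Z) e :
  0 < e -> exists m, forall x, In x L -> exists j, (j < m)%nat /\ norm (x - y j)%V < e.
Proof.
  intros He. induction L as [|x L [m IH]].
  - exists O. intros x [].
  - destruct (y_dense x He) as [j Hj]. exists (Nat.max (S j) m). intros x' [<-|Hx'].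
    + exists j. split; auto. lia.
    + destruct (IH x' Hx') as (j' & ? & ?). exists j'. split; auto. lia.
Qed.

Lemma bounded_sub_le C (k : Z -> K b) x x' :
  linear_functional Z k -> bounded_by Z C k -> Kabs (k x - k x')%K <= C * norm (x - x')%V.
Proof. intros Hk HC. rewrite <- linear_sub by auto. apply HC. Qed.

Lemma bounded_close_at C (k k' : Z -> K b) x x' :
  linear_functional Z k -> bounded_by Z C k -> linear_functional Z k' -> bounded_by Z C k' ->
  Kabs (k x - k' x)%K <= 2 * C * norm (x - x')%V + Kabs (k x' - k' x')%K.
Proof.
  intros H1 H2 H3 H4.
  pose proof (bounded_sub_le x x' H1 H2). pose proof (bounded_sub_le x' x H3 H4).
  rewrite (vnorm_sub_sym x' x) in *.
  pose proof (Ksub_le b (k x) (k x') (k' x)). pose proof (Ksub_le b (k x') (k' x') (k' x)). lra.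
Qed.

(** Cantor-Bendixson argument: a member is [thin] when one of its cells contains only countably many
    members of [G]. As there are countably many cells, the thin members form a countable set, and
    after their removal every cell that meets the rest is still uncountable. By density of [y] and
    the common bound [C], the neighbourhood given by [L] and [e] contains a whole cell around its
    centre. *)
Lemma condensation_points (C : R) (G : (Z -> K b) -> Prop) :
  (forall k, G k -> linear_functional Z k /\ bounded_by Z C k) -> ~ countable_set G ->
  exists G', (forall k, G' k -> G k) /\ ~ countable_set G' /\
    forall k L e, G' k -> 0 < e ->
      ~ countable_set (fun k' => G' k' /\ forall x, In x L -> Kabs (k' x - k x)%K <= e).
Proof.
  intros HG unc.
  pose (thin := fun k => exists M m n, (G k /\ values_code M m k = n) /\
    countable_set (fun k' => G k' /\ values_code M m k' = n)).
  assert (Hthin : countable_set thin).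
  { do 3 (apply countable_union; intros ?).
    destruct (classic (countable_set (fun k' => G k' /\ values_code n n0 k' = n1))) as [H|H].
    - apply countable_sub with (1 := H). tauto.
    - exists (fun _ => O). tauto. }
  exists (fun k => G k /\ ~ thin k). split; [tauto|]. split; [apply uncountable_minus; auto|].
  intros k L e [Gk Tk] He H.
  set (D := 2 * Rabs C + 1). assert (HD : 0 < D) by (pose proof (Rabs_pos C); unfold D; lra).
  destruct (@dense_approx_list L (e / 2 / D)) as [m Hm].
  { apply Rdiv_lt_0_compat; lra. }
  destruct (@exists_fine_cell (e / 2)) as [M HM]; [lra|].
  apply Tk. exists M, m, (values_code M m k). split; auto.
  apply NNPP. intros N. apply (uncountable_minus N Hthin).
  apply countable_sub with (1 := H). intros k' [[Gk' E] Tk']. split; [auto|].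
  intros x Hx. destruct (Hm x Hx) as (j & Hj & Hxj).
  destruct (HG k Gk) as [k1 k2], (HG k' Gk') as [k3 k4].
  pose proof (bounded_close_at x (y j) k3 k4 k1 k2) as H1.
  pose proof (values_code_close M _ _ E Hj) as H2.
  assert (2 * C * norm (x - y j)%V <= e / 2).
  { apply Rle_trans with (D * norm (x - y j)%V).
    - apply Rmult_le_compat_r; [apply vnorm_pos|]. pose proof (Rle_abs C). unfold D. lra.
    - replace (e / 2) with (D * (e / 2 / D)) by (field; lra). apply Rmult_le_compat_l; lra. }
  lra.
Qed.

End Condensation.

(** Peeling off one coefficient at a time is the shape needed for the inductions on [l] below. *)
Fixpoint functional_span {b} {X : NormedSpace b} (l : list (X -> K b)) (f : X -> K b) : Prop :=
  match l with
  | nil => forall x, f x = 0%K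
  | h :: l => exists c, functional_span l (fun x => f x - c * h x)%K
  end.

Section Span.
Context {b : bool} {X : NormedSpace b}.
Add Ring K_ring : (K_ring_theory b).
Add Ring X_ring : (sqz_ring_theory X).
Implicit Types (l : list (X -> K b)) (f : X -> K b).

(** If some [x] in the common kernel of [l] has [h x] nonzero, subtracting [(f x / h x) h] from [f]
    leaves a functional vanishing on that kernel, since [x' - s x] can be moved into the kernel of
    [h]. Otherwise [h] vanishes there already and its coefficient is 0. *)
Lemma functional_span_of_kernel l f :
  Forall (linear_functional X) l -> linear_functional X f ->
  (forall x, Forall (fun h => h x = 0%K) l -> f x = 0%K) -> functional_span l f.
Proof.
  revert f. induction l as [|h l IH]; intros f Hl Hf H; simpl; [auto|].
  apply Forall_cons_iff in Hl. destruct Hl as [Hh Hl].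
  assert (lin : forall c, linear_functional X (fun x => f x - c * h x)%K).
  { intros c. destruct Hf as [f1 f2], Hh as [h1 h2].
    split; intros; rewrite ?f1, ?f2, ?h1, ?h2; ring. }
  destruct (classic (exists x, Forall (fun h => h x = 0%K) l /\ h x <> 0%K)) as [(x & Hx & N)|N].
  - exists (f x * Kinv (h x))%K. apply IH; auto. intros x' Hx'.
    pose (s := (h x' * Kinv (h x))%K).
    assert (E : f (x' - s *: x)%V = 0%K).
    { assert (Es : forall g, linear_functional X g -> g (x' - s *: x)%V = (g x' - s * g x)%K).
      { intros g Hg. rewrite linear_sub by auto. destruct Hg as [_ ->]. reflexivity. }
      apply H. constructor.
      - rewrite Es by auto. unfold s. rewrite <- (Rmul_assoc (K_ring_theory b)), Kinv_l by auto. ring.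
      - rewrite Forall_forall in *. intros g Hg. rewrite Es, Hx, Hx' by auto. ring. }
    rewrite linear_sub in E by auto. destruct Hf as [_ f2]. rewrite f2 in E.
    rewrite <- E. unfold s. ring.
  - exists 0%K. apply IH; auto. intros x Hx. rewrite H; [ring|].
    constructor; auto. apply NNPP. intros E. apply N. eauto.
Qed.

Lemma Kabs_split_le (a1 a2 p1 p2 f1 f2 : K b) r s t :
  Kabs (a1 - p1 - f1)%K <= r -> Kabs (a2 - p2 - f2)%K <= s -> Kabs (p1 - p2)%K <= t ->
  Kabs (a1 - a2 - (f1 - f2))%K <= r + s + t.
Proof.
  intros H1 H2 H3.
  replace (a1 - a2 - (f1 - f2))%K with ((a1 - p1 - f1) + (- (a2 - p2 - f2) + (p1 - p2)))%K by ring.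
  eapply Rle_trans; [apply Kabs_tri|].
  eapply Rle_trans; [apply Rplus_le_compat_l, Kabs_tri|]. rewrite Kabs_opp. lra.
Qed.

(* A finite-dimensional space of functionals is norm separable, so it comes within [r < eps / 2]
   of only countably many members of an [eps]-separated family. The coefficients are
   discretized one at a time; [p] accumulates those already treated. *)
Lemma separated_near_span_aux (I : Type) (h : I -> X -> K b) (eps : R) l (A : I -> Prop)
    (p : I -> X -> K b) (r s : R) :
  (forall i j, A i -> A j -> i <> j -> ~ bounded_by X eps (fun x => h i x - h j x)%K) ->
  Forall (fun g => exists C, bounded_by X C g) l ->
  2 * r + s < eps ->
  (forall i j, A i -> A j -> bounded_by X s (fun x => p i x - p j x)%K) ->
  (forall i, A i -> exists f, functional_span l f /\
     bounded_by X r (fun x => h i x - p i x - f x)%K) ->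
  countable_set A.
Proof.
  revert A p s. induction l as [|g l IH]; intros A p s sep Hl Hrs Hp Hf; apply NNPP; intros unc.
  - destruct (uncountable_distinct unc) as (i & j & Si & Sj & Nij).
    apply (sep i j Si Sj Nij). intros x.
    destruct (Hf i Si) as (f & f0 & Hfi), (Hf j Sj) as (f' & f'0 & Hfj).
    pose proof (Kabs_split_le _ _ _ _ _ _ (Hfi x) (Hfj x) (Hp i j Si Sj x)) as H.
    rewrite f0, f'0 in H. replace (h i x - h j x - (0 - 0))%K with (h i x - h j x)%K in H by ring.
    pose proof (vnorm_pos x). nra.
  - apply Forall_cons_iff in Hl. destruct Hl as [[C HC] Hl].
    pose (c := fun i => epsilon (inhabits 0%K) (fun c => exists f,
      functional_span l (fun x => f x - c * g x)%K /\
      bounded_by X r (fun x => h i x - p i x - f x)%K)).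
    assert (Hc : forall i, A i -> exists f, functional_span l (fun x => f x - c i * g x)%K /\
      bounded_by X r (fun x => h i x - p i x - f x)%K).
    { intros i Si. unfold c. apply epsilon_spec. destruct (Hf i Si) as (f & [d Hd] & H'). eauto. }
    set (D := Rabs C + 1). assert (HD : 0 < D) by (pose proof (Rabs_pos C); unfold D; lra).
    (* Fine enough that freezing this coefficient raises [s] by less than the slack
       [eps - (2 * r + s)]. *)
    destruct (@exists_fine_cell ((eps - (2 * r + s)) / D)) as [M HM].
    { apply Rdiv_lt_0_compat; lra. }
    destruct (uncountable_fiber (fun i => K_cell M (c i)) unc) as [n Hn].
    apply Hn.
    apply (IH _ (fun i x => p i x + c i * g x)%K (s + (2 * / INR (S M)) * D)).
    + intros i j [Si _] [Sj _]. auto.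
    + auto.
    + apply Rmult_lt_compat_r with (r := D) in HM; auto.
      replace ((eps - (2 * r + s)) / D * D) with (eps - (2 * r + s)) in HM by (field; lra). lra.
    + intros i j [Si Ei] [Sj Ej] x.
      assert (E : K_cell M (c i) = K_cell M (c j)) by congruence.
      apply K_cell_close in E. pose proof (Hp i j Si Sj x) as H1. pose proof (HC x) as H2.
      replace (p i x + c i * g x - (p j x + c j * g x))%K
        with ((p i x - p j x) + (c i - c j) * g x)%K by ring.
      eapply Rle_trans; [apply Kabs_tri|]. rewrite Kabs_mul.
      assert (H3 : Kabs (g x) <= D * norm x).
      { pose proof (vnorm_pos x). pose proof (Rle_abs C). unfold D. nra. }
      rewrite Rmult_plus_distr_r. apply Rplus_le_compat; auto. rewrite Rmult_assoc.
      apply Rmult_le_compat; auto; apply Kabs_pos.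
    + intros i [Si _]. destruct (Hc i Si) as (f & F1 & F2).
      exists (fun x => f x - c i * g x)%K. split; auto. intros x.
      replace (h i x - (p i x + c i * g x) - (f x - c i * g x))%K
        with (h i x - p i x - f x)%K by ring. apply F2.
Qed.

Lemma separated_near_span (I : Type) (h : I -> X -> K b) (eps r : R) l (A : I -> Prop) :
  (forall i j, A i -> A j -> i <> j -> ~ bounded_by X eps (fun x => h i x - h j x)%K) ->
  Forall (fun g => exists C, bounded_by X C g) l -> 2 * r < eps ->
  countable_set (fun i => A i /\ exists f, functional_span l f /\ bounded_by X r (fun x => h i x - f x)%K).
Proof.
  intros sep Hl Hr.
  apply (@separated_near_span_aux I h eps l _ (fun _ _ => 0%K) r 0).
  - intros i j [Si _] [Sj _]. auto.
  - auto.
  - lra.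
  - intros i j _ _ x. replace (0 - 0)%K with (K0 b) by ring. rewrite Kabs_0. lra.
  - intros i [_ (f & F1 & F2)]. exists f. split; auto. intros x.
    replace (h i x - 0 - f x)%K with (h i x - f x)%K by ring. apply F2.
Qed.

(** If [f] were bounded by [r] on the common kernel of [l], a Hahn-Banach extension [F] of this
    restriction would make [f - F] vanish on the kernel, hence lie in the span, within [r] of [f]. A
    vector violating the bound is normalized and rotated so that [f] is a positive real there. *)
Lemma exists_kernel_vector l f r :
  0 <= r -> Forall (linear_functional X) l -> linear_functional X f ->
  ~ (exists g, functional_span l g /\ bounded_by X r (fun x => f x - g x)%K) ->
  exists w t, norm w = 1 /\ Forall (fun h => h w = 0%K) l /\ f w = KofR b t /\ r < t.
Proof.
  intros Hr Hl Hf N.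
  assert (H : exists x, Forall (fun h => h x = 0%K) l /\ r * norm x < Kabs (f x)).
  { apply NNPP. intros N'. apply N.
    destruct (@Hahn_Banach b X r (fun x => Forall (fun h => h x = 0%K) l) f) as (F & F1 & F2 & F3); auto.
    - rewrite Forall_forall in *. intros h Hh. apply linear_0. auto.
    - rewrite Forall_forall in Hl. intros x y a Hx Hy. split.
      + rewrite Forall_forall in *. intros h Hh. destruct (Hl h Hh) as [h1 h2].
        rewrite h1, h2, Hx, Hy by auto. ring.
      + destruct Hf as [f1 f2]. rewrite f1, f2. reflexivity.
    - intros x Hx. destruct (Rle_lt_dec (Kabs (f x)) (r * norm x)); auto. exfalso. eauto.
    - exists (fun x => f x - F x)%K. split.
      + apply functional_span_of_kernel; auto.
        * destruct Hf as [f1 f2], F1 as [g1 g2]. split; intros; rewrite ?f1, ?f2, ?g1, ?g2; ring.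
        * intros x Hx. rewrite F3 by auto. ring.
      + intros x. replace (f x - (f x - F x))%K with (F x) by ring. apply F2. }
  destruct H as (x & Hx & Hlt).
  assert (Nx : 0 < norm x).
  { destruct (vnorm_pos x) as [|E]; auto. symmetry in E. apply vnorm_def in E. subst x.
    rewrite linear_0, Kabs_0, vnorm_0 in Hlt by auto. lra. }
  destruct (K_phase (f x)) as (u & Hu & E).
  exists ((u * KofR b (/ norm x))%K *: x)%V, (Kabs (f x) / norm x).
  assert (P : 0 < / norm x) by (apply Rinv_0_lt_compat; auto).
  split; [|split; [|split]].
  - rewrite vnorm_scale, Kabs_mul, Hu, Kabs_ofR, Rabs_pos_eq by lra. field. lra.
  - rewrite Forall_forall in *. intros h Hh. destruct (Hl h Hh) as [_ ->]. rewrite Hx by auto. ring.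
  - destruct Hf as [_ ->]. unfold Rdiv. rewrite KofR_mul, <- E. ring.
  - apply Rmult_lt_reg_r with (norm x); auto. replace (Kabs (f x) / norm x * norm x) with (Kabs (f x)) by (field; lra). auto.
Qed.

End Span.

(** * Finite nets, series, quotient norms and biorthogonal systems *)

Definition finite_net {X : Type} (A : X -> Prop) (close : X -> X -> Prop) : Prop :=
  exists L, (forall x, In x L -> A x) /\ forall x, A x -> exists x', In x' L /\ close x x'.

Section FiniteNets.
Context {X : Type}.
Implicit Types (A : X -> Prop) (close : X -> X -> Prop).

Lemma finite_net_union A A1 A2 close :
  (forall x, A x <-> A1 x \/ A2 x) -> finite_net A1 close -> finite_net A2 close -> finite_net A close.
Proof.
  intros HA (L1 & H1 & H1') (L2 & H2 & H2'). exists (L1 ++ L2). split.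
  - intros x Hx. apply HA. apply in_app_or in Hx. destruct Hx; auto.
  - intros x Hx. apply HA in Hx. destruct Hx as [Hx|Hx].
    + destruct (H1' x Hx) as (x' & ? & ?). exists x'. split; auto. apply in_or_app; auto.
    + destruct (H2' x Hx) as (x' & ? & ?). exists x'. split; auto. apply in_or_app; auto.
Qed.

(** The range of [f] is cut into intervals of length [e], and the nets of the slices are joined. *)
Lemma finite_net_split A close (f : X -> R) B e :
  0 < e -> (forall x, A x -> Rabs (f x) <= B) ->
  (forall A', (forall x, A' x -> A x) ->
     (forall x x', A' x -> A' x' -> Rabs (f x - f x') <= e) -> finite_net A' close) ->
  finite_net A close.
Proof.
  intros He HB H.
  assert (step : forall N A', (forall x, A' x -> A x) ->
    (forall x, A' x -> - B <= f x < - B + INR N * e) -> finite_net A' close).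
  { induction N as [|N IH]; intros A' HA' Hf.
    - exists nil. split; [intros x []|]. intros x Hx. specialize (Hf x Hx). simpl in Hf. lra.
    - apply (@finite_net_union _ (fun x => A' x /\ f x < - B + INR N * e)
        (fun x => A' x /\ - B + INR N * e <= f x)).
      + intros x. destruct (Rlt_le_dec (f x) (- B + INR N * e)); tauto.
      + apply IH; [firstorder|]. intros x [Hx Hx']. specialize (Hf x Hx). lra.
      + apply H; [firstorder|]. intros x x' [Hx1 Hx2] [Hx'1 Hx'2].
        pose proof (Hf x Hx1) as F1. pose proof (Hf x' Hx'1) as F2. rewrite S_INR in F1, F2.
        apply Rabs_le. lra. }
  destruct (INR_archimed e (2 * B + 1)) as [N HN]; [auto|].
  apply (step N); auto. intros x Hx. specialize (HB x Hx).
  pose proof (Rle_abs (f x)). pose proof (Rle_abs (- f x)). rewrite Rabs_Ropp in *. lra.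
Qed.

(** Total boundedness of bounded sets in finite dimension, pulled back along [phi]: slicing by real
    and imaginary parts, one function at a time. The net lies in [A], which itself may be
    infinite-dimensional. *)
Lemma finite_net_scalars b (n : nat) A (phi : nat -> X -> K b) e :
  0 < e -> (forall i, (i < n)%nat -> exists B, forall x, A x -> Kabs (phi i x) <= B) ->
  finite_net A (fun x x' => forall i, (i < n)%nat -> Kabs (phi i x - phi i x')%K <= e).
Proof.
  intros He. revert A. induction n as [|n IH]; intros A HB.
  - destruct (classic (exists x, A x)) as [[x0 Hx0]|N].
    + exists (x0 :: nil). split; [intros x [<-|[]]; auto|].
      intros x _. exists x0. split; [left; auto|]. intros; lia.
    + exists nil. split; [intros x []|]. intros x Hx. exfalso; eauto.
  - destruct (HB n (le_n _)) as [B HBn].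
    apply (@finite_net_split _ _ (fun x => Kre (phi n x)) B (e / 2)); [lra| |].
    { intros x Hx. eapply Rle_trans; [apply Kre_le | auto]. }
    intros A1 I1 O1.
    apply (@finite_net_split _ _ (fun x => Kim (phi n x)) B (e / 2)); [lra| |].
    { intros x Hx. eapply Rle_trans; [apply Kim_le | auto]. }
    intros A2 I2 O2.
    destruct (IH A2) as (L & HL & HL').
    { intros i Hi. destruct (HB i) as [Bi HBi]; [lia|]. exists Bi. auto. }
    exists L. split; auto. intros x Hx. destruct (HL' x Hx) as (x' & Hx' & C). exists x'.
    split; auto. intros i Hi. destruct (Nat.eq_dec i n) as [->|]; [|apply C; lia].
    eapply Rle_trans; [apply Kabs_le_re_im|]. rewrite Kre_sub, Kim_sub.
    pose proof (O1 x x' (I2 _ Hx) (I2 _ (HL _ Hx'))). pose proof (O2 x x' Hx (HL _ Hx')). lra.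
Qed.

End FiniteNets.

Definition update {T : Type} (f : nat -> T) (n : nat) (s : T) (m : nat) : T :=
  if Nat.eq_dec m n then s else f m.

Lemma update_eq T (f : nat -> T) n s : update f n s n = s.
Proof. unfold update. destruct (Nat.eq_dec n n); congruence. Qed.

Lemma update_neq T (f : nat -> T) n s m : m <> n -> update f n s m = f m.
Proof. unfold update. destruct (Nat.eq_dec m n); congruence. Qed.

(** Dependent choice in which the value at [n] may use all earlier ones. The values of [F n] below
    [n] are final; [ext], by which [Q] at [n] looks only at arguments up to [n], transfers [Q] to
    the diagonal. *)
Lemma course_of_values_choice (T : Type) (s0 : T) (Q : (nat -> T) -> nat -> Prop) :
  (forall f g n, (forall m, (m <= n)%nat -> f m = g m) -> Q f n -> Q g n) ->
  (forall f n, (forall m, (m < n)%nat -> Q f m) -> exists s, Q (update f n s) n) ->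
  exists f, forall n, Q f n.
Proof.
  intros ext step.
  pose (F := fix F n := match n with
    | O => fun _ => s0
    | S m => update (F m) m (epsilon (inhabits s0) (fun s => Q (update (F m) m s) m))
    end).
  assert (FS : forall n, F (S n) =
    update (F n) n (epsilon (inhabits s0) (fun s => Q (update (F n) n s) n))) by reflexivity.
  assert (agree : forall n m, (m < n)%nat -> F n m = F (S m) m).
  { induction n as [|n IH]; intros m Hm; [lia|].
    destruct (Nat.eq_dec m n) as [->|Hmn]; [reflexivity|].
    rewrite FS, update_neq by auto. apply IH. lia. }
  exists (fun n => F (S n) n). intros n. induction n as [n IH] using (well_founded_induction lt_wf).
  apply ext with (F (S n)); [intros; apply agree; lia|].
  rewrite FS. apply epsilon_spec. apply step. intros m Hm.
  apply ext with (2 := IH m Hm). intros k Hk. symmetry. apply agree. lia.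
Qed.

Lemma half_pow_pos n : 0 < (/ 2) ^ n.
Proof. apply pow_lt. lra. Qed.

Lemma half_pow_le1 n : (/ 2) ^ n <= 1.
Proof. rewrite <- (pow1 n). apply pow_incr. lra. Qed.

(** Budget for one step of the tree: from the [2^-p] available at the parent, [2^-n] is spent and
    [2^-n] remains. *)
Lemma half_pow_lt p n : (p < n)%nat -> 2 * (/ 2) ^ n <= (/ 2) ^ p.
Proof.
  intros H. replace n with (S (n - S p) + p)%nat by lia.
  generalize (n - S p)%nat. intros k. rewrite pow_add. simpl.
  pose proof (half_pow_le1 k). pose proof (half_pow_pos p).
  assert ((/ 2) ^ k * (/ 2) ^ p <= 1 * (/ 2) ^ p) by (apply Rmult_le_compat_r; lra). lra.
Qed.

Lemma half_pow_small c e : 0 < e -> exists N, forall n, (N <= n)%nat -> c * (/ 2) ^ n < e.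
Proof.
  intros He. destruct (pow_lt_1_zero (/ 2)) with (y := e / (Rabs c + 1)) as [N HN].
  - rewrite Rabs_pos_eq; lra.
  - apply Rdiv_lt_0_compat; auto. pose proof (Rabs_pos c). lra.
  - exists N. intros n Hn. specialize (HN n Hn). pose proof (half_pow_pos n).
    rewrite Rabs_pos_eq in HN by lra. pose proof (Rle_abs c). pose proof (Rabs_pos c).
    apply Rmult_lt_compat_l with (r := Rabs c + 1) in HN; [|lra].
    replace ((Rabs c + 1) * (e / (Rabs c + 1))) with e in HN by (field; lra). nra.
Qed.

Section Series.
Context {b : bool} {X : NormedSpace b}.
Add Ring K_ring : (K_ring_theory b).
Add Ring X_ring : (sqz_ring_theory X).

Lemma geometric_Cauchy_limit (s : nat -> X) (B : R) :
  complete X -> 0 <= B -> (forall n, norm (s (S n) - s n)%V <= B * (/ 2) ^ n) ->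
  exists l, forall n, norm (l - s n)%V <= 2 * B * (/ 2) ^ n.
Proof.
  intros HX HB Hs.
  assert (D : forall n k, norm (s (n + k)%nat - s n)%V <= 2 * B * (/ 2) ^ n - 2 * B * (/ 2) ^ (n + k)).
  { intros n. induction k as [|k IH].
    - rewrite Nat.add_0_r. unfold vsub. rewrite vadd_opp, vnorm_0. lra.
    - replace (n + S k)%nat with (S (n + k)) by lia.
      pose proof (vnorm_sub_le (s (S (n + k))) (s (n + k)%nat) (s n)).
      pose proof (Hs (n + k)%nat). simpl. lra. }
  assert (D' : forall n m, (n <= m)%nat -> norm (s m - s n)%V <= 2 * B * (/ 2) ^ n).
  { intros n m H. pose proof (D n (m - n)%nat) as E. replace (n + (m - n))%nat with m in E by lia.
    pose proof (half_pow_pos m). nra. }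
  destruct (HX s) as [l Hl].
  { intros e He. destruct (@half_pow_small (2 * B) (e / 2)) as [N HN]; [lra|]. exists N.
    intros m n Hm Hn. pose proof (vnorm_sub_le (s m) (s N) (s n)). pose proof (D' N m Hm).
    pose proof (D' N n Hn). rewrite (vnorm_sub_sym (s n)) in *. pose proof (HN N (le_n _)). lra. }
  exists l. intros n. apply Rnot_lt_le. intros H.
  destruct (Hl (norm (l - s n)%V - 2 * B * (/ 2) ^ n)) as [N HN]; [lra|].
  pose proof (HN (Nat.max n N) (Nat.le_max_r _ _)) as E. rewrite vnorm_sub_sym in E.
  pose proof (D' n (Nat.max n N) (Nat.le_max_l _ _)).
  pose proof (vnorm_sub_le l (s (Nat.max n N)) (s n)). lra.
Qed.

Lemma lin_comb_truncate (a : nat -> K b) (x : nat -> X) N n :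
  (N <= n)%nat ->
  lin_comb X (fun i => if lt_dec i N then a i else 0%K) x n = lin_comb X a x N.
Proof.
  induction n as [|n IH]; intros H; [replace N with O by lia; reflexivity|].
  destruct (Nat.eq_dec N (S n)) as [->|HN].
  - apply lin_comb_ext; auto. intros i Hi. destruct (lt_dec i (S n)); [auto|lia].
  - cbn [lin_comb]. rewrite IH by lia. destruct (lt_dec n N); [lia|]. vring.
Qed.

End Series.

Section QuotientNorm.
Context {b : bool} {Z : NormedSpace b} (Z0 : Z -> Prop).
Context (Z0_zero : Z0 0%V) (Z0_add : forall x y, Z0 x -> Z0 y -> Z0 (x + y)%V)
  (Z0_opp : forall x, Z0 x -> Z0 (- x)%V).
Add Ring K_ring : (K_ring_theory b).
Add Ring Z_ring : (sqz_ring_theory Z).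

(** The default value of [Rsup] does not arise: the numbers [- norm (z - z0)] are bounded above by
    0, and there is one because [Z0] contains zero. So [quot_norm] is a genuine infimum. *)
Lemma quot_norm_glb z :
  (forall z0, Z0 z0 -> quot_norm Z Z0 z <= norm (z - z0)%V) /\
  (forall e, 0 < e -> exists z0, Z0 z0 /\ norm (z - z0)%V < quot_norm Z Z0 z + e).
Proof.
  unfold quot_norm, Rsup.
  destruct excluded_middle_informative as [H|N].
  - destruct completeness as [m [Hub Hlub]]. simpl. split.
    + intros z0 Hz0. assert (- norm (z - z0)%V <= m) by (apply Hub; eauto). lra.
    + intros e He. apply NNPP. intros N. assert (m <= m - e); [|lra].
      apply Hlub. intros r (z0 & Hz0 & ->). apply Rnot_lt_le. intros E. apply N.
      exists z0. split; auto. lra.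
  - exfalso. apply N. split; [|eauto].
    exists 0. intros r (z0 & _ & ->). pose proof (vnorm_pos (z - z0)%V). lra.
Qed.

Lemma quot_norm_le_of_sub x y : Z0 (x - y)%V -> quot_norm Z Z0 x <= norm y.
Proof.
  intros H. eapply Rle_trans; [apply (proj1 (quot_norm_glb x)), H|]. right. f_equal. vring.
Qed.

Lemma quot_norm_le_norm x : quot_norm Z Z0 x <= norm x.
Proof. apply quot_norm_le_of_sub. unfold vsub. rewrite vadd_opp. apply Z0_zero. Qed.

Lemma quot_norm_tri x y : quot_norm Z Z0 (x + y)%V <= quot_norm Z Z0 x + quot_norm Z Z0 y.
Proof.
  apply Rnot_lt_le. intros H.
  set (e := quot_norm Z Z0 (x + y)%V - (quot_norm Z Z0 x + quot_norm Z Z0 y)).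
  destruct (proj2 (quot_norm_glb x) (e / 2)) as (x0 & Hx0 & Hx); [unfold e; lra|].
  destruct (proj2 (quot_norm_glb y) (e / 2)) as (y0 & Hy0 & Hy); [unfold e; lra|].
  pose proof (proj1 (quot_norm_glb (x + y)%V) _ (Z0_add Hx0 Hy0)) as Hxy.
  replace (x + y - (x0 + y0))%V with ((x - x0) + (y - y0))%V in Hxy by vring.
  pose proof (vnorm_tri Z (x - x0)%V (y - y0)%V). unfold e in *. lra.
Qed.

Lemma quot_norm_opp_le x : quot_norm Z Z0 (- x)%V <= quot_norm Z Z0 x.
Proof.
  apply Rnot_lt_le. intros H.
  destruct (proj2 (quot_norm_glb x) (quot_norm Z Z0 (- x)%V - quot_norm Z Z0 x))
    as (x0 & Hx0 & Hx); [lra|].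
  pose proof (proj1 (quot_norm_glb (- x)%V) _ (Z0_opp Hx0)) as Hx'.
  replace (- x - - x0)%V with (- (x - x0))%V in Hx' by vring. rewrite vnorm_opp in Hx'. lra.
Qed.

Lemma quot_norm_opp x : quot_norm Z Z0 (- x)%V = quot_norm Z Z0 x.
Proof.
  apply Rle_antisym; [apply quot_norm_opp_le|].
  replace x with (- - x)%V at 1 by vring. apply quot_norm_opp_le.
Qed.

Lemma quot_norm_bounded C (f : Z -> K b) :
  0 <= C -> linear_functional Z f -> bounded_by Z C f -> (forall x, Z0 x -> f x = 0%K) ->
  forall x, Kabs (f x) <= C * quot_norm Z Z0 x.
Proof.
  intros HC Hf Hb H0 x. apply Rnot_lt_le. intros H.
  assert (HC' : 0 < C + 1) by lra.
  destruct (proj2 (quot_norm_glb x) ((Kabs (f x) - C * quot_norm Z Z0 x) / (C + 1)))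
    as (x0 & Hx0 & Hx); [apply Rdiv_lt_0_compat; lra|].
  pose proof (Hb (x - x0)%V) as E. rewrite linear_sub, (H0 x0) in E by auto.
  replace (f x - 0)%K with (f x) in E by ring.
  set (q := quot_norm Z Z0 x) in *. set (e := (Kabs (f x) - C * q) / (C + 1)) in *.
  assert (e * (C + 1) = Kabs (f x) - C * q) by (unfold e; field; lra).
  assert (0 < e) by (unfold e; apply Rdiv_lt_0_compat; lra). nra.
Qed.

End QuotientNorm.

Section BiorthogonalBasis.
Context {b : bool} {X : NormedSpace b} (p : X -> R) (x : nat -> X) (d : nat -> X -> K b).
Context (p_tri : forall u v, p (u + v)%V <= p u + p v) (p_opp : forall u, p (- u)%V = p u).
Context (d_linear : forall i, linear_functional X (d i))
  (d_bounded : forall i, exists C, 0 <= C /\ forall u, Kabs (d i u) <= C * p u)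
  (d_diag : forall i, d i (x i) = 1%K) (d_off : forall i j, i <> j -> d i (x j) = 0%K).
Add Ring K_ring : (K_ring_theory b).
Add Ring X_ring : (sqz_ring_theory X).

Lemma coordinate_lin_comb a i n :
  d i (lin_comb X a x n) = if lt_dec i n then a i else 0%K.
Proof.
  rewrite linear_lin_comb by auto. destruct (lt_dec i n) as [H|H].
  - apply lin_comb_delta; auto.
  - induction n as [|n IH]; simpl; [reflexivity|].
    rewrite IH, d_off by lia. ring.
Qed.

Lemma coordinates_unique a y i : series_conv X p a x y -> a i = d i y.
Proof.
  intros H. symmetry. apply Ksub_eq0, Kabs_eq0.
  destruct (d_bounded i) as (C & HC & Hd).
  destruct (Kabs_pos (d i y - a i)%K) as [P|P]; [exfalso|auto].
  destruct (H (Kabs (d i y - a i)%K / (C + 1))) as [N HN].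
  { apply Rdiv_lt_0_compat; lra. }
  specialize (HN (Nat.max N (S i)) (Nat.le_max_l _ _)).
  pose proof (Hd (y - lin_comb X a x (Nat.max N (S i)))%V) as E.
  rewrite linear_sub, coordinate_lin_comb in E by auto.
  destruct (lt_dec i (Nat.max N (S i))); [|lia].
  set (e := Kabs (d i y - a i)%K) in *. set (q := p _) in *.
  apply Rmult_lt_compat_r with (r := C + 1) in HN; [|lra].
  replace (e / (C + 1) * (C + 1)) with e in HN by (field; lra). nra.
Qed.

(** If a finite combination [v] is close to [y], late partial sums fix [v], so that
    [y - S y = (y - v) + S (v - y)] is small by the uniform bound; this needs the bound at [v - y],
    hence the last closure hypothesis on [A]. A general [p] lets the lemma serve both [W] and the
    quotient seminorm. *)
Lemma biorthogonal_basis (A : X -> Prop) (M : R) :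
  0 <= M ->
  (forall y n, A y -> p (lin_comb X (fun i => d i y) x n) <= M * p y) ->
  (forall y, A y -> closed_span X p x y) ->
  (forall y a n, A y -> A (lin_comb X a x n - y)%V) ->
  basis_of X p x A M.
Proof.
  intros HM bound dense closed. split; [|split].
  - intros y Hy. exists (fun i => d i y). intros e He.
    destruct (dense y Hy (e / (M + 1))) as (a & N & Ha).
    { apply Rdiv_lt_0_compat; lra. }
    exists N. intros n Hn.
    pose proof (bound _ n (closed y a N Hy)) as B.
    assert (E : p (lin_comb X a x N - y)%V = p (y - lin_comb X a x N)%V).
    { rewrite <- p_opp. f_equal. vring. }
    rewrite E in B.
    replace (y - lin_comb X (fun i => d i y) x n)%V with
      ((y - lin_comb X a x N) + lin_comb X (fun i => d i (lin_comb X a x N - y)%V) x n)%V.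
    + eapply Rle_lt_trans; [apply p_tri|]. set (q := p (y - _)%V) in *.
      apply Rmult_lt_compat_r with (r := M + 1) in Ha; [|lra].
      replace (e / (M + 1) * (M + 1)) with e in Ha by (field; lra). nra.
    + rewrite (lin_comb_ext _ (fun i => (if lt_dec i N then a i else 0) - d i y)%K x x (n := n)).
      * rewrite lin_comb_sub, lin_comb_truncate by auto. vring.
      * intros i _. rewrite linear_sub, coordinate_lin_comb by auto. reflexivity.
      * auto.
  - intros y a a' _ H H' i. rewrite (coordinates_unique i H), (coordinates_unique i H'). reflexivity.
  - intros y a n Hy H. rewrite (lin_comb_ext a (fun i => d i y) x x (n := n)); auto.
    intros i _. apply coordinates_unique, H.
Qed.

End BiorthogonalBasis.

(** * The recursive construction *)

Section AbsolutelyConvex.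
Context {b : bool} {Z : NormedSpace b} (D : (Z -> K b) -> Prop) (D_convex : absolutely_convex Z D).
Add Ring K_ring : (K_ring_theory b).

(** The set [s D], written without division so that [s = 0] makes sense; it records how much of [D]
    a correction uses up. *)
Definition in_multiple (s : R) (f : Z -> K b) : Prop :=
  0 <= s /\ exists k, D k /\ forall x, f x = (KofR b s * k x)%K.

Lemma in_multiple_combination s s' t f g a c :
  in_multiple s f -> in_multiple s' g -> Kabs a * s + Kabs c * s' <= t ->
  in_multiple t (fun x => a * f x + c * g x)%K.
Proof.
  intros (Hs & k & Dk & Hf) (Hs' & k' & Dk' & Hg) Ht.
  pose proof (Kabs_pos a) as Pa. pose proof (Kabs_pos c) as Pc.
  assert (P1 : 0 <= Kabs a * s) by nra. assert (P2 : 0 <= Kabs c * s') by nra.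
  split; [lra|].
  destruct (Req_dec t 0) as [->|Nt].
  - exists k. split; auto. intros x. rewrite Hf, Hg, KofR_0.
    assert (E1 : (a * KofR b s)%K = 0%K).
    { apply Kabs_eq0. rewrite Kabs_mul, Kabs_ofR, Rabs_pos_eq; lra. }
    assert (E2 : (c * KofR b s')%K = 0%K).
    { apply Kabs_eq0. rewrite Kabs_mul, Kabs_ofR, Rabs_pos_eq; lra. }
    transitivity ((a * KofR b s) * k x + (c * KofR b s') * k' x)%K; [ring|].
    rewrite E1, E2. ring.
  - exists (fun x => (a * KofR b (s / t)) * k x + (c * KofR b (s' / t)) * k' x)%K. split.
    + apply D_convex; auto. rewrite !Kabs_mul, !Kabs_ofR.
      assert (0 <= / t) by (left; apply Rinv_0_lt_compat; lra).
      rewrite !Rabs_pos_eq by (apply Rmult_le_pos; lra).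
      replace (Kabs a * (s / t) + Kabs c * (s' / t)) with ((Kabs a * s + Kabs c * s') * / t) by (unfold Rdiv; ring).
      replace 1 with (t * / t) by (field; lra). apply Rmult_le_compat_r; lra.
    + intros x. rewrite Hf, Hg.
      assert (E1 : KofR b s = (KofR b t * KofR b (s / t))%K) by (rewrite <- KofR_mul; f_equal; field; auto).
      assert (E2 : KofR b s' = (KofR b t * KofR b (s' / t))%K) by (rewrite <- KofR_mul; f_equal; field; auto).
      rewrite E1, E2 at 1. ring.
Qed.

Lemma in_multiple_lin_comb (a : nat -> K b) (f : nat -> Z -> K b) s t n :
  (exists k, D k) -> 0 <= s -> (forall i, (i < n)%nat -> in_multiple s (f i)) ->
  (forall i, (i < n)%nat -> Kabs (a i) <= t) ->
  in_multiple (INR n * (t * s)) (fun x => lin_comb (Kspace b) a (fun i => f i x) n).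
Proof.
  intros [k Dk] Hs Hf Ha. induction n as [|n IH].
  - simpl. rewrite Rmult_0_l. split; [lra|]. exists k. split; auto. intros. rewrite KofR_0. ring.
  - assert (E : in_multiple (INR n * (t * s)) (fun x => lin_comb (Kspace b) a (fun i => f i x) n)) by auto.
    replace (fun x => lin_comb (Kspace b) a (fun i => f i x) (S n)) with
      (fun x => 1 * lin_comb (Kspace b) a (fun i => f i x) n + a n * f n x)%K
      by (apply functional_extensionality; intros x; simpl; ring).
    apply (in_multiple_combination _ _ E (Hf n (le_n _))).
    rewrite S_INR, Kabs_1. pose proof (Ha n (le_n _)).
    assert (Kabs (a n) * s <= t * s) by (apply Rmult_le_compat_r; auto). lra.
Qed.

Lemma in_multiple_1 f : in_multiple 1 f -> D f.
Proof.
  intros (_ & k & Dk & H). replace f with k; auto. apply functional_extensionality.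
  intros x. rewrite H, KofR_1. ring.
Qed.

Lemma in_multiple_of_mem f : D f -> in_multiple 1 f.
Proof. intros H. split; [lra|]. exists f. split; auto. intros. rewrite KofR_1. ring. Qed.

End AbsolutelyConvex.

Section Construction.
Context {b : bool} {W Z : NormedSpace b} (T : W -> Z) (CT : R).
Context (T_add : forall u v, T (u + v)%V = (T u + T v)%V)
  (T_scale : forall a u, T (a *: u)%V = (a *: T u)%V)
  (CT_pos : 0 <= CT) (T_bounded : forall u, norm (T u) <= CT * norm u).
Context (D : (Z -> K b) -> Prop) (C : R).
Context (D_convex : absolutely_convex Z D) (C_pos : 0 <= C)
  (D_linear : forall k, D k -> linear_functional Z k) (D_bounded : forall k, D k -> bounded_by Z C k).
Context (G : (Z -> K b) -> Prop) (eps : R).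
Context (G_D : forall k, G k -> D k) (G_uncountable : ~ countable_set G)
  (G_condensed : forall k L e, G k -> 0 < e ->
     ~ countable_set (fun k' => G k' /\ forall x, In x L -> Kabs (k' x - k x)%K <= e))
  (G_separated : forall k k', G k -> G k' -> k <> k' ->
     ~ bounded_by W eps (fun w => k (T w) - k' (T w))%K).
Context (y : nat -> Z) (par : nat -> nat) (par_lt : forall n, (0 < n)%nat -> (par n < n)%nat).
Context (lam r eta kap nu : R).
Context (lam_pos : 0 < lam) (lam_lt1 : lam < 1) (r_pos : 0 < r) (r_eps : 2 * r < eps)
  (eta_pos : 0 < eta) (kap_pos : 0 < kap) (nu_pos : 0 < nu).
Add Ring K_ring : (K_ring_theory b).
Add Ring W_ring : (sqz_ring_theory W).
Add Ring Z_ring : (sqz_ring_theory Z).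

(** [anchor] is stored beside [func] because the next functional is sought near the anchor, a
    condensation point of [G], whereas [func] is only in [D]. [points] serves the projections of the
    quotient, [norming] those of [W]. *)
Record stage := mk_stage {
  vec : W;
  anchor : Z -> K b;
  func : Z -> K b;
  points : list Z;
  norming : list (W -> K b)
}.

Implicit Types (f : nat -> stage).

(* The summand [(1 - lam) (1 - 2^-n) k] of [func] collects the corrections that make the values
   on earlier vectors exact; its weight stays below [1 - lam], so that [func] remains in [D]. *)
Record core f (n : nat) : Prop := mk_core {
  core_anchor : G (anchor (f n));
  core_unit : norm (vec (f n)) = 1;
  core_kernel : forall i, (i < n)%nat ->
    func (f i) (T (vec (f n))) = 0%K /\ anchor (f i) (T (vec (f n))) = 0%K /\
    Forall (fun h => h (vec (f n)) = 0%K) (norming (f i));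
  core_diag : exists t, lam * r < t /\ func (f n) (T (vec (f n))) = KofR b t;
  core_inherit : forall i, (i < n)%nat ->
    func (f n) (T (vec (f i))) = func (f (par n)) (T (vec (f i)));
  core_decomp : exists k, D k /\ forall x,
    func (f n) x = (KofR b lam * anchor (f n) x + KofR b ((1 - lam) * (1 - (/ 2) ^ n)) * k x)%K;
  core_close : forall x i, (i < n)%nat -> In x (y i :: points (f i)) ->
    Kabs (func (f n) x - func (f (par n)) x)%K <= eta * (/ 2) ^ n
}.

(** Kept apart from [core]: these lists are chosen after the vector and functional of stage [n] and
    constrain only later stages. The precision is divided by the number [n + 1] of coordinates, so
    that their errors add up to a multiple of [kap]. *)
Record nets f (n : nat) : Prop := mk_nets {
  nets_points : forall x, In x (points (f n)) -> norm x <= 1;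
  nets_approx : forall x, norm x <= 1 -> exists x', In x' (points (f n)) /\
    forall i, (i <= n)%nat -> Kabs (func (f i) x - func (f i) x')%K <= kap * / INR (S n);
  nets_linear : Forall (fun h => linear_functional W h /\ bounded_by W 1 h) (norming (f n));
  nets_norming : forall a, exists h, In h (norming (f n)) /\
    (1 - nu) * norm (lin_comb W a (fun i => vec (f i)) (S n))
      <= Kabs (h (lin_comb W a (fun i => vec (f i)) (S n)))
}.

(** The lists of stage [n] itself do not enter, so [core] can be established with empty lists and
    survives when they are filled in. *)
Lemma core_ext f g n :
  (forall m, (m < n)%nat -> f m = g m) -> vec (f n) = vec (g n) -> anchor (f n) = anchor (g n) ->
  func (f n) = func (g n) -> core f n -> core g n.
Proof.
  intros E E1 E2 E3 [c1 c2 c3 c4 c5 c6 c7].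
  assert (Hp : forall i, (i < n)%nat -> f (par n) = g (par n)) by (intros; apply E, par_lt; lia).
  split; rewrite <- ?E1, <- ?E2, <- ?E3; auto.
  - intros i Hi. rewrite <- (E i Hi). auto.
  - intros i Hi. rewrite <- (E i Hi), <- (Hp i Hi). auto.
  - intros x i Hi. rewrite <- (E i Hi), <- (Hp i Hi). eauto.
Qed.

Lemma nets_ext f g n : (forall m, (m <= n)%nat -> f m = g m) -> nets f n -> nets g n.
Proof.
  intros E [c1 c2 c3 c4]. split; rewrite <- ?(E n) by auto; auto.
  - intros x Hx. destruct (c2 x Hx) as (x' & Hx' & H). exists x'. split; auto.
    intros i Hi. rewrite <- (E i) by auto. auto.
  - intros a. rewrite (lin_comb_ext a a (fun i => vec (g i)) (fun i => vec (f i)) (n := S n)); auto.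
    intros i Hi. rewrite E by lia. reflexivity.
Qed.

(** The root has no parent, so its increment is the functional itself; the increments along the path
    to [n] then add up to [func (f n)]. *)
Definition increment f (i : nat) (x : Z) : K b :=
  match i with
  | O => func (f O) x
  | S _ => (func (f i) x - func (f (par i)) x)%K
  end.

Definition coord f (i : nat) (x : Z) : K b :=
  (Kinv (func (f i) (T (vec (f i)))) * increment f i x)%K.

Lemma func_mem f n : core f n -> D (func (f n)).
Proof.
  intros H. destruct (core_decomp H) as (k & Dk & E).
  apply in_multiple_1. replace (func (f n)) with
    (fun x => KofR b lam * anchor (f n) x + KofR b ((1 - lam) * (1 - (/ 2) ^ n)) * k x)%K
    by (apply functional_extensionality; intros; auto).
  apply (in_multiple_combination D_convex (s := 1) (s' := 1)).
  - apply in_multiple_of_mem, G_D, (core_anchor H).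
  - apply in_multiple_of_mem, Dk.
  - rewrite !Kabs_ofR. pose proof (half_pow_pos n).
    assert ((/ 2) ^ n <= 1) by (rewrite <- (pow1 n); apply pow_incr; lra).
    rewrite !Rabs_pos_eq by nra. nra.
Qed.

Lemma diag_inv f n :
  core f n -> func (f n) (T (vec (f n))) <> 0%K /\
  Kabs (Kinv (func (f n) (T (vec (f n))))) <= / (lam * r).
Proof.
  intros H. destruct (core_diag H) as (t & Ht & E).
  assert (0 < lam * r) by (apply Rmult_lt_0_compat; auto).
  assert (N : func (f n) (T (vec (f n))) <> 0%K).
  { intros E0. rewrite E0 in E. apply (f_equal Kabs) in E.
    rewrite Kabs_0, Kabs_ofR, Rabs_pos_eq in E; lra. }
  split; auto. rewrite Kabs_inv, E, Kabs_ofR, Rabs_pos_eq by (auto; lra).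
  apply Rinv_le_contravar; lra.
Qed.

Section CoordinateProperties.
Context (f : nat -> stage) (n : nat) (Hcore : forall m, (m < n)%nat -> core f m).

Lemma func_linear i : (i < n)%nat -> linear_functional Z (func (f i)).
Proof. intros Hi. apply D_linear, func_mem, Hcore, Hi. Qed.

Lemma increment_linear i : (i < n)%nat -> linear_functional Z (increment f i).
Proof.
  intros Hi. destruct i as [|i]; simpl; [apply (func_linear Hi)|].
  assert (Hp : (par (S i) < S i)%nat) by (apply par_lt; lia).
  destruct (func_linear Hi) as [h1 h2]. destruct (@func_linear (par (S i))) as [h3 h4]; [lia|].
  split; intros; simpl; rewrite ?h1, ?h2, ?h3, ?h4; ring.
Qed.

Lemma coord_linear i : (i < n)%nat -> linear_functional Z (coord f i).
Proof.
  intros Hi. destruct (increment_linear Hi) as [h1 h2].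
  split; intros; unfold coord; rewrite ?h1, ?h2; ring.
Qed.

Lemma increment_diag i : (i < n)%nat -> increment f i (T (vec (f i))) = func (f i) (T (vec (f i))).
Proof.
  intros Hi. destruct i as [|i]; simpl; auto.
  destruct (core_kernel (Hcore Hi) (par_lt (Nat.lt_0_succ i))) as [-> _]. ring.
Qed.

(** For [i < j] the later vector is killed by both functionals in the increment; for [i > j] they
    agree on the earlier vector by inheritance. *)
Lemma increment_off i j : (i < n)%nat -> (j < n)%nat -> i <> j -> increment f i (T (vec (f j))) = 0%K.
Proof.
  intros Hi Hj Hij. destruct (Nat.lt_ge_cases i j) as [L|L].
  - destruct (core_kernel (Hcore Hj) L) as [E _]. destruct i as [|i]; simpl; auto.
    assert (Hp : (par (S i) < S i)%nat) by (apply par_lt; lia).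
    destruct (core_kernel (Hcore Hj) (Nat.lt_trans _ _ _ Hp L)) as [E' _].
    rewrite E, E'. ring.
  - destruct i as [|i]; [lia|]. simpl.
    rewrite (core_inherit (Hcore Hi) (i := j)) by lia. ring.
Qed.

Lemma coord_diag i : (i < n)%nat -> coord f i (T (vec (f i))) = 1%K.
Proof.
  intros Hi. unfold coord. rewrite increment_diag by auto. apply Kinv_l, diag_inv, Hcore, Hi.
Qed.

Lemma coord_off i j : (i < n)%nat -> (j < n)%nat -> i <> j -> coord f i (T (vec (f j))) = 0%K.
Proof. intros. unfold coord. rewrite increment_off by auto. ring. Qed.

(** Two functionals from [D] and a diagonal value exceeding [lam * r] give the constant
    [2 / (lam * r)]. *)
Lemma coord_in_multiple i : (i < n)%nat -> in_multiple D (2 * / (lam * r)) (coord f i).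
Proof.
  intros Hi. destruct (diag_inv (Hcore Hi)) as [_ Hinv].
  set (c := Kinv (func (f i) (T (vec (f i))))) in *.
  pose proof (Kabs_pos c).
  destruct i as [|i].
  - replace (coord f 0) with (fun x => c * func (f O) x + 0 * func (f O) x)%K
      by (apply functional_extensionality; intros; unfold coord, c; simpl; ring).
    apply (in_multiple_combination D_convex (s := 1) (s' := 1));
      try (apply in_multiple_of_mem, func_mem, Hcore, Hi). rewrite Kabs_0. lra.
  - assert (Hp : (par (S i) < S i)%nat) by (apply par_lt; lia).
    replace (coord f (S i)) with (fun x => c * func (f (S i)) x + (- c) * func (f (par (S i))) x)%K
      by (apply functional_extensionality; intros; unfold coord, c; simpl; ring).
    apply (in_multiple_combination D_convex (s := 1) (s' := 1));
      try (apply in_multiple_of_mem, func_mem, Hcore; lia). rewrite Kabs_opp. lra.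
Qed.

Lemma in_multiple_bounded s g : in_multiple D s g -> bounded_by Z (s * C) g.
Proof.
  intros (Hs & k & Dk & E) x. rewrite E, Kabs_mul, Kabs_ofR, Rabs_pos_eq, Rmult_assoc by auto.
  apply Rmult_le_compat_l; auto. apply D_bounded; auto.
Qed.

Lemma coord_close i x x' e :
  (i < n)%nat -> (forall j, (j <= i)%nat -> Kabs (func (f j) x - func (f j) x')%K <= e) ->
  Kabs (coord f i x - coord f i x')%K <= 2 * / (lam * r) * e.
Proof.
  intros Hi He. destruct (diag_inv (Hcore Hi)) as [_ Hinv].
  unfold coord. set (c := Kinv (func (f i) (T (vec (f i))))) in *.
  replace (c * increment f i x - c * increment f i x')%K
    with (c * (increment f i x - increment f i x'))%K by ring.
  rewrite Kabs_mul. pose proof (Kabs_pos c).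
  assert (E : Kabs (increment f i x - increment f i x')%K <= 2 * e).
  { pose proof (He i (le_n _)) as H1. pose proof (Kabs_pos (func (f i) x - func (f i) x')%K).
    destruct i as [|i]; simpl in *; [lra|].
    assert (Hp : (par (S i) < S i)%nat) by (apply par_lt; lia).
    pose proof (He (par (S i)) (Nat.lt_le_incl _ _ Hp)) as H2.
    match goal with |- Kabs ?t <= _ => replace t with
      ((func (f (S i)) x - func (f (S i)) x') + - (func (f (par (S i))) x - func (f (par (S i))) x'))%K by ring end.
    eapply Rle_trans; [apply Kabs_tri|]. rewrite Kabs_opp. lra. }
  replace (2 * / (lam * r) * e) with (/ (lam * r) * (2 * e)) by ring.
  apply Rmult_le_compat; auto; apply Kabs_pos.
Qed.

End CoordinateProperties.

Lemma exists_anchor_and_vector (A : (Z -> K b) -> Prop) (F : list (W -> K b)) :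
  (forall k, A k -> G k) -> ~ countable_set A ->
  Forall (fun h => linear_functional W h /\ exists M, bounded_by W M h) F ->
  exists g w t, A g /\ norm w = 1 /\ Forall (fun h => h w = 0%K) F /\ g (T w) = KofR b t /\ r < t.
Proof.
  intros AG unc HF.
  destruct (uncountable_inhabited (uncountable_minus unc
    (@separated_near_span b W _ (fun k w => k (T w)) eps r F A
       (fun i j Hi Hj => G_separated (AG i Hi) (AG j Hj))
       (Forall_impl _ (fun h H => proj2 H) HF) r_eps))) as (g & Ag & N).
  destruct (@exists_kernel_vector b W F (fun w => g (T w)) r) as (w & t & H1 & H2 & H3 & H4).
  - lra.
  - apply Forall_impl with (2 := HF). tauto.
  - destruct (D_linear (G_D (AG g Ag))) as [g1 g2].
    split; intros; rewrite ?T_add, ?T_scale, ?g1, ?g2; reflexivity.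
  - intros H. apply N. auto.
  - exists g, w, t. auto.
Qed.

Lemma comp_T_linear_bounded k :
  D k -> linear_functional W (fun w => k (T w)) /\ exists M, bounded_by W M (fun w => k (T w)).
Proof.
  intros Dk. destruct (D_linear Dk) as [k1 k2]. split.
  - split; intros; rewrite ?T_add, ?T_scale, ?k1, ?k2; reflexivity.
  - exists (C * CT). intros w. eapply Rle_trans; [apply (D_bounded Dk)|].
    rewrite Rmult_assoc. apply Rmult_le_compat_l; auto.
Qed.

Definition killed f (n : nat) : list (W -> K b) :=
  flat_map (fun i => (fun w => func (f i) (T w)) :: (fun w => anchor (f i) (T w)) :: norming (f i)) (seq 0 n).

Lemma killed_spec f n w i :
  Forall (fun h => h w = 0%K) (killed f n) -> (i < n)%nat ->
  func (f i) (T w) = 0%K /\ anchor (f i) (T w) = 0%K /\ Forall (fun h => h w = 0%K) (norming (f i)).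
Proof.
  rewrite Forall_forall. intros H Hi.
  assert (H' : forall h, In h ((fun w => func (f i) (T w)) :: (fun w => anchor (f i) (T w)) :: norming (f i)) ->
    h w = 0%K).
  { intros h Hh. apply H. apply in_flat_map. exists i. split; auto. apply in_seq. lia. }
  split; [|split].
  - apply (H' (fun w => func (f i) (T w))). left; auto.
  - apply (H' (fun w => anchor (f i) (T w))). right; left; auto.
  - apply Forall_forall. intros h Hh. apply H'. right; right; auto.
Qed.

Lemma killed_linear_bounded f n :
  (forall m, (m < n)%nat -> core f m /\ nets f m) ->
  Forall (fun h => linear_functional W h /\ exists M, bounded_by W M h) (killed f n).
Proof.
  intros H. apply Forall_forall. intros h Hh. apply in_flat_map in Hh.
  destruct Hh as (i & Hi & Hh). apply in_seq in Hi. destruct (H i) as [Hc Hn]; [lia|].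
  destruct Hh as [<-|[<-|Hh]].
  - apply comp_T_linear_bounded, func_mem, Hc.
  - apply comp_T_linear_bounded, G_D, (core_anchor Hc).
  - pose proof (nets_linear Hn) as L. rewrite Forall_forall in L. destruct (L h Hh). eauto.
Qed.

Lemma exists_norm_bound (L : list Z) : exists B, 0 <= B /\ forall x, In x L -> norm x <= B.
Proof.
  induction L as [|x L (B & HB & H)].
  - exists 0. split; [lra|]. intros x [].
  - exists (Rmax (norm x) B). split; [apply Rle_trans with B; auto; apply Rmax_r|].
    intros x' [<-|Hx']; [apply Rmax_l|]. apply Rle_trans with B; auto; apply Rmax_r.
Qed.

Lemma core_step f n :
  (forall m, (m < n)%nat -> core f m /\ nets f m) ->
  exists w g z, core (update f n (mk_stage w g z nil nil)) n.
Proof.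
  intros H. assert (Hcore : forall m, (m < n)%nat -> core f m) by (intros; apply H; auto).
  assert (lr : 0 < / (lam * r)) by (apply Rinv_0_lt_compat, Rmult_lt_0_compat; auto).
  destruct n as [|n'].
  (* At the root the correction has weight [1 - (/ 2) ^ 0 = 0], so [func] is exactly [lam * g]. *)
  - destruct (@exists_anchor_and_vector G nil) as (g & w & t & Gg & Hw & _ & Et & Ht); auto.
    exists w, g, (fun x => KofR b lam * g x)%K.
    split; intros; try lia; rewrite ?update_eq; simpl; auto.
    + exists (lam * t). split; [apply Rmult_lt_compat_l; auto|]. rewrite Et, KofR_mul. reflexivity.
    + exists g. split; auto. intros x. rewrite Rminus_diag, Rmult_0_r, KofR_0. ring.
  - set (n := S n') in *. assert (Hp : (par n < n)%nat) by (apply par_lt; unfold n; lia).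
    set (p := par n) in *.
    (* The points where [g] must be close to the parent's anchor: the earlier [T (vec (f i))], where
       the difference has to be corrected, and those of [core_close]. *)
    set (L := flat_map (fun i => T (vec (f i)) :: y i :: points (f i)) (seq 0 n)).
    destruct (exists_norm_bound L) as (B & HB & HBL).
    (* [M] is the amplification of the error [e]: 1 for [g] itself, and [n] corrections with
       coefficients at most [e], measured in [D] or, through [C * B], on [L]. With [e = m0 / M] both
       budgets in [m0] are met. *)
    set (M := 1 + INR n * (2 * / (lam * r)) * (1 + C * B)).
    set (m0 := Rmin ((1 - lam) * (/ 2) ^ n) (eta * (/ 2) ^ n)).
    pose proof (half_pow_pos n) as Hh. pose proof (pos_INR n) as HINR.
    assert (P0 : 0 <= INR n * (2 * / (lam * r))) by (apply Rmult_le_pos; lra).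
    assert (PCB : 0 <= C * B) by (apply Rmult_le_pos; auto).
    assert (P1 : 0 <= INR n * (2 * / (lam * r)) * (C * B)) by (apply Rmult_le_pos; auto).
    assert (HM : 1 <= M) by (unfold M; nra).
    assert (Hm0 : 0 < m0) by (apply Rmin_glb_lt; apply Rmult_lt_0_compat; lra).
    set (e := m0 / M). assert (He : 0 < e) by (apply Rdiv_lt_0_compat; lra).
    assert (EM : e * M = m0) by (unfold e; field; lra).
    destruct (@exists_anchor_and_vector
      (fun k => G k /\ forall x, In x L -> Kabs (k x - anchor (f p) x)%K <= e) (killed f n))
      as (g & w & t & [Gg Hg] & Hw & Hkill & Et & Ht).
    { tauto. }
    { apply G_condensed; auto. apply (core_anchor (Hcore p Hp)). }
    { apply killed_linear_bounded, H. }
    pose proof (fun i => @killed_spec f n w i Hkill) as kill.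
    assert (inL : forall i x, (i < n)%nat -> In x (T (vec (f i)) :: y i :: points (f i)) -> In x L).
    { intros i x Hi Hx. apply in_flat_map. exists i. split; auto. apply in_seq. lia. }
    (* [s i] is what is missing at [T (vec (f i))] once [g] replaces the parent's anchor; by
       biorthogonality [v] has exactly this value there. *)
    pose (s := fun i => (KofR b lam * (anchor (f p) (T (vec (f i))) - g (T (vec (f i)))))%K).
    pose (v := fun x => lin_comb (Kspace b) s (fun i => coord f i x) n).
    assert (Hs : forall i, (i < n)%nat -> Kabs (s i) <= e).
    { intros i Hi. unfold s. rewrite Kabs_mul, Kabs_ofR, Rabs_pos_eq, Kabs_sub_sym by lra.
      pose proof (Hg _ (inL i _ Hi (or_introl eq_refl))).
      pose proof (Kabs_pos (g (T (vec (f i))) - anchor (f p) (T (vec (f i))))%K). nra. }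
    assert (Hv : in_multiple D (INR n * (e * (2 * / (lam * r)))) v).
    { apply in_multiple_lin_comb; auto.
      - exists g. auto.
      - lra.
      - intros i Hi. apply coord_in_multiple with n; auto. }
    assert (Hv1 : INR n * (e * (2 * / (lam * r))) <= (1 - lam) * (/ 2) ^ n).
    { apply Rle_trans with m0; [|apply Rmin_l]. rewrite <- EM. unfold M.
      replace (INR n * (e * (2 * / (lam * r)))) with (e * (INR n * (2 * / (lam * r)))) by ring.
      apply Rmult_le_compat_l; nra. }
    assert (Hv2 : forall x, In x L -> e + Kabs (v x) <= eta * (/ 2) ^ n).
    { intros x Hx. apply Rle_trans with m0; [|apply Rmin_r]. rewrite <- EM. unfold M.
      pose proof (in_multiple_bounded Hv x) as E. pose proof (HBL x Hx) as E'.
      apply Rle_trans with (e + INR n * (e * (2 * / (lam * r))) * (C * B)).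
      - apply Rplus_le_compat_l. eapply Rle_trans; [exact E|]. rewrite Rmult_assoc.
        apply Rmult_le_compat_l; [apply Hv|]. apply Rmult_le_compat_l; auto.
      - replace (e + INR n * (e * (2 * / (lam * r))) * (C * B))
          with (e * (1 + INR n * (2 * / (lam * r)) * (C * B))) by ring.
        apply Rmult_le_compat_l; nra. }
    pose (z := fun x => (func (f p) x + KofR b lam * (g x - anchor (f p) x) + v x)%K).
    exists w, g, z.
    split; intros; rewrite ?update_eq; fold p; rewrite ?update_neq by lia; simpl; auto.
    + exists (lam * t). split; [apply Rmult_lt_compat_l; auto|].
      (* At [T w] all earlier functionals and anchors vanish, hence also every coordinate in [v];
         only [lam * g (T w)] survives. *)
      destruct (kill p Hp) as (E1 & E2 & _). unfold z. rewrite E1, E2, Et, KofR_mul.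
      assert (Ev : v (T w) = 0%K).
      { apply (@lin_comb_0 b (Kspace b)). intros i Hi. unfold coord.
        assert (Ei : increment f i (T w) = 0%K).
        { destruct (kill i Hi) as (E3 & _). destruct i as [|i]; simpl; auto.
          assert (Hpi : (par (S i) < S i)%nat) by (apply par_lt; lia).
          destruct (kill (par (S i))) as (E4 & _); [lia|]. rewrite E3, E4. ring. }
        rewrite Ei. simpl. ring. }
      rewrite Ev. ring.
    + unfold z. assert (Ev : v (T (vec (f i))) = s i).
      { apply lin_comb_delta; auto.
        - apply coord_diag with n; auto.
        - intros j Hj Hij. apply coord_off with n; auto. }
      rewrite Ev. unfold s. ring.
    + destruct (core_decomp (Hcore p Hp)) as (k & Dk & Ek).
      (* The parent's correction has weight [(1 - lam) * (1 - 2^-p)] and [v] at most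
         [(1 - lam) * 2^-n]; [2 * 2^-n <= 2^-p] keeps the sum within the weight allowed at [n]. *)
      assert (Hsum : in_multiple D ((1 - lam) * (1 - (/ 2) ^ n))
        (fun x => KofR b ((1 - lam) * (1 - (/ 2) ^ p)) * k x + 1 * v x)%K).
      { apply (in_multiple_combination D_convex _ _ (in_multiple_of_mem _ _ Dk) Hv).
        rewrite Kabs_ofR, Kabs_1.
        assert ((/ 2) ^ p <= 1) by (rewrite <- (pow1 p); apply pow_incr; lra).
        assert (2 * (/ 2) ^ n <= (/ 2) ^ p) by (apply half_pow_lt; auto).
        assert ((1 - lam) * (2 * (/ 2) ^ n) <= (1 - lam) * (/ 2) ^ p) by (apply Rmult_le_compat_l; lra).
        rewrite Rabs_pos_eq by (apply Rmult_le_pos; lra). lra. }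
      destruct Hsum as (_ & k' & Dk' & Ek'). exists k'. split; auto. intros x.
      rewrite <- Ek'. unfold z. rewrite Ek. ring.
    + unfold z.
      replace (func (f p) x + KofR b lam * (g x - anchor (f p) x) + v x - func (f p) x)%K
        with (KofR b lam * (g x - anchor (f p) x) + v x)%K by ring.
      assert (Hx : In x L) by (apply (inL i); auto; right; rewrite update_neq in H1 by lia; exact H1).
      eapply Rle_trans; [apply Kabs_tri|]. eapply Rle_trans; [|apply (Hv2 x Hx)].
      apply Rplus_le_compat_r. rewrite Kabs_mul, Kabs_ofR, Rabs_pos_eq by lra.
      pose proof (Hg x Hx). pose proof (Kabs_pos (g x - anchor (f p) x)%K). nra.
Qed.

Lemma coord_bounded f n i :
  (forall m, (m < n)%nat -> core f m) -> (i < n)%nat -> bounded_by Z (2 * / (lam * r) * C) (coord f i).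
Proof. intros H Hi. apply in_multiple_bounded, (@coord_in_multiple f n); auto. Qed.

Lemma inv_lam_r_pos : 0 < / (lam * r).
Proof. apply Rinv_0_lt_compat, Rmult_lt_0_compat; auto. Qed.

(** Both lists come from total boundedness. For [norming], the coordinates are bounded on the unit
    sphere of the span of the first [n + 1] vectors, and points of the span whose coordinates agree
    within [nu / (n + 1)] are within [nu] in norm; norming functionals of the net points therefore
    lose at most the factor [1 - nu]. *)
Lemma nets_step f n :
  (forall m, (m <= n)%nat -> core f m) ->
  exists X N, nets (update f n (mk_stage (vec (f n)) (anchor (f n)) (func (f n)) X N)) n.
Proof.
  intros H. assert (Hcore : forall m, (m < S n)%nat -> core f m) by (intros; apply H; lia).
  assert (Hn : 0 < INR (S n)) by (apply lt_0_INR; lia).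
  destruct (@finite_net_scalars Z b (S n) (fun x => norm x <= 1) (fun i => func (f i)) (kap * / INR (S n)))
    as (X & HX & HX').
  { apply Rmult_lt_0_compat; auto. apply Rinv_0_lt_compat; auto. }
  { intros i Hi. exists (C * 1). intros x Hx.
    eapply Rle_trans; [apply (D_bounded (func_mem (Hcore i Hi)))|]. apply Rmult_le_compat_l; auto. }
  set (lc := fun a => lin_comb W a (fun i => vec (f i)) (S n)).
  assert (coord_lc : forall a i, (i < S n)%nat -> coord f i (T (lc a)) = a i).
  { intros a i Hi. unfold lc.
    assert (L : linear_functional W (fun u => coord f i (T u))).
    { destruct (coord_linear Hcore Hi) as [h1 h2].
      split; intros; rewrite ?T_add, ?T_scale, ?h1, ?h2; reflexivity. }
    rewrite (linear_lin_comb a _ (S n) L). apply lin_comb_delta; auto.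
    - apply coord_diag with (S n); auto.
    - intros j Hj Hij. apply coord_off with (S n); auto. }
  destruct (@finite_net_scalars W b (S n) (fun u => (exists a, u = lc a) /\ norm u = 1)
    (fun i u => coord f i (T u)) (nu * / INR (S n))) as (N & HN & HN').
  { apply Rmult_lt_0_compat; auto. apply Rinv_0_lt_compat; auto. }
  { intros i Hi. exists (2 * / (lam * r) * C * (CT * 1)). intros u [_ Hu].
    eapply Rle_trans; [apply (coord_bounded Hcore Hi)|]. pose proof inv_lam_r_pos.
    apply Rmult_le_compat_l; [apply Rmult_le_pos; lra|]. rewrite <- Hu. apply T_bounded. }
  pose (F := fun u => proj1_sig (constructive_indefinite_description _ (norming_functional W u))).
  assert (HF : forall u, linear_functional W (F u) /\ bounded_by W 1 (F u) /\ F u u = KofR b (norm u)) by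
    (intros u; exact (proj2_sig (constructive_indefinite_description _ (norming_functional W u)))).
  (* The functional of [vzero W] serves combinations of norm zero, which cannot be normalized. *)
  exists X, (map F (vzero W :: N)).
  assert (upd : forall i, (i <= n)%nat ->
    vec (update f n (mk_stage (vec (f n)) (anchor (f n)) (func (f n)) X (map F (vzero W :: N))) i) = vec (f i) /\
    func (update f n (mk_stage (vec (f n)) (anchor (f n)) (func (f n)) X (map F (vzero W :: N))) i) = func (f i)).
  { intros i Hi. destruct (Nat.eq_dec i n) as [->|]; [rewrite update_eq | rewrite update_neq by auto]; auto. }
  split.
  - rewrite update_eq. simpl. apply HX.
  - rewrite update_eq. intros x Hx. destruct (HX' x Hx) as (x' & Hx' & H').
    exists x'. split; [exact Hx'|]. intros i Hi. destruct (upd i Hi) as [_ ->]. apply H'. lia.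
  - rewrite update_eq. apply Forall_forall. intros h Hh. apply in_map_iff in Hh.
    destruct Hh as (u & <- & _). split; apply HF.
  - intros a. rewrite update_eq. simpl norming.
    rewrite (lin_comb_ext a a _ (fun i => vec (f i)) (n := S n)); [|auto|intros i Hi; apply upd; lia].
    fold (lc a).
    destruct (Req_dec (norm (lc a)) 0) as [E|E].
    { exists (F (vzero W)). split; [left; auto|]. rewrite E, Rmult_0_r. apply Kabs_pos. }
    pose proof (vnorm_pos (lc a)) as P. set (rho := norm (lc a)) in *.
    assert (Hrho : 0 < / rho) by (apply Rinv_0_lt_compat; lra).
    pose (a1 := fun i => (KofR b (/ rho) * a i)%K).
    assert (E1 : lc a1 = (KofR b (/ rho) *: lc a)%V) by apply lin_comb_scale.
    destruct (HN' (lc a1)) as (u & Hu & Hclose).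
    { split; [eauto|]. rewrite E1, vnorm_scale, Kabs_ofR, Rabs_pos_eq by lra. fold rho. field. lra. }
    destruct (HN u Hu) as [[a' ->] Hu1].
    exists (F (lc a')). split; [right; apply in_map; auto|].
    destruct (HF (lc a')) as (F1 & F2 & F3). rewrite Hu1, KofR_1 in F3.
    assert (Hdist : norm (lc a' - lc a1)%V <= nu).
    { unfold lc. rewrite <- lin_comb_sub.
      replace nu with (INR (S n) * (nu * / INR (S n))) by (field; lra).
      apply vnorm_lin_comb_le. intros i Hi.
      rewrite (core_unit (Hcore i Hi)), Rmult_1_r, Kabs_sub_sym.
      rewrite <- (coord_lc a1 i Hi), <- (coord_lc a' i Hi). auto. }
    pose proof (F2 (lc a' - lc a1)%V) as H1. rewrite linear_sub, F3 in H1 by auto.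
    pose proof (Kabs_le_sub b (K1 b) (F (lc a') (lc a1))) as H2. rewrite Kabs_1 in H2.
    assert (H3 : F (lc a') (lc a1) = (KofR b (/ rho) * F (lc a') (lc a))%K).
    { rewrite E1. apply F1. }
    rewrite H3, Kabs_mul, Kabs_ofR, (Rabs_pos_eq (/ rho)) in H2 by lra. rewrite H3 in H1.
    apply Rmult_le_reg_l with (/ rho); auto.
    replace (/ rho * ((1 - nu) * rho)) with (1 - nu) by (field; lra). lra.
Qed.

Lemma exists_stages : exists f, forall n, core f n /\ nets f n.
Proof.
  apply (course_of_values_choice (mk_stage (vzero W) (fun _ => 0%K) (fun _ => 0%K) nil nil)
    (fun f n => core f n /\ nets f n)).
  - intros f g n E [Hc Hn]. split; [|apply nets_ext with f; auto].
    apply core_ext with f; auto; intros; rewrite E; auto; lia.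
  - intros f n H. destruct (core_step H) as (w & g & z & Hc).
    set (f1 := update f n (mk_stage w g z nil nil)) in *.
    destruct (@nets_step f1 n) as (X & N & HN).
    { intros m Hm. destruct (Nat.eq_dec m n) as [->|Hmn]; auto.
      apply core_ext with f; unfold f1; rewrite ?update_neq by auto; auto; [|apply H; lia].
      intros k Hk. rewrite update_neq by lia. reflexivity. }
    exists (mk_stage w g z X N).
    assert (E : forall m, update f1 n (mk_stage w g z X N) m = update f n (mk_stage w g z X N) m).
    { intros m. unfold f1, update. destruct (Nat.eq_dec m n); auto. }
    split.
    + apply core_ext with f1; auto; unfold f1; rewrite ?update_eq; auto.
      intros m Hm. rewrite !update_neq by lia. reflexivity.
    + apply nets_ext with (2 := HN). intros m _. rewrite <- E. unfold f1. rewrite update_eq. reflexivity.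
Qed.

(** * Basis constants of the constructed sequences *)

Section Consequences.
Context (Z_complete : complete Z) (y_dense : forall x e, 0 < e -> exists n, norm (x - y n)%V < e).
Context (delta : R) (delta_pos : 0 < delta) (nu_delta : 1 <= (1 + delta) * (1 - nu))
  (kap_eta_delta : 2 * (kap + eta) * CT * / (lam * r) <= delta).
Context (f : nat -> stage) (Hf : forall n, core f n /\ nets f n).

Let x_ (m : nat) : Z := T (vec (f m)).
Let Hc : forall n m, (m < n)%nat -> core f m := fun _ m _ => proj1 (Hf m).

Lemma stage_coord_linear i : linear_functional Z (coord f i).
Proof. apply (coord_linear (@Hc (S i))). lia. Qed.

Lemma stage_coord_diag i : coord f i (x_ i) = 1%K.
Proof. apply (coord_diag (@Hc (S i))). lia. Qed.

Lemma stage_coord_off i j : i <> j -> coord f i (x_ j) = 0%K.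
Proof. apply (coord_off (n := S (i + j)) (@Hc _)); lia. Qed.

Lemma stage_coord_bounded i : bounded_by Z (2 * / (lam * r) * C) (coord f i).
Proof. apply (coord_bounded (@Hc (S i))). lia. Qed.

Lemma bound_pos : 0 <= 2 * / (lam * r) * C.
Proof. pose proof inv_lam_r_pos. apply Rmult_le_pos; lra. Qed.

Lemma coord_T_linear i : linear_functional W (fun u => coord f i (T u)).
Proof.
  destruct (stage_coord_linear i) as [h1 h2].
  split; intros; rewrite ?T_add, ?T_scale, ?h1, ?h2; reflexivity.
Qed.

Lemma coord_T_bounded i u : Kabs (coord f i (T u)) <= 2 * / (lam * r) * C * CT * norm u.
Proof.
  eapply Rle_trans; [apply stage_coord_bounded|]. rewrite (Rmult_assoc _ CT).
  apply Rmult_le_compat_l; [apply bound_pos | apply T_bounded].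
Qed.

Lemma norm_x_le m : norm (x_ m) <= CT.
Proof.
  unfold x_. eapply Rle_trans; [apply T_bounded|]. rewrite (core_unit (proj1 (Hf m))). lra.
Qed.

(** Some [h] in the list [norming] of stage [n - 1] almost norms the initial combination and kills
    all later vectors, so it has the same value at the longer combination and bounds its norm from
    below. *)
Lemma norm_initial_le a n N :
  (n <= N)%nat ->
  norm (lin_comb W a (fun i => vec (f i)) n) <= (1 + delta) * norm (lin_comb W a (fun i => vec (f i)) N).
Proof.
  intros HnN. pose proof (vnorm_pos (lin_comb W a (fun i => vec (f i)) N)) as P.
  destruct n as [|m]; [simpl; rewrite vnorm_0; apply Rmult_le_pos; lra|].
  destruct (nets_norming (proj2 (Hf m)) a) as (h & Hh & Hle).
  pose proof (nets_linear (proj2 (Hf m))) as L. rewrite Forall_forall in L.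
  destruct (L h Hh) as [h1 h2].
  assert (E : h (lin_comb W a (fun i => vec (f i)) N) = h (lin_comb W a (fun i => vec (f i)) (S m))).
  { clear Hle P. induction N as [|N IH]; [lia|].
    destruct (Nat.eq_dec (S m) (S N)) as [->|]; auto.
    change (lin_comb W a (fun i => vec (f i)) (S N))
      with (lin_comb W a (fun i => vec (f i)) N + a N *: vec (f N))%V.
    destruct h1 as [h3 h4]. rewrite h3, h4, IH by lia.
    destruct (core_kernel (proj1 (Hf N)) (i := m)) as (_ & _ & HK); [lia|].
    rewrite Forall_forall in HK. rewrite (HK h Hh). ring. }
  rewrite <- E in Hle. specialize (h2 (lin_comb W a (fun i => vec (f i)) N)).
  set (u := norm (lin_comb W a (fun i => vec (f i)) (S m))) in *.
  assert (0 <= u) by apply vnorm_pos.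
  apply Rle_trans with ((1 + delta) * (1 - nu) * u); [nra|]. rewrite Rmult_assoc.
  apply Rmult_le_compat_l; lra.
Qed.

Lemma vec_basic : basic_seq W (fun m => vec (f m)) (1 + delta).
Proof.
  apply (@biorthogonal_basis b W (vnorm W) _ (fun i u => coord f i (T u))).
  - apply vnorm_tri.
  - apply vnorm_opp.
  - apply coord_T_linear.
  - intros i. exists (2 * / (lam * r) * C * CT). split; [apply Rmult_le_pos; auto; apply bound_pos|].
    apply coord_T_bounded.
  - apply stage_coord_diag.
  - apply stage_coord_off.
  - lra.
  - intros u n Hu. apply Rnot_lt_le. intros Hlt.
    set (Q := fun v => lin_comb W (fun i => coord f i (T v)) (fun i => vec (f i)) n) in *.
    (* A crude bound for [Q], applied only to the error [u - v]; the sharp factor [1 + delta] is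
       applied to the finite combination [v]. Together they cost at most [M + 1 + delta] times the
       error, which stays below [gap]. *)
    set (M := INR n * (2 * / (lam * r) * C * CT)).
    assert (HM : 0 <= M).
    { apply Rmult_le_pos; [apply pos_INR|]. apply Rmult_le_pos; auto. apply bound_pos. }
    set (gap := norm (Q u) - (1 + delta) * norm u).
    destruct (Hu (gap / (M + 1 + delta))) as (a & N & Ha).
    { apply Rdiv_lt_0_compat; unfold gap; [fold (Q u) in Hlt|]; lra. }
    set (v := lin_comb W a (fun i => vec (f i)) N) in *.
    assert (H1 : norm (Q (u - v)%V) <= M * norm (u - v)%V).
    { unfold M. rewrite Rmult_assoc. apply vnorm_lin_comb_le. intros i _.
      rewrite (core_unit (proj1 (Hf i))), Rmult_1_r. apply coord_T_bounded. }
    assert (H2 : norm (Q v) <= (1 + delta) * norm v).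
    { pose (a' := fun i => if lt_dec i N then a i else 0%K).
      assert (Ev : v = lin_comb W a' (fun i => vec (f i)) (N + n)).
      { symmetry. apply lin_comb_truncate. lia. }
      assert (EQ : Q v = lin_comb W a' (fun i => vec (f i)) n).
      { apply lin_comb_ext; auto. intros i Hi.
        apply (@coordinate_lin_comb b W (fun i => vec (f i)) (fun i u => coord f i (T u)));
          [apply coord_T_linear | apply stage_coord_diag | apply stage_coord_off]. }
      rewrite EQ. rewrite Ev at 1. apply norm_initial_le. lia. }
    assert (H3 : Q u = (Q (u - v) + Q v)%V).
    { unfold Q. rewrite <- lin_comb_add. apply lin_comb_ext; auto. intros i _.
      rewrite (linear_sub u v (coord_T_linear i)). ring. }
    pose proof (vnorm_tri W (Q (u - v)%V) (Q v)) as H4. rewrite <- H3 in H4.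
    pose proof (vnorm_le_sub v u) as H5. rewrite (vnorm_sub_sym v u) in H5.
    apply Rmult_lt_compat_r with (r := M + 1 + delta) in Ha; [|lra].
    replace (gap / (M + 1 + delta) * (M + 1 + delta)) with gap in Ha by (field; lra).
    unfold gap in Ha.
    assert ((1 + delta) * norm v <= (1 + delta) * (norm (u - v)%V + norm u)) by
      (apply Rmult_le_compat_l; lra). lra.
  - auto.
  - intros u a n Hu e He. destruct (Hu e He) as (a' & N & H').
    pose (t := fun (s : nat -> K b) k i => if lt_dec i k then s i else 0%K).
    exists (fun i => t a n i - t a' N i)%K, (n + N)%nat.
    rewrite lin_comb_sub. unfold t. rewrite !lin_comb_truncate by lia.
    match goal with |- norm ?g < _ => replace g with
      (- (u - lin_comb W a' (fun i => vec (f i)) N))%V by vring end.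
    rewrite vnorm_opp. exact H'.
Qed.

Let Z0 (x : Z) : Prop := forall n, func (f n) x = 0%K.

(** When all increments vanish at [x], each functional agrees there with that of its parent, and the
    root functional is itself an increment. *)
Lemma Z0_of_coord x : (forall i, coord f i x = 0%K) -> Z0 x.
Proof.
  intros H n. induction n as [n IH] using (well_founded_induction lt_wf).
  destruct (diag_inv (proj1 (Hf n))) as [N _].
  assert (E : increment f n x = 0%K).
  { pose proof (Kinv_l N) as E. specialize (H n). unfold coord in H.
    transitivity (Kinv (func (f n) (T (vec (f n)))) * func (f n) (T (vec (f n))) * increment f n x)%K.
    - rewrite E. ring.
    - transitivity (func (f n) (T (vec (f n))) * (Kinv (func (f n) (T (vec (f n)))) * increment f n x))%K; [ring|].
      rewrite H. ring. }
  destruct n as [|n]; simpl in E; auto.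
  rewrite <- (IH (par (S n)) (par_lt (Nat.lt_0_succ n))). apply Ksub_eq0, E.
Qed.

Lemma coord_Z0 x i : Z0 x -> coord f i x = 0%K.
Proof. intros H. unfold coord. destruct i as [|i]; simpl; rewrite !H; ring. Qed.

Lemma stage_func_linear n : linear_functional Z (func (f n)).
Proof. apply D_linear, func_mem, Hf. Qed.

Lemma Z0_zero : Z0 0%V.
Proof. intros n. apply linear_0, stage_func_linear. Qed.

Lemma Z0_add x x' : Z0 x -> Z0 x' -> Z0 (x + x')%V.
Proof.
  intros H H' n. destruct (stage_func_linear n) as [-> _]. rewrite H, H'. ring.
Qed.

Lemma Z0_opp x : Z0 x -> Z0 (- x)%V.
Proof.
  intros H n. rewrite vopp_scale. destruct (stage_func_linear n) as [_ ->]. rewrite H. ring.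
Qed.

Let P (n : nat) (x : Z) : Z := lin_comb Z (fun i => coord f i x) x_ n.

Lemma coord_x_lin_comb a i n : coord f i (lin_comb Z a x_ n) = if lt_dec i n then a i else 0%K.
Proof.
  apply (@coordinate_lin_comb b Z x_ (coord f));
    [apply stage_coord_linear | apply stage_coord_diag | apply stage_coord_off].
Qed.

Lemma increment_coord E x m :
  Kabs (increment f m x) <= E -> Kabs (coord f m x) <= / (lam * r) * E.
Proof.
  intros H. unfold coord. rewrite Kabs_mul. destruct (diag_inv (proj1 (Hf m))) as [_ Hi].
  apply Rmult_le_compat; auto; apply Kabs_pos.
Qed.

(* Modulo [Z0], the remainder [x - P n x] is the absolutely convergent tail of the expansion. *)
Lemma quot_norm_remainder E x n :
  0 <= E -> (forall m, (n <= m)%nat -> Kabs (increment f m x) <= E * (/ 2) ^ m) ->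
  quot_norm Z Z0 (x - P n x)%V <= 2 * (/ (lam * r) * E * CT) * (/ 2) ^ n.
Proof.
  intros HE H. pose proof inv_lam_r_pos as Hi.
  assert (HB : 0 <= / (lam * r) * E) by (apply Rmult_le_pos; lra).
  pose (a := fun m => if lt_dec m n then 0%K else coord f m x).
  destruct (@geometric_Cauchy_limit b Z (lin_comb Z a x_) (/ (lam * r) * E * CT)) as [l Hl]; auto.
  { apply Rmult_le_pos; auto. }
  { intros m. cbn [lin_comb].
    replace (lin_comb Z a x_ m + a m *: x_ m - lin_comb Z a x_ m)%V with (a m *: x_ m)%V by vring.
    rewrite vnorm_scale. replace (/ (lam * r) * E * CT * (/ 2) ^ m)
      with (/ (lam * r) * (E * (/ 2) ^ m) * CT) by ring.
    apply Rmult_le_compat; [apply Kabs_pos | apply vnorm_pos | | apply norm_x_le].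
    unfold a. destruct (lt_dec m n).
    - rewrite Kabs_0. pose proof (half_pow_pos m). apply Rmult_le_pos; [lra|]. apply Rmult_le_pos; lra.
    - apply increment_coord, H. lia. }
  assert (Cl : forall i, coord f i l = a i).
  { intros i. apply Ksub_eq0, Kabs_eq0.
    destruct (Kabs_pos (coord f i l - a i)%K) as [Pos|Eq]; [exfalso|auto].
    destruct (half_pow_small (2 * / (lam * r) * C * (2 * (/ (lam * r) * E * CT))) Pos) as [N HN].
    specialize (HN (N + S i)%nat (Nat.le_add_r _ _)).
    pose proof (stage_coord_bounded i (l - lin_comb Z a x_ (N + S i))%V) as B.
    rewrite (linear_sub _ _ (stage_coord_linear i)), coord_x_lin_comb in B.
    destruct (lt_dec i (N + S i)); [|lia].
    pose proof (Rmult_le_compat_l _ _ _ bound_pos (Hl (N + S i)%nat)). lra. }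
  apply Rle_trans with (norm l).
  (* [l] and [x - P n x] have the same coordinates, so they differ by an element of [Z0]. *)
  - apply (quot_norm_le_of_sub Z0 Z0_zero). apply Z0_of_coord. intros i.
    rewrite !(linear_sub _ _ (stage_coord_linear i)), Cl. unfold P, a. rewrite coord_x_lin_comb.
    destruct (lt_dec i n); ring.
  - specialize (Hl n). replace (l - lin_comb Z a x_ n)%V with l in Hl; auto.
    assert (E0 : lin_comb Z a x_ n = 0%V).
    { transitivity (lin_comb Z (fun _ => K0 b) x_ n).
      - apply lin_comb_ext; auto. intros i Hi0. unfold a. destruct (lt_dec i n); [auto|lia].
      - clear. induction n as [|n IH]; simpl; auto. rewrite IH. vring. }
    rewrite E0. vring.
Qed.

(** Let [x'] be a net point scaled to approximate [z - z0], of norm [rho]. In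
    [P z = P (z - x') + x' - (x' - P x')] the first term is controlled by [kap], as the coordinates
    nearly agree; the second has norm at most [rho]; the third is a remainder controlled by [eta],
    because later functionals are close to those of their parents on the points of stage [m]. The
    infimum over [z0] gives the claim. *)
Lemma quot_norm_projection z n : quot_norm Z Z0 (P n z) <= (1 + delta) * quot_norm Z Z0 z.
Proof.
  pose proof inv_lam_r_pos as Hi.
  assert (key : forall z0, Z0 z0 -> quot_norm Z Z0 (P n z) <= (1 + delta) * norm (z - z0)%V).
  { intros z0 Hz0. pose proof (vnorm_pos (z - z0)%V) as Hrho.
    set (rho := norm (z - z0)%V) in *.
    assert (coord_z : forall i, coord f i (z - z0)%V = coord f i z).
    { intros i. rewrite (linear_sub _ _ (stage_coord_linear i)), (coord_Z0 i Hz0). ring. }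
    destruct n as [|m].
    { eapply Rle_trans; [apply (quot_norm_le_norm Z0 Z0_zero)|]. unfold P; simpl. rewrite vnorm_0.
      apply Rmult_le_pos; lra. }
    destruct Hrho as [Hrho|E].
    - assert (Hrho' : 0 < / rho) by (apply Rinv_0_lt_compat; auto).
      destruct (nets_approx (proj2 (Hf m)) (KofR b (/ rho) *: (z - z0))%V) as (x & Hx & Hclose).
      { rewrite vnorm_scale, Kabs_ofR, Rabs_pos_eq by lra. fold rho. right. field. lra. }
      set (x1 := (KofR b (/ rho) *: (z - z0))%V) in *.
      set (x' := (KofR b rho *: x)%V).
      assert (E1 : P (S m) z =
        (lin_comb Z (fun i => coord f i z - coord f i x')%K x_ (S m) + (x' + - (x' - P (S m) x')))%V).
      { rewrite lin_comb_sub. fold (P (S m) z) (P (S m) x'). vring. }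
      rewrite E1.
      eapply Rle_trans; [apply (quot_norm_tri Z0 Z0_zero Z0_add)|].
      assert (B1 : quot_norm Z Z0 (lin_comb Z (fun i => coord f i z - coord f i x')%K x_ (S m))
        <= 2 * kap * CT * / (lam * r) * rho).
      { eapply Rle_trans; [apply (quot_norm_le_norm Z0 Z0_zero)|].
        assert (Hn : 0 < INR (S m)) by (apply lt_0_INR; lia).
        replace (2 * kap * CT * / (lam * r) * rho) with
          (INR (S m) * (rho * (2 * / (lam * r) * (kap * / INR (S m))) * CT))
          by (field; split; [lra | split; lra]).
        apply vnorm_lin_comb_le. intros i Hi'.
        apply Rmult_le_compat; [apply Kabs_pos | apply vnorm_pos | | apply norm_x_le].
        replace (coord f i z) with (KofR b rho * coord f i x1)%K.
        - unfold x'. destruct (stage_coord_linear i) as [_ ->].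
          replace (KofR b rho * coord f i x1 - KofR b rho * coord f i x)%K
            with (KofR b rho * (coord f i x1 - coord f i x))%K by ring.
          rewrite Kabs_mul, Kabs_ofR, Rabs_pos_eq by lra. apply Rmult_le_compat_l; [lra|].
          apply (coord_close (n := S m) (@Hc _)); auto. intros j Hj. apply Hclose. lia.
        - unfold x1. destruct (stage_coord_linear i) as [_ ->]. rewrite coord_z.
          transitivity (KofR b rho * KofR b (/ rho) * coord f i z)%K; [ring|].
          rewrite <- KofR_mul, Rinv_r, KofR_1 by lra. ring. }
      assert (Hx' : norm x' <= rho).
      { unfold x'. rewrite vnorm_scale, Kabs_ofR, Rabs_pos_eq by lra.
        pose proof (nets_points (proj2 (Hf m)) x Hx). nra. }
      assert (B2 : quot_norm Z Z0 (x' - P (S m) x')%V <= 2 * eta * CT * / (lam * r) * rho).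
      { eapply Rle_trans; [apply (@quot_norm_remainder (rho * eta))|].
        - apply Rmult_le_pos; lra.
        - intros k Hk. destruct k as [|k]; [lia|]. simpl increment. unfold x'.
          destruct (stage_func_linear (S k)) as [_ ->]. destruct (stage_func_linear (par (S k))) as [_ ->].
          match goal with |- Kabs ?t <= _ => replace t with
            (KofR b rho * (func (f (S k)) x - func (f (par (S k))) x))%K by ring end.
          rewrite Kabs_mul, Kabs_ofR, Rabs_pos_eq, Rmult_assoc by lra.
          apply Rmult_le_compat_l; [lra|].
          apply (core_close (proj1 (Hf (S k))) (i := m)); [lia|right; auto].
        - pose proof (half_pow_le1 (S m)).
          assert (0 <= 2 * (/ (lam * r) * (rho * eta) * CT)).
          { repeat apply Rmult_le_pos; lra. }
          replace (2 * eta * CT * / (lam * r) * rho) with (2 * (/ (lam * r) * (rho * eta) * CT) * 1) by ring.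
          apply Rmult_le_compat_l; auto. }
      pose proof (quot_norm_tri Z0 Z0_zero Z0_add x' (- (x' - P (S m) x'))%V) as B3.
      rewrite (quot_norm_opp Z0 Z0_zero Z0_opp) in B3.
      pose proof (quot_norm_le_norm Z0 Z0_zero x') as B4.
      assert (2 * (kap + eta) * CT * / (lam * r) * rho <= delta * rho) by
        (apply Rmult_le_compat_r; lra). lra.
    - eapply Rle_trans; [apply (quot_norm_le_norm Z0 Z0_zero)|].
      assert (E0 : (z - z0)%V = 0%V) by (apply vnorm_def; symmetry; exact E).
      replace (P (S m) z) with (vzero Z).
      + rewrite vnorm_0, <- E. lra.
      + symmetry. transitivity (lin_comb Z (fun _ => K0 b) x_ (S m)).
        * apply lin_comb_ext; auto. intros i _. rewrite <- coord_z, E0.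
          apply linear_0, stage_coord_linear.
        * clear. induction (S m) as [|n IH]; simpl; auto. rewrite IH. vring. }
  apply Rnot_lt_le. intros Hlt.
  destruct (proj2 (quot_norm_glb Z0 Z0_zero z)
    ((quot_norm Z Z0 (P n z) - (1 + delta) * quot_norm Z Z0 z) / (1 + delta))) as (z0 & Hz0 & Hlt').
  { apply Rdiv_lt_0_compat; lra. }
  pose proof (key z0 Hz0) as Hk. set (q := quot_norm Z Z0 z) in *. set (q' := quot_norm Z Z0 (P n z)) in *.
  apply Rmult_lt_compat_l with (r := 1 + delta) in Hlt'; [|lra].
  replace ((1 + delta) * (q + (q' - (1 + delta) * q) / (1 + delta))) with q' in Hlt' by (field; lra). lra.
Qed.

Lemma quotient_basis : basis_of Z (quot_norm Z Z0) x_ (fun _ => True) (1 + delta).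
Proof.
  pose proof inv_lam_r_pos as Hi.
  apply (@biorthogonal_basis b Z (quot_norm Z Z0) x_ (coord f)).
  - apply (quot_norm_tri Z0 Z0_zero Z0_add).
  - apply (quot_norm_opp Z0 Z0_zero Z0_opp).
  - apply stage_coord_linear.
  - intros i. exists (2 * / (lam * r) * C). split; [apply bound_pos|].
    apply quot_norm_bounded; auto.
    + apply Z0_zero.
    + apply bound_pos.
    + apply stage_coord_linear.
    + apply stage_coord_bounded.
    + intros x. apply coord_Z0.
  - apply stage_coord_diag.
  - apply stage_coord_off.
  - lra.
  - intros z n _. apply quot_norm_projection.
  (* It is enough to expand the dense vectors: past stage [j] the increments at [y j] decay like
     [eta * 2^-k], so its remainder tends to zero. *)
  - intros z _ e He. destruct (@y_dense z (e / 2)) as [j Hj]; [lra|].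
    destruct (@half_pow_small (2 * (/ (lam * r) * eta * CT)) (e / 2)) as [N HN]; [lra|].
    exists (fun i => coord f i (y j)), (N + S j)%nat. fold (P (N + S j) (y j)).
    replace (z - P (N + S j) (y j))%V with ((z - y j) + (y j - P (N + S j) (y j)))%V by vring.
    eapply Rle_lt_trans; [apply (quot_norm_tri Z0 Z0_zero Z0_add)|].
    pose proof (quot_norm_le_norm Z0 Z0_zero (z - y j)%V).
    specialize (HN (N + S j)%nat (Nat.le_add_r _ _)).
    assert (quot_norm Z Z0 (y j - P (N + S j) (y j))%V <= 2 * (/ (lam * r) * eta * CT) * (/ 2) ^ (N + S j)).
    { apply quot_norm_remainder; [lra|]. intros k Hk. destruct k as [|k]; [lia|]. simpl increment.
      apply (core_close (proj1 (Hf (S k))) (i := j)); [lia|left; auto]. }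
    lra.
  - auto.
Qed.

End Consequences.

Theorem exists_system (delta : R) :
  complete Z -> (forall x e, 0 < e -> exists n, norm (x - y n)%V < e) ->
  0 < delta -> 1 <= (1 + delta) * (1 - nu) -> 2 * (kap + eta) * CT * / (lam * r) <= delta ->
  exists (w : nat -> W) (z : nat -> Z -> K b),
    (forall n, norm (w n) = 1) /\
    (forall n, D (z n)) /\
    (forall n, exists t, lam * r < t /\ z n (T (w n)) = KofR b t) /\
    (forall i n, (i < n)%nat -> z i (T (w n)) = 0%K) /\
    (forall i n, (i < n)%nat -> z n (T (w i)) = z (par n) (T (w i))) /\
    (forall j n, (j < n)%nat -> Kabs (z n (y j) - z (par n) (y j))%K <= eta * (/ 2) ^ n) /\
    basic_seq W w (1 + delta) /\
    basis_of Z (quot_norm Z (fun x => forall n, z n x = 0%K)) (fun m => T (w m)) (fun _ => True) (1 + delta).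
Proof.
  intros HZ Hy Hd Hnu Hke. destruct exists_stages as [f Hf].
  exists (fun n => vec (f n)), (fun n => func (f n)).
  repeat match goal with |- _ /\ _ => split end.
  - intros n. apply (core_unit (proj1 (Hf n))).
  - intros n. apply func_mem, Hf.
  - intros n. apply (core_diag (proj1 (Hf n))).
  - intros i n Hi. apply (core_kernel (proj1 (Hf n)) Hi).
  - intros i n Hi. apply (core_inherit (proj1 (Hf n)) Hi).
  - intros j n Hj. apply (core_close (proj1 (Hf n)) Hj). left; auto.
  - apply vec_basic; auto.
  - apply quotient_basis; auto.
Qed.

End Construction.

(** * Trees, branches and the coarse wedge topology *)

Lemma prefix_refl s : prefix s s.
Proof. exists nil. rewrite app_nil_r. reflexivity. Qed.

Lemma prefix_trans s t u : prefix s t -> prefix t u -> prefix s u.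
Proof. intros [r ->] [r' ->]. exists (r ++ r'). rewrite app_assoc. reflexivity. Qed.

Lemma prefix_comparable s t u : prefix s u -> prefix t u -> prefix s t \/ prefix t s.
Proof.
  intros [r ->] [r' E]. destruct (app_eq_app _ _ _ _ E) as (l & [[-> _]|[-> _]]).
  - right. exists l. reflexivity.
  - left. exists l. reflexivity.
Qed.

Lemma prefix_length s t : prefix s t -> (length s <= length t)%nat.
Proof. intros [r ->]. rewrite length_app. lia. Qed.

Lemma prefix_eq s t : prefix s t -> (length t <= length s)%nat -> s = t.
Proof.
  intros [r ->] H. rewrite length_app in H. destruct r as [|a r]; [|simpl in H; lia].
  rewrite app_nil_r. reflexivity.
Qed.

Lemma prefix_snoc s t a : prefix s (t ++ a :: nil) -> prefix s t \/ s = t ++ a :: nil.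
Proof.
  intros [r E]. destruct r as [|c r] using rev_ind.
  - right. rewrite app_nil_r in E. auto.
  - left. rewrite app_assoc in E. apply app_inj_tail in E. destruct E as [-> _]. exists r. reflexivity.
Qed.

Section Tree.
Context (Tr : list nat -> Prop) (Tr_closed : down_closed Tr) (tau : nat -> list nat)
  (tau_in : forall n, Tr (tau n)) (tau_inj : forall n m, tau n = tau m -> n = m)
  (tau_surj : forall t, Tr t -> exists n, tau n = t)
  (tau_mono : forall l m, prefix (tau l) (tau m) -> (l <= m)%nat).

Lemma tau_0 : tau 0 = nil.
Proof.
  destruct (tau_surj (t := nil)) as [n Hn].
  { apply Tr_closed with (tau 0); auto. exists (tau 0). reflexivity. }
  assert (n <= 0)%nat by (apply tau_mono; rewrite Hn; exists (tau 0); reflexivity).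
  replace 0%nat with n by lia. exact Hn.
Qed.

Lemma exists_parent :
  exists par, forall n, (0 < n)%nat -> (par n < n)%nat /\ exists a, tau n = tau (par n) ++ a :: nil.
Proof.
  assert (H : forall n, exists p, (0 < n)%nat -> (p < n)%nat /\ exists a, tau n = tau p ++ a :: nil).
  { intros n. destruct (Nat.eq_dec n 0) as [->|Hn]; [exists O; lia|].
    destruct (@exists_last _ (tau n)) as (t & a & E).
    { intros E. apply Hn, tau_inj. rewrite E, tau_0. reflexivity. }
    assert (Ht : prefix t (tau n)) by (exists (a :: nil); exact E).
    destruct (tau_surj (t := t)) as [p Hp]; [apply Tr_closed with (tau n); auto|].
    exists p. intros _. split; [|exists a; rewrite Hp; exact E].
    rewrite <- Hp in Ht. pose proof (tau_mono Ht).
    destruct (Nat.eq_dec p n) as [->|]; [|lia].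
    apply (f_equal (@length nat)) in E. rewrite length_app, <- Hp in E. simpl in E. lia. }
  exists (fun n => proj1_sig (constructive_indefinite_description _ (H n))).
  intros n. exact (proj2_sig (constructive_indefinite_description _ (H n))).
Qed.

Definition index (t : list nat) : nat := epsilon (inhabits O) (fun n => tau n = t).

Lemma tau_index t : Tr t -> tau (index t) = t.
Proof. intros H. unfold index. apply epsilon_spec. auto. Qed.

Lemma index_tau n : index (tau n) = n.
Proof. apply tau_inj, tau_index, tau_in. Qed.

(** Adding [s] to [B] leaves a chain inside the tree, so maximality puts [s] in [B]. *)
Lemma branch_down B s t : is_branch Tr B -> B t -> prefix s t -> B s.
Proof.
  intros (HT & Hch & _ & Hmax) Bt Hs.
  apply (Hmax (fun u => B u \/ u = s)); auto.
  - intros u [Bu| ->]; auto. apply Tr_closed with t; auto.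
  - assert (D : forall u, B u -> prefix u s \/ prefix s u).
    { intros u Bu. destruct (Hch u t Bu Bt) as [H|H].
      - apply prefix_comparable with t; auto.
      - right. apply prefix_trans with t; auto. }
    intros u v [Bu| ->] [Bv| ->]; auto.
    + destruct (D v Bv); auto.
    + left. apply prefix_refl.
Qed.

(** A chain has at most one element of each length, so a branch of bounded length would be
    finite. *)
Lemma branch_long B k : is_branch Tr B -> exists s, B s /\ (k <= length s)%nat.
Proof.
  intros (HT & Hch & Hinf & _). apply NNPP. intros N. apply Hinf.
  assert (H : exists l, forall s, B s -> (length s < k)%nat -> In s l).
  { clear N. induction k as [|k [l Hl]].
    - exists nil. intros; lia.
    - destruct (classic (exists s0, B s0 /\ length s0 = k)) as [(s0 & B0 & L0)|N].
      + exists (s0 :: l). intros s Bs Ls. destruct (Nat.eq_dec (length s) k) as [E|E].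
        * left. destruct (Hch s s0 Bs B0) as [P|P]; [symmetry|]; apply prefix_eq; auto; lia.
        * right. apply Hl; auto. lia.
      + exists l. intros s Bs Ls. apply Hl; auto.
        destruct (Nat.eq_dec (length s) k); [exfalso; eauto | lia]. }
  destruct H as [l Hl]. exists l. intros s Bs. apply Hl; auto.
  apply Nat.nle_gt. intros H. apply N. eauto.
Qed.

Lemma le'_comparable s t u :
  in_Tbar Tr u -> le' (Node s) u -> le' (Node t) u -> prefix s t \/ prefix t s.
Proof.
  destruct u as [v|B]; simpl.
  - intros _. apply prefix_comparable.
  - intros (_ & Hch & _). apply Hch.
Qed.

(** * Functionals at nodes and branches, and their continuity *)

Section System.
Context {b : bool} {W Z : NormedSpace b} (T : W -> Z) (D : (Z -> K b) -> Prop) (C : R) (C_pos : 0 <= C)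
  (D_linear : forall k, D k -> linear_functional Z k) (D_bounded : forall k, D k -> bounded_by Z C k)
  (Ks : (Z -> K b) -> Prop) (D_Ks : forall k, D k -> Ks k) (Ks_compact : compact_in (@weakstar_open b Z) Ks).
Context (y : nat -> Z) (y_dense : forall x e, 0 < e -> exists n, norm (x - y n)%V < e).
Context (par : nat -> nat)
  (par_spec : forall n, (0 < n)%nat -> (par n < n)%nat /\ exists a, tau n = tau (par n) ++ a :: nil).
Context (eta : R) (eta_pos : 0 < eta) (w : nat -> W) (z : nat -> Z -> K b).
Context (z_D : forall n, D (z n))
  (z_kernel : forall i n, (i < n)%nat -> z i (T (w n)) = 0%K)
  (z_inherit : forall i n, (i < n)%nat -> z n (T (w i)) = z (par n) (T (w i)))
  (z_close : forall j n, (j < n)%nat -> Kabs (z n (y j) - z (par n) (y j))%K <= eta * (/ 2) ^ n).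

Lemma prefix_par i n : (0 < n)%nat -> prefix (tau i) (tau n) -> i <> n -> prefix (tau i) (tau (par n)).
Proof.
  intros Hn H Hi. destruct (par_spec Hn) as (_ & a & E). rewrite E in H.
  destruct (prefix_snoc _ _ H) as [|E']; auto. exfalso. apply Hi, tau_inj. congruence.
Qed.

Lemma prefix_of_par i n : (0 < n)%nat -> prefix (tau i) (tau (par n)) -> prefix (tau i) (tau n).
Proof.
  intros Hn H. destruct (par_spec Hn) as (_ & a & E). apply prefix_trans with (1 := H).
  exists (a :: nil). exact E.
Qed.

Lemma length_tau n : (length (tau n) <= n)%nat.
Proof.
  induction n as [n IH] using (well_founded_induction lt_wf).
  destruct n as [|n]; [rewrite tau_0; simpl; lia|].
  destruct (par_spec (Nat.lt_0_succ n)) as (Hp & a & E). specialize (IH _ Hp).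
  rewrite E, length_app. simpl. lia.
Qed.

(** On the way from [n] to [i] through parents, every node before [i] has index greater than [i],
    and inheritance keeps the value. *)
Lemma value_below i n : prefix (tau i) (tau n) -> z n (T (w i)) = z i (T (w i)).
Proof.
  induction n as [n IH] using (well_founded_induction lt_wf). intros H.
  destruct (Nat.eq_dec i n) as [->|Hi]; auto. pose proof (tau_mono H).
  assert (Hn : (0 < n)%nat) by lia.
  rewrite z_inherit by lia. apply IH; [apply par_spec, Hn | apply prefix_par; auto].
Qed.

(** The walk through parents now avoids [i], so it reaches an index below [i], where [z_kernel]
    gives zero. *)
Lemma value_off i n : ~ prefix (tau i) (tau n) -> z n (T (w i)) = 0%K.
Proof.
  induction n as [n IH] using (well_founded_induction lt_wf). intros H.
  destruct (Nat.lt_trichotomy i n) as [Hi|[->|Hi]]; auto.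
  - assert (Hn : (0 < n)%nat) by lia. rewrite z_inherit by auto.
    apply IH; [apply par_spec, Hn|]. intros H'. apply H, prefix_of_par; auto.
  - destruct H. apply prefix_refl.
Qed.

(** The nodes after [i] on the path to [n] have index at least [N], hence above [j], so [z_close]
    applies at each and the steps form a geometric series. The change of the term
    [2 * eta * (/ 2) ^ n] in [claim] from [par n] to [n] pays for one step. *)
Lemma node_close N j i n :
  (j < N)%nat -> prefix (tau i) (tau n) ->
  (forall m, (m < N)%nat -> prefix (tau m) (tau n) -> prefix (tau m) (tau i)) ->
  Kabs (z n (y j) - z i (y j))%K <= 4 * eta * (/ 2) ^ N.
Proof.
  intros Hj Hp Hm.
  assert (claim : n = i \/
    (N <= n)%nat /\ Kabs (z n (y j) - z i (y j))%K <= 4 * eta * (/ 2) ^ N - 2 * eta * (/ 2) ^ n).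
  { induction n as [n IH] using (well_founded_induction lt_wf).
    destruct (Nat.eq_dec n i) as [E|E]; [auto|right].
    assert (HN : (N <= n)%nat).
    { apply Nat.nlt_ge. intros H. apply E. apply Nat.le_antisymm; apply tau_mono; auto.
      apply Hm; auto. apply prefix_refl. }
    split; auto. assert (Hn : (0 < n)%nat) by lia.
    destruct (par_spec Hn) as (Hpn & _).
    assert (H1 : Kabs (z n (y j) - z (par n) (y j))%K <= eta * (/ 2) ^ n) by (apply z_close; lia).
    pose proof (half_pow_pos n) as P1. pose proof (half_pow_pos N) as P2.
    assert (P3 : (/ 2) ^ n <= (/ 2) ^ N).
    { destruct (Nat.eq_dec N n) as [->|]; [lra|].
      pose proof (@half_pow_lt N n). assert (N < n)%nat by lia. pose proof (half_pow_pos n). intuition lra. }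
    assert (P4 : eta * (/ 2) ^ n <= eta * (/ 2) ^ N) by (apply Rmult_le_compat_l; lra).
    assert (P5 : 0 < eta * (/ 2) ^ n) by (apply Rmult_lt_0_compat; lra).
    destruct (IH (par n) Hpn) as [Ep|[_ H2]].
    - apply prefix_par; auto.
    - intros m HmN Hmp. apply Hm; auto. apply prefix_of_par; auto.
    - rewrite Ep in H1. lra.
    - pose proof (half_pow_lt Hpn) as P6.
      assert (P7 : eta * (2 * (/ 2) ^ n) <= eta * (/ 2) ^ par n) by (apply Rmult_le_compat_l; lra).
      pose proof (Ksub_le b (z n (y j)) (z (par n) (y j)) (z i (y j))). lra. }
  pose proof (half_pow_pos N) as P2. assert (0 < eta * (/ 2) ^ N) by (apply Rmult_lt_0_compat; lra).
  destruct claim as [->|[_ H7]].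
  - replace (z i (y j) - z i (y j))%K with (K0 b) by (symmetry; apply (Ropp_def (K_ring_theory b))).
    rewrite Kabs_0. lra.
  - pose proof (half_pow_pos n). assert (0 < eta * (/ 2) ^ n) by (apply Rmult_lt_0_compat; lra). lra.
Qed.

(** A cluster condition for one [x] at a time is enough: the exact values and the continuity
    estimate each concern a single [x]. *)
Definition branch_limit (B : list nat -> Prop) (phi : Z -> K b) : Prop :=
  Ks phi /\ forall x e s, 0 < e -> B s ->
    exists t, B t /\ prefix s t /\ Kabs (z (index t) x - phi x)%K < e.

Lemma weakstar_ball_open (phi : Z -> K b) (x : Z) e :
  0 < e -> weakstar_open Z (fun f : Z -> K b => Kabs (f x - phi x)%K < e).
Proof.
  intros He f Hf. exists ((fun f : Z -> K b => Kabs (f x - phi x)%K < e) :: nil). repeat split.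
  - constructor; auto. exists x, (phi x), e. split; auto. reflexivity.
  - constructor; auto.
  - intros g Hg. inversion Hg. auto.
Qed.

(* A cluster point in the compact set [Ks] of the functionals along the branch suffices. *)
Lemma exists_branch_limit B : is_branch Tr B -> exists phi, branch_limit B phi.
Proof.
  intros HB.
  assert (Hs : forall k, exists s, B s /\ (k <= length s)%nat) by (intros; apply branch_long; auto).
  pose (s := fun k => proj1_sig (constructive_indefinite_description _ (Hs k))).
  assert (sB : forall k, B (s k) /\ (k <= length (s k))%nat) by
    (intros k; exact (proj2_sig (constructive_indefinite_description _ (Hs k)))).
  assert (cluster : exists phi, Ks phi /\ forall U N, weakstar_open Z U -> U phi ->
    exists k, (N <= k)%nat /\ U (z (index (s k)))).
  { apply NNPP. intros N.
    pose (I := {p : ((Z -> K b) -> Prop) * nat | weakstar_open Z (fst p) /\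
      forall k, (snd p <= k)%nat -> ~ fst p (z (index (s k)))}).
    destruct (Ks_compact (fun i : I => fst (proj1_sig i))) as [l Hl].
    - intros i. exact (proj1 (proj2_sig i)).
    - intros phi Hphi. apply NNPP. intros N'. apply N. exists phi. split; auto.
      intros U M HU Uphi. apply NNPP. intros N''. apply N'.
      assert (HI : weakstar_open Z (fst (U, M)) /\
        forall k, (snd (U, M) <= k)%nat -> ~ fst (U, M) (z (index (s k)))) by (split; simpl; eauto).
      exists (exist _ (U, M) HI). exact Uphi.
    - pose (M := list_max (map (fun i : I => snd (proj1_sig i)) l)).
      destruct (Hl (z (index (s M)))) as (i & Hi & HU); [apply D_Ks, z_D|].
      destruct i as [p [Hp1 Hp2]]. apply (Hp2 M); [|exact HU].
      assert (F : Forall (fun k => k <= M)%nat (map (fun i : I => snd (proj1_sig i)) l)) by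
        (apply list_max_le; reflexivity).
      rewrite Forall_forall in F. apply F.
      exact (in_map (fun i : I => snd (proj1_sig i)) _ _ Hi). }
  destruct cluster as (phi & Kphi & Hphi). exists phi. split; auto.
  intros x e s0 He Bs0.
  destruct (Hphi _ (length s0) (@weakstar_ball_open phi x e He)) as (k & Hk & Hclose).
  { simpl. replace (phi x - phi x)%K with (K0 b) by (symmetry; apply (Ropp_def (K_ring_theory b))).
    rewrite Kabs_0. auto. }
  destruct (sB k) as [Bk Lk]. exists (s k). split; [|split]; auto.
  destruct HB as (_ & Hch & _). destruct (Hch s0 (s k) Bs0 Bk) as [P|P]; auto.
  rewrite (prefix_eq P) by lia. apply prefix_refl.
Qed.

Definition point_functional (u : tpoint) : Z -> K b :=
  match u with
  | Node t => z (index t)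
  | Branch B => epsilon (inhabits (fun _ => K0 b)) (branch_limit B)
  end.

Lemma point_functional_branch B : is_branch Tr B -> branch_limit B (point_functional (Branch B)).
Proof. intros HB. exact (epsilon_spec (inhabits (fun _ => K0 b)) (branch_limit B) (exists_branch_limit HB)). Qed.

Lemma point_functional_mem u : in_Tbar Tr u -> Ks (point_functional u).
Proof.
  destruct u as [t|B]; intros Hu.
  - apply D_Ks, z_D.
  - apply (point_functional_branch Hu).
Qed.

(** Treats nodes and branches alike: identities and estimates at nodes beyond [tau i] and below [u]
    carry over to [u]. *)
Lemma point_functional_approx u i x e :
  in_Tbar Tr u -> le' (Node (tau i)) u -> 0 < e ->
  exists n, prefix (tau i) (tau n) /\ le' (Node (tau n)) u /\
    Kabs (z n x - point_functional u x)%K < e.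
Proof.
  destruct u as [t|B]; intros Hu Hi He.
  - exists (index t). rewrite (tau_index Hu). split; [exact Hi|]. split; [apply prefix_refl|].
    simpl. replace (z (index t) x - z (index t) x)%K with (K0 b)
      by (symmetry; apply (Ropp_def (K_ring_theory b))).
    rewrite Kabs_0. auto.
  - destruct (point_functional_branch Hu) as [_ H]. destruct (H x e (tau i) He Hi) as (t & Bt & P & E).
    assert (Tt : Tr t) by (apply Hu; auto).
    exists (index t). simpl. rewrite (tau_index Tt). auto.
Qed.

Lemma le'_node_trans s t u : in_Tbar Tr u -> prefix s t -> le' (Node t) u -> le' (Node s) u.
Proof.
  destruct u as [v|B]; simpl; intros Hu P H.
  - apply prefix_trans with t; auto.
  - apply branch_down with t; auto.
Qed.

Lemma point_functional_below i u :
  in_Tbar Tr u -> le' (Node (tau i)) u -> point_functional u (T (w i)) = z i (T (w i)).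
Proof.
  intros Hu Hi. apply NNPP. intros N.
  destruct (@point_functional_approx u i (T (w i)) (Kabs (z i (T (w i)) - point_functional u (T (w i)))%K))
    as (n & P & _ & H); auto.
  { destruct (Kabs_pos (z i (T (w i)) - point_functional u (T (w i)))%K) as [|E]; auto.
    exfalso. apply N. symmetry. apply Ksub_eq0, Kabs_eq0. auto. }
  rewrite (value_below P) in H. lra.
Qed.

Lemma point_functional_off i u :
  in_Tbar Tr u -> ~ le' (Node (tau i)) u -> point_functional u (T (w i)) = 0%K.
Proof.
  intros Hu Hi. apply NNPP. intros N.
  assert (root : le' (Node (tau 0)) u).
  { rewrite tau_0. destruct u as [t|B]; [exists t; reflexivity|].
    destruct (branch_long 0 Hu) as (s & Bs & _). apply (branch_down (t := s) Hu Bs).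
    exists s. reflexivity. }
  destruct (@point_functional_approx u 0 (T (w i)) (Kabs (0 - point_functional u (T (w i)))%K))
    as (n & _ & Pn & H); auto.
  { destruct (Kabs_pos (0 - point_functional u (T (w i)))%K) as [|E]; auto.
    exfalso. apply N. symmetry. apply Ksub_eq0, Kabs_eq0. auto. }
  rewrite value_off in H; [lra|]. intros P. apply Hi. apply le'_node_trans with (tau n); auto.
Qed.

(** Three errors: replacing [x] by [y j], walking from [i] to a node [n] below [u], and passing from
    that node to [u]. *)
Lemma point_functional_close N j i u x e :
  (j < N)%nat -> in_Tbar Tr u -> le' (Node (tau i)) u -> 0 < e ->
  (forall m, (m < N)%nat -> le' (Node (tau m)) u -> prefix (tau m) (tau i)) ->
  Kabs (point_functional u x - z i x)%K < 2 * C * norm (x - y j)%V + 4 * eta * (/ 2) ^ N + e.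
Proof.
  intros Hj Hu Hi He Hm.
  destruct (@point_functional_approx u i x e Hu Hi He) as (n & P & Pn & H).
  assert (H1 : Kabs (z n (y j) - z i (y j))%K <= 4 * eta * (/ 2) ^ N).
  { apply node_close; auto. intros m HmN Hmn. apply Hm; auto.
    apply le'_node_trans with (tau n); auto. }
  pose proof (bounded_close_at x (y j) (D_linear (z_D n)) (D_bounded (z_D n))
    (D_linear (z_D i)) (D_bounded (z_D i))) as H2.
  rewrite Kabs_sub_sym in H.
  pose proof (Ksub_le b (point_functional u x) (z n x) (z i x)). lra.
Qed.

Definition wedge (t : list nat) (u : tpoint) : Prop := le' (Node t) u.

Lemma wedge_in_subbase t : Tr t -> wedge_subbase Tr (wedge t).
Proof. intros H. exists t. split; auto. left. reflexivity. Qed.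

Lemma wedge_compl_in_subbase t : Tr t -> wedge_subbase Tr (fun u => ~ wedge t u).
Proof. intros H. exists t. split; auto. right. reflexivity. Qed.

(** All points of the neighbourhood lie above a common node [tau i], and above no [tau m] with
    [m < N] except those below [tau i]. Hence [u] and [u'] both have nearly the value of [z i] at
    [x], each comparison having three errors of at most [e / 8]. *)
Lemma point_functional_continuous_at u x e :
  in_Tbar Tr u -> 0 < e ->
  exists l, Forall (wedge_subbase Tr) l /\ Forall (fun V => V u) l /\
    forall u', in_Tbar Tr u' -> Forall (fun V => V u') l ->
      Kabs (point_functional u' x - point_functional u x)%K < e.
Proof.
  intros Hu He.
  destruct (@y_dense x (e / 8 / (2 * C + 1))) as [j Hj].
  { apply Rdiv_lt_0_compat; lra. }
  destruct (@half_pow_small (4 * eta) (e / 8)) as [N0 HN0]; [lra|].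
  set (N := (N0 + S j)%nat). assert (HjN : (j < N)%nat) by (unfold N; lia).
  assert (HN : 4 * eta * (/ 2) ^ N < e / 8) by (apply HN0; unfold N; lia).
  assert (HC : 2 * C * norm (x - y j)%V <= e / 8).
  { pose proof (vnorm_pos (x - y j)%V).
    apply Rmult_lt_compat_l with (r := 2 * C + 1) in Hj; [|lra].
    replace ((2 * C + 1) * (e / 8 / (2 * C + 1))) with (e / 8) in Hj by (field; lra). lra. }
  assert (center : exists i l, Forall (wedge_subbase Tr) l /\ Forall (fun V => V u) l /\
    forall u', in_Tbar Tr u' -> Forall (fun V => V u') l ->
      le' (Node (tau i)) u' /\
      forall m, (m < N)%nat -> le' (Node (tau m)) u' -> prefix (tau m) (tau i)).
  { destruct u as [t|B].
    (* At a node: the wedge of [t], and for each [m < N] the wedge of [tau m] or its complement,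
       whichever contains [t]. *)
    - pose (V := fun m => if excluded_middle_informative (prefix (tau m) t)
        then wedge (tau m) else (fun u => ~ wedge (tau m) u)).
      exists (index t), (wedge t :: map V (seq 0 N)). split; [|split].
      + constructor; [apply wedge_in_subbase, Hu|]. apply Forall_map, Forall_forall. intros m _.
        unfold V. destruct excluded_middle_informative;
          [apply wedge_in_subbase | apply wedge_compl_in_subbase]; auto.
      + constructor; [apply prefix_refl|]. apply Forall_map, Forall_forall. intros m _.
        unfold V. destruct excluded_middle_informative; auto.
      + intros u' Hu' H. apply Forall_cons_iff in H. destruct H as [Ht H].
        rewrite (tau_index Hu). split; auto. intros m Hm Hmu.
        rewrite Forall_map, Forall_forall in H. assert (Hin : In m (seq 0 N)) by (apply in_seq; lia).
        specialize (H m Hin). unfold V in H.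
        destruct excluded_middle_informative; auto. contradiction.
    (* At a branch one wedge is enough: [tau m] with [m < N] is shorter than [s], so it lies below
       [s] as soon as they are comparable. *)
    - destruct (branch_long N Hu) as (s & Bs & Ls).
      assert (Ts : Tr s) by (apply Hu; auto).
      exists (index s), (wedge s :: nil). rewrite (tau_index Ts). split; [|split].
      + constructor; auto. apply wedge_in_subbase; auto.
      + constructor; auto.
      + intros u' Hu' H. apply Forall_cons_iff in H. destruct H as [Hs _]. split; auto.
        intros m Hm Hmu. destruct (@le'_comparable _ _ _ Hu' Hmu Hs) as [P|P]; auto.
        exfalso. apply prefix_length in P. pose proof (length_tau m). lia. }
  destruct center as (i & l & L1 & L2 & H). exists l. split; [|split]; auto.
  intros u' Hu' Hl.
  destruct (H u Hu L2) as [A1 A2]. destruct (H u' Hu' Hl) as [A3 A4].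
  pose proof (@point_functional_close N j i u x (e / 8) HjN Hu A1 ltac:(lra) A2) as B1.
  pose proof (@point_functional_close N j i u' x (e / 8) HjN Hu' A3 ltac:(lra) A4) as B2.
  rewrite Kabs_sub_sym in B1.
  pose proof (Ksub_le b (point_functional u' x) (z i x) (point_functional u x)). lra.
Qed.

Lemma point_functional_continuous :
  continuous_on (wedge_open Tr) (in_Tbar Tr) (@weakstar_open b Z) point_functional.
Proof.
  intros V HV.
  exists (fun u => exists l, Forall (wedge_subbase Tr) l /\ Forall (fun V => V u) l /\
    forall u', in_Tbar Tr u' -> Forall (fun V => V u') l -> V (point_functional u')).
  split.
  - intros u (l & L1 & L2 & L3). exists l. split; [|split]; eauto.
  - intros u Hu. split.
    + intros (l & _ & L2 & L3). auto.
    + intros Vu. destruct (HV _ Vu) as (vs & S1 & S2 & S3).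
      assert (H : exists l, Forall (wedge_subbase Tr) l /\ Forall (fun V => V u) l /\
        forall u', in_Tbar Tr u' -> Forall (fun V => V u') l -> Forall (fun V => V (point_functional u')) vs).
      { clear S3. induction vs as [|v vs IH].
        - exists nil. repeat split; auto.
        - apply Forall_cons_iff in S1. destruct S1 as [(x & a & r & Hr & Hv) S1].
          apply Forall_cons_iff in S2. destruct S2 as [Vu1 S2].
          destruct (IH S1 S2) as (l & L1 & L2 & L3). apply Hv in Vu1.
          destruct (@point_functional_continuous_at u x (r - Kabs (point_functional u x - a)%K))
            as (l' & L1' & L2' & L3'); auto; [lra|].
          exists (l' ++ l). split; [|split]; try (apply Forall_app; auto).
          intros u' Hu' Hl. apply Forall_app in Hl. destruct Hl as [Hl' Hl]. constructor; auto.
          apply Hv. specialize (L3' u' Hu' Hl').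
          pose proof (Ksub_le b (point_functional u' x) (point_functional u x) a). lra. }
      destruct H as (l & L1 & L2 & L3). exists l. split; [|split]; auto.
Qed.

End System.
End Tree.

(** * Choice of the constants and conclusion *)

Lemma Rsup_le (E : R -> Prop) M : 0 <= M -> (forall r, E r -> r <= M) -> Rsup E <= M.
Proof.
  intros HM H. unfold Rsup. destruct excluded_middle_informative as [A|A]; auto.
  destruct completeness as [m Hm]. apply (proj2 Hm). exact H.
Qed.

Lemma dual_norm_le b (X : NormedSpace b) M (f : X -> K b) :
  0 <= M -> bounded_by X M f -> dual_norm X f <= M.
Proof.
  intros HM Hf. apply Rsup_le; auto. intros r (x & Hx & ->).
  eapply Rle_trans; [apply Hf|]. pose proof (vnorm_pos x). nra.
Qed.

Theorem theorem3p1 (b : bool) (W Z : NormedSpace b)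
  (HW : complete W) (HZ : complete Z) (HZsep : separable Z)
  (Rop : W -> Z) (HR : bounded_linear_op W Z Rop)
  (Ks : (Z -> K b) -> Prop) (HKdual : forall f, Ks f -> bounded_linear_fun Z f)
  (HKac : absolutely_convex Z Ks) (HKcpt : compact_in (weakstar_open Z) Ks)
  (eps : R) (Heps : 0 < eps)
  (Hsep : exists A : (W -> K b) -> Prop,
      (forall g, A g -> exists f, Ks f /\ g = (fun w => f (Rop w))) /\
      uncountable A /\ eps_separated W eps A) :
  forall (delta theta : R), 0 < delta -> 0 < theta ->
  forall (T : list nat -> Prop), down_closed T ->
  forall tau : nat -> list nat,
    (forall n, T (tau n)) ->
    (forall n m, tau n = tau m -> n = m) ->
    (forall t, T t -> exists n, tau n = t) ->
    (forall l m, prefix (tau l) (tau m) -> (l <= m)%nat) ->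
  exists (w : list nat -> W) (z : tpoint -> (Z -> K b)),
    (forall s, T s -> sphere W (w s)) /\
    (forall t, in_Tbar T t -> Ks (z t)) /\
    (* (i) *)
    (forall s t, T s -> in_Tbar T t ->
       (le' (Node s) t ->
          z t (Rop (w s)) = z (Node s) (Rop (w s)) /\
          Kgt (z (Node s) (Rop (w s))) (eps / (2 + theta))) /\
       (~ le' (Node s) t -> z t (Rop (w s)) = K0 b)) /\
    (* (ii) *)
    continuous_on (wedge_open T) (in_Tbar T) (weakstar_open Z) z /\
    (* (iii) *)
    basic_seq W (fun m => w (tau m)) (1 + delta) /\
    (* (iv) *)
    (let Z0 := fun y : Z => forall t, T t -> z (Node t) y = K0 b in
     basis_of Z (quot_norm Z Z0) (fun m => Rop (w (tau m))) (fun _ => True) (1 + delta)).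
Proof.
  intros delta theta Hdelta Htheta T HT tau tau_in tau_inj tau_surj tau_mono.
  destruct Hsep as (A & HA & Aunc & Asep).
  destruct HZsep as [y Hy]. destruct HR as (R_add & R_scale & CT0 & HCT0).
  set (CT := Rabs CT0).
  assert (HCT : forall u, norm (Rop u) <= CT * norm u).
  { intros u. eapply Rle_trans; [apply HCT0|]. apply Rmult_le_compat_r; [apply vnorm_pos | apply Rle_abs]. }
  destruct (exists_parent HT tau tau_in tau_inj tau_surj tau_mono) as [par Hpar].
  (* Condensation takes place on [Z] whereas [A] lives on [W]; with one preimage per member of [A],
     distinct members of [G0] stay separated after composition with [Rop]. *)
  pose (kappa := fun g => epsilon (inhabits (fun _ => K0 b)) (fun f => Ks f /\ g = (fun w => f (Rop w)))).
  assert (Hkappa : forall g, A g -> Ks (kappa g) /\ g = (fun w => kappa g (Rop w))) by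
    (intros g Ag; unfold kappa; apply epsilon_spec; auto).
  pose (G0 := fun k => exists g, A g /\ k = kappa g).
  assert (G0unc : ~ countable_set G0).
  { intros [c Hc]. apply (uncountable_not_countable_set (fun _ => K0 b) Aunc).
    exists (fun g => c (kappa g)). intros g g' Ag Ag' E.
    rewrite (proj2 (Hkappa g Ag)), (proj2 (Hkappa g' Ag')).
    rewrite (Hc (kappa g) (kappa g')); auto; [exists g | exists g']; auto. }
  (* A common norm bound comes from uncountability: each chosen functional is bounded by some
     integer, and one integer serves uncountably many. *)
  assert (HC : exists n, ~ countable_set (fun k => G0 k /\ bounded_by Z (INR n) k)).
  { apply NNPP. intros N. apply G0unc.
    apply countable_sub with (fun k => exists n, G0 k /\ bounded_by Z (INR n) k).
    - apply countable_union. intros n. apply NNPP. eauto.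
    - intros k (g & Ag & ->). destruct (HKdual _ (proj1 (Hkappa g Ag))) as (_ & _ & C & HC).
      destruct (INR_archimed 1 C) as [n Hn]; [lra|]. exists n. split; [exists g; auto|].
      intros x. eapply Rle_trans; [apply HC|]. apply Rmult_le_compat_r; [apply vnorm_pos | lra]. }
  destruct HC as [nC HC]. set (C := INR nC) in *. assert (C_pos : 0 <= C) by apply pos_INR.
  assert (Klin : forall k, Ks k -> linear_functional Z k).
  { intros k Hk. destruct (HKdual k Hk) as (k1 & k2 & _). split; auto. }
  assert (HG0 : forall k, G0 k /\ bounded_by Z C k -> linear_functional Z k /\ bounded_by Z C k).
  { intros k [(g & Ag & ->) Bk]. split; auto. apply Klin, Hkappa, Ag. }
  destruct (condensation_points y Hy HG0 HC) as (G & HG & Gunc & Gcond).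
  (* The bound [C] preserves absolute convexity, so all functionals at nodes share it; the branch
     limits are taken in the compact set [Ks]. *)
  pose (D := fun k => Ks k /\ bounded_by Z C k).
  assert (D_convex : absolutely_convex Z D).
  { intros f g a c [Kf Bf] [Kg Bg] Hac. split; [apply HKac; auto|].
    intros x. eapply Rle_trans; [apply (bounded_combination a c Bf Bg)|].
    apply Rmult_le_compat_r; [apply vnorm_pos|]. nra. }
  assert (G_D : forall k, G k -> D k).
  { intros k Gk. destruct (HG k Gk) as [(g & Ag & ->) Bk]. split; auto. apply Hkappa, Ag. }
  assert (G_sep : forall k k', G k -> G k' -> k <> k' ->
    ~ bounded_by W eps (fun w => k (Rop w) - k' (Rop w))%K).
  { intros k k' Gk Gk' N Hb. destruct (HG k Gk) as [(g & Ag & E) _].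
    destruct (HG k' Gk') as [(g' & Ag' & E') _].
    assert (N' : g <> g') by (intros ->; apply N; congruence).
    pose proof (Asep g g' Ag Ag' N') as Hlt.
    rewrite (proj2 (Hkappa g Ag)), (proj2 (Hkappa g' Ag')), <- E, <- E' in Hlt.
    assert (dual_norm W (fun w => k (Rop w) - k' (Rop w))%K <= eps) by (apply dual_norm_le; auto; lra).
    lra. }
  set (a := eps / (2 + theta)).
  assert (Ha : 0 < a) by (apply Rdiv_lt_0_compat; lra).
  assert (Ha' : 2 * a < eps).
  { apply Rmult_lt_reg_r with (2 + theta); [lra|]. unfold a.
    replace (2 * (eps / (2 + theta)) * (2 + theta)) with (2 * eps) by (field; lra). nra. }
  (* A midpoint: [2 * r < eps] for the distance argument, [a < r] to afford the factor [lam]. *)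
  set (r := (a + eps / 2) / 2). assert (Hr : a < r) by (unfold r; lra).
  assert (Hr' : 2 * r < eps) by (unfold r; lra).
  (* Makes [lam * r] the midpoint of [a] and [r]. *)
  set (lam := (a / r + 1) / 2).
  assert (Har : a / r < 1).
  { apply Rmult_lt_reg_r with r; [lra|]. replace (a / r * r) with a by (field; lra). lra. }
  assert (Har' : 0 < a / r) by (apply Rdiv_lt_0_compat; lra).
  assert (Hlam : 0 < lam) by (unfold lam; lra). assert (Hlam' : lam < 1) by (unfold lam; lra).
  assert (Hlr : a < lam * r).
  { replace (lam * r) with ((a + r) / 2) by (unfold lam; field; lra). lra. }
  (* Solves [(1 + delta) * (1 - nu) = 1]. *)
  set (nu := delta / (1 + delta)). assert (Hnu : 0 < nu) by (apply Rdiv_lt_0_compat; lra).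
  assert (CT_pos : 0 <= CT) by apply Rabs_pos.
  (* Taken for both [kap] and [eta]: the total loss [4 * kap * CT / (lam * r)] becomes
     [delta * CT / (CT + 1)], and [CT + 1] avoids a zero divisor. *)
  set (kap := delta * (lam * r) / (4 * (CT + 1))).
  assert (Hkap : 0 < kap).
  { apply Rdiv_lt_0_compat; [apply Rmult_lt_0_compat|]; lra. }
  destruct (@exists_system b W Z Rop CT R_add R_scale CT_pos HCT D C D_convex C_pos
    (fun k H => Klin k (proj1 H)) (fun k H => proj2 H) G eps G_D Gunc Gcond G_sep y par
    (fun n H => proj1 (Hpar n H)) lam r kap kap nu Hlam Hlam' (Rlt_trans _ _ _ Ha Hr) Hr' Hkap Hkap Hnu delta HZ Hy Hdelta)
    as (w & z & w1 & zD & zdiag & zker & zinh & zclose & wbasic & zbasis).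
  { unfold nu. right. field. lra. }
  { unfold kap. apply Rle_trans with (delta * (CT / (CT + 1))).
    - right. field. split; [lra|]. split; lra.
    - rewrite <- (Rmult_1_r delta) at 2. apply Rmult_le_compat_l; [lra|].
      apply Rmult_le_reg_r with (CT + 1); [lra|].
      replace (CT / (CT + 1) * (CT + 1)) with CT by (field; lra). lra. }
  pose proof (index_tau T tau tau_in tau_inj tau_surj) as Hit.
  pose proof (tau_index T tau tau_surj) as Hti.
  exists (fun s => w (index tau s)), (point_functional tau Ks z).
  assert (zD_Ks : forall k, D k -> Ks k) by (intros k H; apply H).
  split; [|split; [|split; [|split; [|split]]]].
  - intros s Hs. apply w1.
  - apply (point_functional_mem T tau D zD_Ks HKcpt z zD).
  - intros s t Hs Ht. rewrite <- (Hti s Hs). rewrite Hit. split.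
    + intros Hle. split.
      * transitivity (z (index tau s) (Rop (w (index tau s)))).
        -- apply (point_functional_below T tau tau_inj tau_surj tau_mono Rop D zD_Ks HKcpt par Hpar w z zD zinh); auto.
        -- simpl. rewrite Hit. reflexivity.
      * simpl. rewrite Hit. destruct (zdiag (index tau s)) as (t' & Ht' & ->). apply Kgt_ofR. lra.
    + apply (point_functional_off HT tau tau_in tau_surj tau_mono Rop D zD_Ks HKcpt par Hpar w z zD zker zinh); auto.
  - apply (point_functional_continuous HT tau tau_in tau_inj tau_surj tau_mono D C_pos (fun k H => Klin k (proj1 H))
      (fun k H => proj2 H) zD_Ks HKcpt y Hy par Hpar Hkap z zD zclose).
  - replace (fun m => w (index tau (tau m))) with w; auto.
    apply functional_extensionality. intros m. rewrite Hit. reflexivity.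
  - cbv zeta.
    replace (fun m => Rop (w (index tau (tau m)))) with (fun m => Rop (w m)) by
      (apply functional_extensionality; intros m; rewrite Hit; reflexivity).
    replace (fun x : Z => forall t, T t -> point_functional tau Ks z (Node t) x = K0 b)
      with (fun x => forall n, z n x = K0 b); [exact zbasis|].
    apply functional_extensionality. intros x. apply propositional_extensionality. split.
    + intros H t _. apply H.
    + intros H n. rewrite <- (Hit n). apply (H (tau n)). auto.
Qed.
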